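(* Let $S$ be a closed orientable surface of genus $g\ge 2$ and let $X\in\mathcal{T}(S)$ be a point of its Teichmüller space. Then there exists $D=D(X)>0$ such that for any weighted multi-curve $c$ on $X$, every extremal metric $\rho$ for $c$ on $X$ with $\mathrm{Area}(\rho)=1$ has diameter at most $D$, i.e. $d_\rho(x,y)\le D$ for all $x,y\in X$.
   Context: $X$ is regarded as a marked Riemann surface. A multi-curve is a finite family of (simple or non-simple) closed curves; closed curves are taken to be homotopically nontrivial. A weighted multi-curve is a finite combination $\sum a_i\gamma_i$ of closed curves with positive weights $a_i$. An allowable conformal metric on $X$ is $\rho(z)|dz|$ with $\rho$ Borel measurable, non-negative, locally $L^2$, and with $\mathrm{Area}(\rho):=\int_X\rho^2\,dx\,dy$ neither $0$ nor $\infty$. For a path $\gamma$, $L_\rho(\gamma):=\int_\gamma\rho|dz|$. For a closed curve $\gamma$, $\ell_\rho(\gamma):=\inf L_\rho(\gamma')$ over $\gamma'$ freely homotopic to $\gamma$; for a weighted multi-curve, $\ell_\rho(\sum a_i\gamma_i)=\sum a_i\ell_\rho(\gamma_i)$. The extremal length of $c$ is $\mathrm{Ext}_X(c):=\sup_\rho \ell_\rho(c)^2/\mathrm{Area}(\rho)$ over all allowable conformal metrics. A conformal metric $\rho$ is called an extremal metric for $c$ if $\mathrm{Ext}_X(c)=\ell_\rho(c)^2/\mathrm{Area}(\rho)$. The $\rho$-distance is $d_\rho(x,y)=\inf_\gamma L_\rho(\gamma)$ over all arcs $\gamma$ in $X$ connecting $x$ and $y$. *)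

(* Defs.v *)
From HB Require Import structures.
From Stdlib Require Import Relation_Operators.
From mathcomp Require Import all_boot all_order all_algebra.
From mathcomp Require Import complex.
From mathcomp Require Import all_classical all_reals all_analysis.

Set Implicit Arguments.
Unset Strict Implicit.
Unset Printing Implicit Defensive.

Import Order.TTheory GRing.Theory Num.Theory numFieldNormedType.Exports.

Local Open Scope classical_set_scope.
Local Open Scope ring_scope.

(* The boundary of the unit disc, cut into 4g arcs: the k-th arc is the image
   of [k, k + 1]. *)
Definition disc_boundary (R : realType) (g : nat) (t : R) : R * R :=
  let theta := pi *+ 2 * t / (4 * g)%:R in (cos theta, sin theta).

(* The edge identifications of the 4g-gon with boundary word
   a_0 b_0 a_0^-1 b_0^-1 ... a_(g-1) b_(g-1) a_(g-1)^-1 b_(g-1)^-1. *)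
Inductive edge_pairing (R : realType) (g : nat) : R * R -> R * R -> Prop :=
| pair_a (j : nat) (s : R) : (j < g)%N -> 0 <= s <= 1 ->
    edge_pairing g (disc_boundary g ((4 * j)%:R + s))
                   (disc_boundary g ((4 * j + 3)%:R - s))
| pair_b (j : nat) (s : R) : (j < g)%N -> 0 <= s <= 1 ->
    edge_pairing g (disc_boundary g ((4 * j + 1)%:R + s))
                   (disc_boundary g ((4 * j + 4)%:R - s)).

Definition unit_disc (R : realType) : set (R * R) :=
  [set z | z.1 ^+ 2 + z.2 ^+ 2 <= 1].

(* S is homeomorphic to the 4g-gon with its edges identified.  Since the disc is
   compact and S is Hausdorff, the map q below is automatically a quotient
   map. *)
Definition closed_orientable_surface (R : realType) (g : nat)
    (S : topologicalType) : Prop :=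
  hausdorff_space S /\
  exists q : R * R -> S,
    [/\ {within @unit_disc R, continuous q},
        forall x, exists2 z, @unit_disc R z & q z = x
      & forall z w, @unit_disc R z -> @unit_disc R w ->
          (q z = q w <-> clos_refl_sym_trans _ (@edge_pairing R g) z w)].

Record chart (R : realType) (X : topologicalType) := Chart {
  chart_dom : set X;
  chart_map :> X -> (R[i])^o;
  chart_inv : (R[i])^o -> X }.

Definition is_chart (R : realType) (X : topologicalType) (phi : chart R X) :=
  let D := chart_dom phi in
  [/\ open D, open (phi @` D),
      {within D, continuous phi},
      {within phi @` D, continuous (chart_inv phi)}
    & {in D, cancel phi (chart_inv phi)}].

Definition transition (R : realType) (X : topologicalType)
    (phi psi : chart R X) : (R[i])^o -> (R[i])^o := psi \o chart_inv phi.

(* Derivability in the normed R[i]-module (R[i])^o is complex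
   differentiability. *)
Record riemann_surface (R : realType) := RiemannSurface {
  surface_space :> topologicalType;
  atlas : set (chart R surface_space);
  surface_hausdorff : hausdorff_space surface_space;
  surface_connected : connected [set: surface_space];
  atlas_chart : forall phi, atlas phi -> is_chart phi;
  atlas_cover : forall p, exists2 phi, atlas phi & chart_dom phi p;
  atlas_holomorphic : forall phi psi p, atlas phi -> atlas psi ->
    chart_dom phi p -> chart_dom psi p ->
    derivable (transition phi psi) (phi p) 1 }.

Definition homeomorphism (S T : topologicalType) (f : S -> T) : Prop :=
  continuous f /\
  exists f' : T -> S, [/\ continuous f', cancel f f' & cancel f' f].

(* A representative of a point of the Teichmueller space of S. *)
Record marked_surface (R : realType) (S : topologicalType) := MarkedSurface {
  marked_riemann :> riemann_surface R;
  marking : S -> marked_riemann;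
  marking_homeo : homeomorphism marking }.

(* |z| as an element of R; the norm of R[i] takes its values in R[i]. *)
Definition cnorm (R : realType) (z : R[i]) : R := complex.Re `|z|.

Section Metrics.
Context {R : realType} {X : riemann_surface R}.
Implicit Types (phi psi : chart R X) (gamma : R -> X).

(* A density rho gives, for each chart, the function rho(z) of the expression
   rho(z)|dz| in that chart. *)
Definition density := chart R X -> (R[i])^o -> R.
Implicit Types rho : density.

(* Chart coordinates as a point of R * R, which carries the Borel sigma-algebra
   and the Lebesgue measure. *)
Definition plane_coord phi (p : X) : R * R :=
  (complex.Re (phi p), complex.Im (phi p)).

Definition area_in rho phi (E : set X) : \bar R :=
  (\int[(@lebesgue_measure R) \x (@lebesgue_measure R)]_(z in plane_coord phi @` E)
     ((rho phi (z.1 +i* z.2)%C) ^+ 2)%:E)%E.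

(* The integral over X of rho^2 dx dy, as the supremum over the finite families
   of disjoint Borel pieces each of which lies in one chart. *)
Definition area rho : \bar R :=
  ereal_sup [set A | exists (n : nat) (phi : 'I_n -> chart R X)
                            (E : 'I_n -> set X),
    [/\ forall i, atlas (phi i) /\ E i `<=` chart_dom (phi i),
        forall i, measurable (plane_coord (phi i) @` E i),
        trivIset [set: 'I_n] E
      & A = (\sum_(i < n) area_in rho (phi i) (E i))%E]].

Record allowable rho : Prop := Allowable {
  density_ge0 : forall phi p, atlas phi -> chart_dom phi p ->
    0 <= rho phi (phi p);
  density_measurable : forall phi, atlas phi ->
    measurable_fun (plane_coord phi @` chart_dom phi)
      (fun z : R * R => rho phi (z.1 +i* z.2)%C);
  density_transition : forall phi psi p, atlas phi -> atlas psi ->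
    chart_dom phi p -> chart_dom psi p ->
    rho phi (phi p) =
      rho psi (psi p) * cnorm ('D_1 (transition phi psi) (phi p));
  density_locally_L2 : forall phi p, atlas phi -> chart_dom phi p ->
    exists E : set X, [/\ open E, E p, E `<=` chart_dom phi
                        & (area_in rho phi E < +oo)%E];
  area_neq0 : area rho <> 0%E;
  area_neqy : area rho <> +oo%E }.

Definition polygon_length (f : R -> (R[i])^o) (a b : R) (s : seq R) : R :=
  \sum_(0 <= n < size s)
    cnorm (f (nth b (a :: s) n.+1) - f (nth b (a :: s) n)).

Definition arc_length (f : R -> (R[i])^o) (a b : R) : \bar R :=
  ereal_sup [set (polygon_length f a b s)%:E | s in itv_partition a b].

(* s is an arc length function on [a, b] of the curve f, which is thus
   rectifiable on [a, b]; the Lebesgue-Stieltjes measure of s on ]a, b] is then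
   the element of arc length |dz| along f. *)
Definition arc_length_function (f : R -> (R[i])^o) (a b : R)
    (s : cumulative R R) : Prop :=
  forall t u, a <= t -> t <= u -> u <= b -> (s u - s t)%:E = arc_length f t u.

(* The integral of rho |dz| along gamma restricted to [a, b], computed on a
   subdivision of [a, b] into intervals sent into the domain of one chart. *)
Inductive line_integral rho gamma : R -> R -> \bar R -> Prop :=
| line_integral_chart phi (a b : R) (s : cumulative R R) :
    atlas phi -> a <= b -> (forall t, a <= t <= b -> chart_dom phi (gamma t)) ->
    arc_length_function (phi \o gamma) a b s ->
    line_integral rho gamma a b
      (\int[lebesgue_stieltjes_measure s]_(t in `]a, b]%classic)
         (rho phi (phi (gamma t)))%:E)%E
| line_integral_cat (a b c : R) (k l : \bar R) :
    line_integral rho gamma a b k -> line_integral rho gamma b c l ->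
    line_integral rho gamma a c (k + l)%E.

(* For an allowable rho and a rectifiable path the infimum is taken over a
   singleton; a path that is not rectifiable has length +oo. *)
Definition path_length rho gamma : \bar R :=
  ereal_inf [set l | line_integral rho gamma 0 1 l].

(* Paths are maps from R to X of which only the restriction to [0, 1]
   matters. *)
Definition is_path gamma : Prop := {within `[0, 1], continuous gamma}.

Definition closed_curve gamma : Prop := is_path gamma /\ gamma 0 = gamma 1.

Definition freely_homotopic gamma gamma' : Prop :=
  exists H : R * R -> X,
    [/\ {within `[0, 1] `*` `[0, 1], continuous H},
        forall t, 0 <= t <= 1 -> H (0, t) = gamma t,
        forall t, 0 <= t <= 1 -> H (1, t) = gamma' t
      & forall s, 0 <= s <= 1 -> H (s, 0) = H (s, 1)].

Definition homotopically_nontrivial gamma : Prop :=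
  forall p : X, ~ freely_homotopic gamma (fun=> p).

Definition curve_length rho gamma : \bar R :=
  ereal_inf [set path_length rho gamma' | gamma' in
    [set gamma' | closed_curve gamma' /\ freely_homotopic gamma gamma']].

Definition rho_dist rho (x y : X) : \bar R :=
  ereal_inf [set path_length rho gamma | gamma in
    [set gamma | [/\ is_path gamma, gamma 0 = x & gamma 1 = y]]].

End Metrics.
Arguments density {R} X.

(* The combination is nonempty: for the empty one every length vanishes. *)
Record weighted_multicurve (R : realType) (X : riemann_surface R) :=
    WeightedMulticurve {
  multicurve_size : nat;
  multicurve_weight : 'I_multicurve_size -> R;
  multicurve_curve : 'I_multicurve_size -> R -> X;
  multicurve_nonempty : (0 < multicurve_size)%N;
  multicurve_weight_gt0 : forall i, 0 < multicurve_weight i;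
  multicurve_closed : forall i, closed_curve (multicurve_curve i);
  multicurve_nontrivial :
    forall i, homotopically_nontrivial (multicurve_curve i) }.

Section ExtremalLength.
Context {R : realType} {X : riemann_surface R}.
Implicit Types (c : weighted_multicurve X) (rho : density X).

Definition multicurve_length rho c : \bar R :=
  (\sum_(i < multicurve_size c)
     (multicurve_weight i)%:E * curve_length rho (multicurve_curve i))%E.

Definition length_area_ratio c rho : \bar R :=
  (multicurve_length rho c ^+ 2 / area rho)%E.

Definition extremal_length c : \bar R :=
  ereal_sup [set length_area_ratio c rho | rho in @allowable R X].

Definition extremal_metric c rho : Prop :=
  allowable rho /\ extremal_length c = length_area_ratio c rho.

End ExtremalLength.

(* Main.v *)
Require Import Defs.
From HB Require Import structures.
From Stdlib Require Import Relation_Operators.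
From mathcomp Require Import all_boot all_order all_algebra.
From mathcomp Require Import complex.
From mathcomp Require Import all_classical all_reals all_analysis.
From mathcomp Require Import measurable_realfun.
From mathcomp Require Import ring lra.

(** Let [rho] be extremal of area 1 and let [{h < r}] be a coordinate square.
    Fubini and Cauchy-Schwarz in the ring [{r <= h < 4r}] of [rho]-area [e^2]
    give a square [{h = s}], [2r < s < 3r], of [rho]-length [O(e)].  Replace [rho]
    by [0] on [{h < r}] and add a flat metric of size [O(e/r)] on [{h <= 2r}]: a
    closed curve entering [{h < r}] pays more than the cost of rerouting it along
    [{h = s}], so no length decreases, and extremality bounds the area of
    [{h < r}] by [O(e^2)].  Hence the [rho]-area of concentric squares decays
    geometrically, uniformly in the curve [c] and in [rho], and averaging over [w]
    the [rho]-lengths of the segments from [p] to [w] bounds the [rho]-distances in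
    a fixed square; connectedness and compactness of [X] conclude. *)

Set Implicit Arguments.
Unset Strict Implicit.
Unset Printing Implicit Defensive.

Import Order.TTheory GRing.Theory Num.Theory numFieldNormedType.Exports.

Local Open Scope classical_set_scope.
Local Open Scope ring_scope.

(** * Lebesgue measure in the plane *)

(** The comparison of ratios needs two facts before extremality says anything: the curves of [c]
    have finite [rho]-length, and the extremal length is positive. After that only orders of
    magnitude matter: whatever the constant [C] in a bound of the inner area by [C] times the ring
    area, adding [C] times the inner area to both sides gives decay with ratio [C / (1 + C) < 1].
    This tolerance shapes the development. Squares replace round discs, so that Fubini applies in
    Cartesian coordinates, and one-sided estimates with explicit, wasteful factors replace the
    change of variables formula. On the other hand [rho] is only measurable while lengths are tested
    on all rectifiable curves, so the lower bound for crossing a ring comes from a growth estimate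
    along Stieltjes arc-length measures. The decay is what makes the final average converge: by
    Cauchy-Schwarz alone the average over radial segments is bounded by the integral of [1 / t],
    which diverges logarithmically, and the geometric gain in area turns it into a convergent
    series. *)

Section DyadicCells.
Context {R : realType}.
Implicit Types (k : int * int) (z w : R * R).

(** Half-open dyadic squares given by integer parts: disjointness within a generation and nesting
    between generations become equalities of integers. *)
Definition cell (n : nat) (k : int * int) : set (R * R) :=
  [set z | Num.floor (2 ^+ n * z.1) = k.1 /\ Num.floor (2 ^+ n * z.2) = k.2].

Lemma cellX n k : cell n k =
  [set x | Num.floor (2 ^+ n * x) = k.1] `*` [set x | Num.floor (2 ^+ n * x) = k.2].
Proof. by []. Qed.

Lemma floor_cellE n (j : int) : [set x : R | Num.floor (2 ^+ n * x) = j] =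
  `[j%:~R / 2 ^+ n, (j + 1)%:~R / 2 ^+ n[%classic.
Proof.
apply/seteqP; split => x /=; rewrite in_itv/= => h.
- by rewrite ler_pdivrMr ?exprn_gt0// ltr_pdivlMr ?exprn_gt0// ![x * _]mulrC
    -h floor_le floorD1_gt.
- move: h; rewrite ler_pdivrMr ?exprn_gt0// ltr_pdivlMr ?exprn_gt0// ![x * _]mulrC.
  by move/floor_def.
Qed.

Lemma measurable_cell n k : measurable (cell n k).
Proof.
by rewrite cellX; apply: measurableX; rewrite floor_cellE; exact: measurable_itv.
Qed.

Lemma cell_dist n k z w : cell n k z -> cell n k w -> `|z - w| <= (2 ^+ n)^-1.
Proof.
have key x y : Num.floor (2 ^+ n * x) = Num.floor (2 ^+ n * y) ->
    `|x - y| <= (2 ^+ n)^-1 :> R.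
  move=> xy; rewrite -(ler_pM2l (exprn_gt0 n (@ltr0n R 2))) mulfV ?expf_neq0//.
  rewrite -{1}(@ger0_norm _ (2 ^+ n)) ?exprn_ge0// -normrM mulrBr.
  have := floor_le (2 ^+ n * x); have := floorD1_gt (2 ^+ n * x).
  have := floor_le (2 ^+ n * y); have := floorD1_gt (2 ^+ n * y).
  rewrite xy intrD; set f := (X in X%:~R); move=> a b c d.
  by rewrite ler_norml; apply/andP; split; lra.
move=> [z1 z2] [w1 w2]; rewrite /Num.norm/= ge_max.
by apply/andP; split; apply: key; [rewrite z1 w1|rewrite z2 w2].
Qed.

(** An integer [f] satisfies [f <= 2 ^ n * x] exactly when [2 * f] is at most the integer part of
    [2 ^ n.+1 * x], so the finer integer part determines the coarser one. *)
Lemma cell_nested n z w : 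
  Num.floor (2 ^+ n.+1 * z.1) = Num.floor (2 ^+ n.+1 * w.1) ->
  Num.floor (2 ^+ n.+1 * z.2) = Num.floor (2 ^+ n.+1 * w.2) ->
  Num.floor (2 ^+ n * z.1) = Num.floor (2 ^+ n * w.1) /\
  Num.floor (2 ^+ n * z.2) = Num.floor (2 ^+ n * w.2).
Proof.
have key (x y : R) : Num.floor (2 ^+ n.+1 * x) = Num.floor (2 ^+ n.+1 * y) ->
    Num.floor (2 ^+ n * x) <= Num.floor (2 ^+ n * y).
  move=> xy; rewrite floor_ge_int; set f := Num.floor _.
  have e2 : 2 * f%:~R = (2 * f)%:~R :> R by rewrite intrM.
  rewrite -(ler_pM2l (@ltr0n R 2)) mulrA -exprS e2 -floor_ge_int -xy.
  by rewrite floor_ge_int -e2 exprS -mulrA ler_pM2l// floor_le.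
by move=> h1 h2; split; apply/eqP; rewrite eq_le !key.
Qed.

Definition cells_in (O : set (R * R)) (n : nat) : set (R * R) :=
  \bigcup_(k in [set k | cell n k `<=` O]) cell n k.

(** Reindexing over [nat] through the encoding of pairs, as countable additivity is stated for
    sequences; codes outside [S] give the empty set. *)
Lemma cells_in_bigcup n (S : set (int * int)) :
  \bigcup_(k in S) cell n k =
  \bigcup_m (if pickle_inv m is Some k then if k \in S then cell n k else set0
             else set0).
Proof.
apply/seteqP; split => z.
- by move=> [k Sk kz]; exists (pickle k); [exact: I|rewrite pickleK_inv mem_set].
- move=> [m _]; case: pickle_inv => // k; case: ifPn => // /set_mem Sk kz.
  by exists k.
Qed.

Lemma trivIset_cells n (S : set (int * int)) :
  trivIset setT (fun m => if pickle_inv m is Some k then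
    if k \in S then cell n k else set0 else set0).
Proof.
apply/trivIsetP => i j _ _ ij; apply/seteqP; split => // z [].
have := @pickle_invK (int * int)%type i; have := @pickle_invK (int * int)%type j.
case: pickle_inv => //= kj ej; case: pickle_inv => //= ki ei.
case: ifPn => // _; case: ifPn => // _ [a b] [c d]; case/eqP: ij.
rewrite -ei -ej; congr pickle.
by case: ki kj a b c d {ei ej} => [? ?] [? ?]/= -> -> -> ->.
Qed.

Lemma measurable_cells n (S : set (int * int)) :
  measurable (\bigcup_(k in S) cell n k).
Proof.
rewrite cells_in_bigcup; apply: bigcupT_measurable => m.
by case: pickle_inv => // k; case: ifPn => // _; exact: measurable_cell.
Qed.

Lemma cells_in_nd (O : set (R * R)) : {homo cells_in O : m n / (m <= n)%N >-> m `<=` n}.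
Proof.
move=> m n mn; rewrite -(subnK mn); elim: (n - m)%N => // {mn}d IH.
apply: (subset_trans IH); rewrite addSn; move: (d + m)%N => {IH}p z [k kO [kz1 kz2]].
exists (Num.floor (2 ^+ p.+1 * z.1), Num.floor (2 ^+ p.+1 * z.2)) => //= w [/= w1 w2].
by apply: kO; have [e1 e2] := cell_nested w1 w2; split; rewrite ?e1 ?e2.
Qed.

Lemma open_cells_in (O : set (R * R)) : open O -> O = \bigcup_n cells_in O n.
Proof.
move=> oO; apply/seteqP; split => z; last by move=> [n _ [k kO]]; exact: kO.
move=> Oz; have /nbhs_ballP[e/= e0 eO] : nbhs z O by exact: open_nbhs_nbhs.
have [n ne] : exists n, (2 ^+ n)^-1 < e.
  have [n _ /(_ n (leqnn n)) hn] := near_infty_natSinv_lt (PosNum e0).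
  exists n; apply: le_lt_trans hn => /=.
  rewrite lef_pV2 ?posrE ?exprn_gt0// -natrX ler_nat.
  exact: ltn_expl.
exists n => //; exists (Num.floor (2 ^+ n * z.1), Num.floor (2 ^+ n * z.2)) => //= w kw.
apply: eO; rewrite -ball_normE/=; apply: le_lt_trans ne.
by apply: cell_dist kw.
Qed.

(** The sigma-algebra is the product one; it contains the open sets because each is a countable
    union of dyadic rectangles. *)
Lemma open_measurable2 (O : set (R * R)) : open O -> measurable O.
Proof.
move=> /open_cells_in ->; apply: bigcupT_measurable => n; exact: measurable_cells.
Qed.

End DyadicCells.

Lemma cvgn_ereal_lt {R : realType} (u : (\bar R)^nat) (l e : \bar R) :
  u n @[n --> \oo] --> l -> (l < e)%E -> exists n, (u n < e)%E.
Proof.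
move=> ul le.
have /ul [n _ /(_ n (leqnn n)) hn] : nbhs l [set y | (y < e)%E].
  by apply: open_nbhs_nbhs; split => //; exact: open_ereal_lt_ereal.
by exists n.
Qed.

Lemma cvgn_ereal_le {R : realType} (u : (\bar R)^nat) (l c : \bar R) :
  u n @[n --> \oo] --> l -> (forall n, u n <= c)%E -> (l <= c)%E.
Proof.
move=> ul uc; rewrite leNgt; apply/negP => cl.
have /ul [n _ /(_ n (leqnn n)) /= hn] : nbhs l [set y | (c < y)%E].
  by apply: open_nbhs_nbhs; split => //; exact: open_ereal_gt_ereal.
by have := lt_le_trans hn (uc n); rewrite ltxx.
Qed.

Notation plane R := (measurableTypeR R * measurableTypeR R)%type.

(* Lebesgue measure lives on [measurableTypeR R], whose display differs from
   that of [R]; the measurable sets are the same up to conversion. *)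
Lemma le_plane_measure {R : realType} (m : {measure set (plane R) -> \bar R})
    (A B : set (R * R)) : measurable A -> measurable B -> A `<=` B ->
  (m A <= m B)%E.
Proof. by move=> mA mB; exact: (@le_measure _ _ _ m A B (mem_set mA) (mem_set mB)). Qed.

(** * Regularity of finite measures on the plane *)

Section RegularClosure.
Context {R : realType}.
Variable m : {measure set (plane R) -> \bar R}.
Hypothesis m_fin : (m setT < +oo)%E.
Implicit Types (A : set (R * R)).

(** Approximation from outside and inside at once, since outer approximation alone is not visibly
    stable under complements. *)
Let regular : set (set (R * R)) := [set A | measurable A /\
  forall e : R, 0 < e -> exists O F : set (R * R),
   [/\ open O, closed F, F `<=` A, A `<=` O & (m (O `\` F) < e%:E)%E]].

Let mfin A : measurable A -> (m A < +oo)%E.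
Proof.
by move=> mA; apply: le_lt_trans m_fin; apply: le_plane_measure.
Qed.

Let mO A : open A -> measurable A. Proof. exact: open_measurable2. Qed.

Let mF A : closed A -> measurable A.
Proof. by move=> cA; rewrite -(setCK A); apply: measurableC; apply: mO; exact: closed_openC. Qed.

Let regularC A : regular A -> regular (~` A).
Proof.
move=> [mA rA]; split; first exact: measurableC.
move=> e /rA[V [F [oO cF FA AO h]]]; exists (~` F), (~` V); split => //.
- exact: closed_openC.
- exact: open_closedC.
- exact: subsetC.
- exact: subsetC.
- by rewrite setDE setCK setIC -setDE.
Qed.

(** The outer open sets can be united over all [n], the inner closed sets only over finitely many;
    continuity from above of the finite measure [m] tells where to stop. *)
Let regular_bigcup (A : (set (R * R))^nat) :
  (forall n, regular (A n)) -> regular (\bigcup_n A n).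
Proof.
move=> rA; split; first by apply: bigcupT_measurable => n; have [] := rA n.
(* The errors sum to [e / 2]; the other half of [e] leaves room for the finite cutoff. *)
move=> e e0; pose d n : R := e / 2 / (2 ^ n.+1)%:R.
have d0 n : 0 < d n by rewrite !divr_gt0// ltr0n expn_gt0.
have h n : exists OF : set (R * R) * set (R * R), [/\ open OF.1, closed OF.2,
    OF.2 `<=` A n, A n `<=` OF.1 & (m (OF.1 `\` OF.2) < (d n)%:E)%E].
  by have [_ /(_ _ (d0 n))[V [F OF]]] := rA n; exists (V, F).
have {h}[OF hOF] := choice h.
pose O := \bigcup_n (OF n).1; pose F n := \bigcup_(i < n) (OF i).2.
have oO : open O by apply: bigcup_open => n _; have [] := hOF n.
have cF n : closed (F n).
  rewrite /F; elim: n => [|n IH]; first by rewrite II0 bigcup_set0; exact: closed0.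
  rewrite IIS setUC bigcup_setU1; apply: closedU => //; by have [] := hOF n.
have Fnd : {homo F : m n / (m <= n)%N >-> m `<=` n}.
  by move=> i j ij z [k /= ki]; exists k => //=; exact: leq_trans ij.
have mDF n : measurable (O `\` F n) by apply: measurableD; [exact: mO|exact: mF].
have cvgm : m (O `\` F n) @[n --> \oo] --> m (\bigcap_n (O `\` F n)).
  apply: nonincreasing_cvg_mu => //.
  - exact: mfin.
  - exact: bigcapT_measurable.
  - move=> i j ij; apply/subsetPset => z [Oz nF]; split => //.
    by move=> /(Fnd _ _ ij).
have lim_small : (m (\bigcap_n (O `\` F n)) <= (e / 2)%:E)%E.
  apply: (@le_trans _ _ (\sum_(n <oo) m ((OF n).1 `\` (OF n).2))%E).
    apply: measure_sigma_subadditive => [n||z hz].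
    - have [? ? _ _ _] := hOF n; apply: measurableD; [exact: mO|exact: mF].
    - exact: bigcapT_measurable.
    - have [[n _ On] _] := hz 0%N Logic.I; exists n => //; split => // Fz.
      by have [_] := hz n.+1 Logic.I; apply; exists n => /=.
  apply: (@le_trans _ _ (\sum_(n <oo) (d n)%:E)%E).
    by apply: lee_nneseries => // n _; have [_ _ _ _ /ltW] := hOF n.
  by apply: epsilon_trick0; rewrite divr_ge0// ltW.
have [n hn] : exists n, (m (O `\` F n) < e%:E)%E.
  have lt : (m (\bigcap_n (O `\` F n)) < e%:E)%E.
    by apply: le_lt_trans lim_small _; rewrite lte_fin ltr_pdivrMr// ltr_pMr// ltr1n.
  exact: cvgn_ereal_lt cvgm lt.
exists O, (F n); split => //.
- by apply: bigcup_sub => i /= _ z Fz; exists i => //; have [_ _ FA _ _] := hOF i; exact: FA.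
- by apply: subset_bigcup => i _; have [] := hOF i.
Qed.

Let regular_sigma : sigma_algebra setT regular.
Proof.
split.
- split => // e e0; exists set0, set0; split; rewrite ?setD0 ?measure0 ?lte_fin//.
  exact: closed0.
- by move=> A /regularC; rewrite setTD.
- exact: regular_bigcup.
Qed.

(** Open rays generate the Borel sets of the line, and the preimage of an open ray is exhausted by
    preimages of closed rays. With [p] a coordinate projection this makes all cylinders regular. *)
Let regular_ray (p : R * R -> R) : continuous p -> forall B : set R, measurable B ->
  regular (p @^-1` B).
Proof.
move=> cp; have mp : measurable_fun setT p.
  apply: (measurability _ (RGenOpens.measurableE R)).
  move=> _ [_ [a [b ->] <-]]; rewrite setTI; apply: mO.
  by apply: open_comp => [z _|]; [exact: cp|exact: interval_open].
have : @measurable _ R `<=` [set B : set R | regular (p @^-1` B)].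
  have -> : @measurable _ R = (@RGenOInfty.G R).-sigma.-measurable.
    exact: RGenOInfty.measurableE.
  apply: smallest_sub.
    split.
    - by rewrite /= preimage_set0; have [] := regular_sigma.
    - by move=> A /= rA; rewrite setTD preimage_setC; exact: regularC.
    - by move=> A rA /=; rewrite preimage_bigcup; exact: regular_bigcup.
  move=> _ [x ->]/=; split.
    by rewrite -[X in measurable X]setTI; apply: mp => //; exact: measurable_itv.
  move=> e e0; pose F n := p @^-1` `[x + n.+1%:R^-1, +oo[%classic.
  have cF n : closed (F n).
    apply: closed_comp => [z _|]; first exact: cp.
    exact: interval_closed.
  pose O := p @^-1` `]x, +oo[%classic.
  have oO : open O by apply: open_comp => [z _|]; [exact: cp|exact: interval_open].
  have mDF n : measurable (O `\` F n) by apply: measurableD; [exact: mO|exact: mF].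
  have cvgm : m (O `\` F n) @[n --> \oo] --> m (\bigcap_n (O `\` F n)).
    apply: nonincreasing_cvg_mu => //.
    - exact: mfin.
    - exact: bigcapT_measurable.
    - move=> i j ij; apply/subsetPset => z [Oz nF]; split => //.
      apply: contra_not nF; rewrite /F/= !in_itv/= !andbT; apply: le_trans.
      by rewrite lerD2l lef_pV2 ?posrE// ler_nat.
  have I0 : \bigcap_n (O `\` F n) = set0.
    apply/seteqP; split => // z hz; have [Oz _] := hz 0%N Logic.I.
    have zx : 0 < p z - x by move: Oz; rewrite /O/= in_itv/= andbT subr_gt0.
    have [n _ /(_ n (leqnn n)) hn] := near_infty_natSinv_lt (PosNum zx).
    have [_] := hz n Logic.I; apply; rewrite /F/= in_itv/= andbT.
    by rewrite addrC -lerBrDr ltW.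
  rewrite I0 measure0 in cvgm.
  have [|n hn] := cvgn_ereal_lt (e := e%:E) cvgm; first by rewrite lte_fin.
  exists O, (F n); split => // z; rewrite /F/O/= !in_itv/= !andbT.
  by apply: lt_le_trans; rewrite ltrDl.
by move=> h A /h.
Qed.

Lemma finite_measure_outer_regular A (e : R) : measurable A -> 0 < e ->
  exists O, [/\ open O, A `<=` O & (m O <= m A + e%:E)%E].
Proof.
move=> mA e0; suff [_ /(_ _ e0)[V [F [oO cF FA AO h]]]] : regular A.
  exists V; split => //.
  have -> : V = A `|` (V `\` A) by rewrite setDUK.
  apply: le_trans (_ : (m A + m (V `\` A) <= _)%E).
    apply: measureU2 => //; apply: measurableD => //; exact: mO.
  rewrite leeD2l//; apply: le_trans (ltW h); apply: le_plane_measure.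
  - by apply: measurableD => //; exact: mO.
  - by apply: measurableD => //; [exact: mO|exact: mF].
  - by apply: setDS.
move: A mA; apply: smallest_sub; first exact: regular_sigma.
rewrite subUset; split.
- by move=> _ [A mA <-]; rewrite setTI; apply: regular_ray => // z; exact: cvg_fst.
- by move=> _ [A mA <-]; rewrite setTI; apply: regular_ray => // z; exact: cvg_snd.
Qed.

End RegularClosure.

(** * Comparison of measures with Lebesgue measure, cell by cell *)

Notation lam2 R := ((@lebesgue_measure R) \x (@lebesgue_measure R))%E.

Section CompareWithLebesgue.
Context {R : realType}.
Variable nu : {measure set (plane R) -> \bar R}.

Lemma lam2X (A B : set R) : measurable A -> measurable B ->
  lam2 R (A `*` B) = (lebesgue_measure A * lebesgue_measure B)%E.
Proof. by move=> mA mB; rewrite product_measure1E. Qed.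

Lemma lam2_itv (b1 b2 b3 b4 : bool) (x1 x2 y1 y2 : R) : x1 <= x2 -> y1 <= y2 ->
  lam2 R ([set` Interval (BSide b1 x1) (BSide b2 x2)] `*`
     [set` Interval (BSide b3 y1) (BSide b4 y2)]) = ((x2 - x1) * (y2 - y1))%:E.
Proof.
move=> x12 y12; rewrite lam2X ?lebesgue_measure_itv//=; try exact: measurable_itv.
have h (x y : R) : x <= y ->
    (if (x%:E < y%:E)%E then (y%:E - x%:E)%E else 0%E) = (y - x)%:E.
  by rewrite lte_fin le_eqVlt => /predU1P[->|->]; rewrite ?ltxx ?subrr.
by rewrite !h.
Qed.

Lemma lam2_cell n k : lam2 R (cell n k) = ((2 ^+ n)^-1 ^+ 2 : R)%:E.
Proof.
rewrite cellX !floor_cellE lam2_itv; first by rewrite -!mulrBl intrD; congr EFin; ring.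
all: by rewrite ler_pM2r ?invr_gt0 ?exprn_gt0// ler_int lerDl.
Qed.

Lemma lam2_ball (z : R * R) (r : R) : 0 <= r -> lam2 R (ball z r) = (4 * r ^+ 2)%:E.
Proof.
move=> r0; have -> : ball z r = `]z.1 - r, z.1 + r[ `*` `]z.2 - r, z.2 + r[.
  apply/seteqP; split => w /=; rewrite -ball_normE/= /Num.norm/= gt_max !ltr_distlC !in_itv/=.
    by move=> /andP[-> ->].
  by move=> [-> ->].
by rewrite lam2_itv; [congr EFin; ring|lra|lra].
Qed.

Lemma lam2_closed_ball (z : R * R) (r : R) : 0 <= r ->
  lam2 R [set w | `|z - w| <= r] = (4 * r ^+ 2)%:E.
Proof.
move=> r0; have -> : [set w | `|z - w| <= r] = `[z.1 - r, z.1 + r] `*` `[z.2 - r, z.2 + r].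
  apply/seteqP; split => w /=; rewrite /Num.norm/= ge_max !ler_distlC !in_itv/=.
    by move=> /andP[-> ->].
  by move=> [-> ->].
by rewrite lam2_itv; [congr EFin; ring|lra|lra].
Qed.

Lemma measurable_closed_ball2 (z : R * R) (r : R) : measurable [set w | `|z - w| <= r].
Proof.
have -> : [set w | `|z - w| <= r] = `[z.1 - r, z.1 + r] `*` `[z.2 - r, z.2 + r].
  apply/seteqP; split => w /=; rewrite /Num.norm/= ge_max !ler_distlC !in_itv/=.
    by move=> /andP[-> ->].
  by move=> [-> ->].
by apply: measurableX; exact: measurable_itv.
Qed.

(** Passage from cells to open sets by exhaustion, to bounded measurable sets by outer regularity,
    to all measurable sets by a monotone limit. Outer regularity is applied to Lebesgue measure
    restricted to a ball, which is finite, and never to [nu]. *)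
Lemma cells_measure_le (C : R) : 0 <= C ->
  (forall n k, nu (cell n k) <= C%:E * lam2 R (cell n k))%E ->
  forall B : set (R * R), measurable B -> (nu B <= C%:E * lam2 R B)%E.
Proof.
move=> C0 nuC.
have open_le (O : set (R * R)) : open O -> (nu O <= C%:E * lam2 R O)%E.
  move=> oO; have mO := open_measurable2 oO.
  have cells_le n : (nu (cells_in O n) <= C%:E * lam2 R O)%E.
    apply: (@le_trans _ _ (C%:E * lam2 R (cells_in O n))%E); last first.
      rewrite lee_wpmul2l ?lee_fin//; apply: le_plane_measure => //.
        exact: measurable_cells.
      by rewrite [X in _ `<=` X](open_cells_in oO); exact: bigcup_sup.
    have tI := @trivIset_cells R n [set k | cell n k `<=` O].
    rewrite /cells_in cells_in_bigcup !measure_bigcup//.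
    - rewrite -nneseriesZl//; apply: lee_nneseries => // i _.
      case: pickle_inv => [k|]; last by rewrite !measure0 mule0.
      by case: ifPn => _; rewrite ?measure0 ?mule0.
    - move=> i _; case: pickle_inv => // k; case: ifPn => // _.
      exact: measurable_cell.
    - move=> i _; case: pickle_inv => // k; case: ifPn => // _.
      exact: measurable_cell.
  have : nu (cells_in O n) @[n --> \oo] --> nu (\bigcup_n cells_in O n).
    apply: nondecreasing_cvg_mu => [n||].
    - exact: measurable_cells.
    - by rewrite -open_cells_in.
    - by move=> i j ij; apply/subsetPset; exact: cells_in_nd.
  by rewrite -open_cells_in// => /cvgn_ereal_le; exact.
move=> B mB; pose D N := B `&` ball (0 : R * R) N%:R.
have mD N : measurable (D N).
  by apply: measurableI => //; apply: open_measurable2; exact: ball_open.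
have D_le N : (nu (D N) <= C%:E * lam2 R B)%E.
  apply: (@le_trans _ _ (C%:E * lam2 R (D N))%E); last first.
    by rewrite lee_wpmul2l ?lee_fin//; apply: le_plane_measure => // z [].
  have mb : measurable (ball (0 : R * R) N%:R).
    by apply: open_measurable2; exact: ball_open.
  pose m := mrestr (lam2 R) mb.
  have mfin : (m setT < +oo)%E by rewrite /m /mrestr setTI lam2_ball// ltry.
  apply/lee_addgt0Pr => e e0.
  (* [C] may be zero, so the error [e] is divided by [C + 1]. *)
  have C1 : 0 < C + 1 by rewrite ltr_wpDl.
  have [V [oV DV hV]] := finite_measure_outer_regular mfin (mD N) (divr_gt0 e0 C1).
  have oVb : open (V `&` ball (0 : R * R) N%:R) by apply: openI => //; exact: ball_open.
  apply: (@le_trans _ _ (nu (V `&` ball (0 : R * R) N%:R))).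
    apply: le_plane_measure => //; first exact: open_measurable2.
    by move=> z Dz; split; [exact: DV|case: Dz].
  apply: (le_trans (open_le _ oVb)).
  have mDE : m (D N) = lam2 R (D N) by rewrite /m /mrestr /D -setIA setIid.
  apply: (@le_trans _ _ (C%:E * (lam2 R (D N) + (e / (C + 1))%:E))%E).
    by rewrite lee_wpmul2l ?lee_fin// -mDE.
  have fD : lam2 R (D N) \is a fin_num.
    rewrite ge0_fin_numE//; apply: (@le_lt_trans _ _ (m setT)) => //.
    rewrite -mDE; apply: le_plane_measure => //.
  rewrite -(fineK fD) -!EFinD -!EFinM lee_fin mulrDr lerD2l.
  by rewrite mulrA ler_pdivrMr// mulrC ler_pM2l// lerDl.
have BD : B = \bigcup_N D N.
  apply/seteqP; split => [z Bz|z [N _ []]//].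
  have [N _ /(_ N (leqnn N)) hN] : \forall N \near \oo, `|z| < N%:R.
    exists (Num.truncn `|z|).+1 => // N /= hN.
    by rewrite (lt_le_trans (truncnS_gt _))// ler_nat.
  by exists N => //; split => //; rewrite -ball_normE/= sub0r normrN.
have : nu (D n) @[n --> \oo] --> nu (\bigcup_n D n).
  apply: nondecreasing_cvg_mu => //; first by rewrite -BD.
  move=> i j ij; apply/subsetPset; apply: setIS; apply: le_ball.
  by rewrite ler_nat.
by rewrite -BD => /cvgn_ereal_le; exact.
Qed.

End CompareWithLebesgue.

Section ExpandingMaps.
Context {R : realType}.

(** The points of [A] mapped into one cell are at mutual distance at most [L * 2 ^- n], hence lie in
    a square of that half-side; doubling the side gives the factor 4. The estimate for cells extends
    to Borel sets by [cells_measure_le], applied to a push-forward. *)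
Lemma lam2_expanding (A B : set (R * R)) (g : R * R -> R * R) (L : R) : 0 <= L ->
  measurable A -> measurable_fun A g ->
  (forall z w, A z -> A w -> `|z - w| <= L * `|g z - g w|) ->
  measurable B -> (lam2 R (A `&` g @^-1` B) <= (4 * L ^+ 2)%:E * lam2 R B)%E.
Proof.
move=> L0 mA mg gL mB.
pose m : {measure set (plane R) -> \bar R} := mrestr (lam2 R) mA.
(* A push-forward needs a map measurable on the whole plane; the values of [g'] off [A] are not seen
   by the measure restricted to [A]. *)
pose g' := g \_ A.
have mg' : @measurable_fun _ _ (plane R) (plane R) setT g'.
  exact: (iffLR (measurable_restrictT g mA) mg).
pose nu : {measure set (plane R) -> \bar R} :=
  measure_function_pushforward__canonical__measure_function_Measure m mg'.
have nuE C : nu C = lam2 R (A `&` g @^-1` C).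
  rewrite /nu/= /pushforward/= /mrestr setIC; congr (_ _).
  by apply/seteqP; split => z []; rewrite /g' /preimage/= => Az; rewrite patchT ?inE.
rewrite -nuE; apply: cells_measure_le; [by rewrite mulr_ge0 ?exprn_ge0| |exact: mB].
move=> n k; rewrite nuE lam2_cell -EFinM -mulrA -exprMn.
have [->|/set0P[z [Az gz]]] := eqVneq (A `&` g @^-1` cell n k) set0.
  by rewrite measure0 lee_fin mulr_ge0 ?exprn_ge0// mulr_ge0// invr_ge0 exprn_ge0.
have r0 : 0 <= L * (2 ^+ n)^-1 by rewrite mulr_ge0// invr_ge0 exprn_ge0.
rewrite -(lam2_closed_ball z r0); apply: le_plane_measure.
- rewrite -[A `&` _]setTI setTI; apply: mg => //; exact: measurable_cell.
- exact: measurable_closed_ball2.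
- move=> w [Aw gw] /=; apply: le_trans (gL _ _ Az Aw) _.
  by rewrite ler_wpM2l//; apply: cell_dist gz gw.
Qed.

End ExpandingMaps.

(** * Charts and stretch factors *)

Section ComplexPlane.
Context {R : realType}.
Local Open Scope complex_scope.

Definition toC (z : R * R) : (R[i])^o := z.1 +i* z.2.
Definition ofC (c : (R[i])^o) : R * R := (complex.Re c, complex.Im c).

Lemma toCK : cancel toC ofC. Proof. by case. Qed.
Lemma ofCK : cancel ofC toC. Proof. by case. Qed.

Lemma cnormE (c : R[i]) : cnorm c = Num.sqrt (complex.Re c ^+ 2 + complex.Im c ^+ 2).
Proof. by rewrite /cnorm normc_def. Qed.

Lemma normC_cnorm (c : R[i]) : `|c| = (cnorm c)%:C.
Proof. by rewrite /cnorm normc_def. Qed.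

Lemma cnorm_ge0 (c : R[i]) : 0 <= cnorm c.
Proof. by rewrite cnormE sqrtr_ge0. Qed.

Lemma cnormD (c d : R[i]) : cnorm (c + d) <= cnorm c + cnorm d.
Proof.
have := ler_normD c d; rewrite !normC_cnorm.
by rewrite -[X in _ <= X -> _](rmorphD (real_complex R)) lecR.
Qed.

Lemma cnormM (c d : R[i]) : cnorm (c * d) = cnorm c * cnorm d.
Proof.
by apply: complexI; rewrite rmorphM -!normC_cnorm normrM.
Qed.

Lemma cnormN (c : R[i]) : cnorm (- c) = cnorm c.
Proof. by rewrite /cnorm normrN. Qed.

Lemma le_ofC_cnorm (c : R[i]) : `|ofC c| <= cnorm c.
Proof.
rewrite cnormE /Num.norm/= ge_max; apply/andP; split.
  by rewrite -sqrtr_sqr ler_wsqrtr// lerDl sqr_ge0.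
by rewrite -sqrtr_sqr ler_wsqrtr// lerDr sqr_ge0.
Qed.

(** The norm on the right is the sup norm; 2 stands in for the square root of 2. *)
Lemma cnorm_le_ofC (c : R[i]) : cnorm c <= 2 * `|ofC c|.
Proof.
have h : complex.Re c ^+ 2 + complex.Im c ^+ 2 <= (2 * `|ofC c|) ^+ 2.
  have a : `|complex.Re c| <= `|ofC c| by rewrite /Num.norm/= le_max lexx.
  have b : `|complex.Im c| <= `|ofC c| by rewrite /Num.norm/= le_max lexx orbT.
  rewrite -(real_normK (num_real (complex.Re c))) -(real_normK (num_real (complex.Im c))).
  have /= := normr_ge0 (complex.Re c); have /= := normr_ge0 (complex.Im c).
  nra.
by rewrite cnormE -(ger0_norm (mulr_ge0 _ (normr_ge0 (ofC c))))// -sqrtr_sqr ler_wsqrtr.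
Qed.

Lemma ofCB (c d : R[i]) : ofC (c - d) = ofC c - ofC d.
Proof. by case: c d => [? ?] [? ?]. Qed.

Lemma toCB (z w : R * R) : toC z - toC w = toC (z - w).
Proof. by []. Qed.

Lemma continuous_toC : continuous toC.
Proof.
move=> z; apply/cvgrPdist_lt => /= e e0.
(* Norms on [R[i]] take values in [R[i]]; a positive [e] there has zero imaginary part. *)
have e0' : 0 < complex.Re e by move: e0; rewrite ltcE => /andP[].
have eE : e = (complex.Re e)%:C.
  by move: e0; rewrite ltcE => /andP[/eqP/= h _]; case: e h e0' => ? ? /= ->.
have e2 : 0 < complex.Re e / 2 by rewrite divr_gt0.
near=> w; rewrite toCB normC_cnorm eE ltcR.
apply: le_lt_trans (cnorm_le_ofC _) _; rewrite toCK.
rewrite mulrC -ltr_pdivlMr//; near: w.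
Unshelve. all: by end_near. Qed.

Lemma continuous_ofC : continuous ofC.
Proof.
move=> c A /nbhs_ballP[e /= e0 eA].
have e0' : 0 < e%:C :> R[i] by rewrite ltcR.
apply/nbhs_ballP; exists e%:C => //= d cd; apply: eA.
move: cd; rewrite -!ball_normE/= normC_cnorm ltcR -ofCB.
exact: le_lt_trans (le_ofC_cnorm _).
Qed.

End ComplexPlane.

Section PlaneMeasurability.
Context {R : realType}.

Lemma continuous_on_measurable2 (W : set (R * R)) (f : R * R -> R) : open W ->
  (forall z, W z -> {for z, continuous f}) -> measurable_fun W f.
Proof.
move=> oW cf; apply: (measurability _ (RGenOpens.measurableE R)).
move=> _ [_ [a [b ->] <-]]; apply: open_measurable2.
rewrite openE => z [Wz fz]; apply: filterI; first exact: open_nbhs_nbhs.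
apply: (cf z Wz `]a, b[%classic); apply: open_nbhs_nbhs; split => //.
Qed.

Lemma measurable_fun_pairD d (T : measurableType d) (D : set T) (f g : T -> R) :
  measurable D -> measurable_fun D f -> measurable_fun D g ->
  measurable_fun D (fun x => (f x, g x)).
Proof.
move=> mD mf mg.
have mf' : measurable_fun setT (f \_ D) by exact: (iffLR (measurable_restrictT f mD) mf).
have mg' : measurable_fun setT (g \_ D) by exact: (iffLR (measurable_restrictT g mD) mg).
have := measurable_funS measurableT (@subsetT _ D) (measurable_fun_pair mf' mg').
by apply: eq_measurable_fun => x xD /=; rewrite !patchT.
Qed.

Lemma continuous_on_measurable2_2 (W : set (R * R)) (f : R * R -> R * R) : open W ->
  (forall z, W z -> {for z, continuous f}) -> measurable_fun W f.
Proof.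
move=> oW cf; have mW := open_measurable2 oW.
have m1 : measurable_fun W (fun z => (f z).1).
  apply: (continuous_on_measurable2 oW) => z Wz.
  by apply: continuous_comp; [exact: cf|exact: cvg_fst].
have m2 : measurable_fun W (fun z => (f z).2).
  apply: (continuous_on_measurable2 oW) => z Wz.
  by apply: continuous_comp; [exact: cf|exact: cvg_snd].
by apply: eq_measurable_fun (measurable_fun_pairD mW m1 m2) => z _; case: (f z).
Qed.

End PlaneMeasurability.

Section Charts.
Context {R : realType} {X : riemann_surface R}.
Implicit Types (phi psi : chart R X) (p : X) (E : set X).

Definition coord_inv phi (z : R * R) : X := chart_inv phi (toC z).

Lemma plane_coordE phi p : plane_coord phi p = ofC (phi p). Proof. by []. Qed.

Lemma atlas_open phi : atlas phi -> open (chart_dom phi).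
Proof. by case/atlas_chart. Qed.

Lemma coord_invK phi p : atlas phi -> chart_dom phi p ->
  coord_inv phi (plane_coord phi p) = p.
Proof.
move=> /atlas_chart[_ _ _ _ h] Dp; rewrite /coord_inv plane_coordE ofCK h//.
exact: mem_set.
Qed.

Lemma plane_coordK phi z : atlas phi -> (plane_coord phi @` chart_dom phi) z ->
  chart_dom phi (coord_inv phi z) /\ plane_coord phi (coord_inv phi z) = z.
Proof. by move=> aphi [p Dp <-]; rewrite coord_invK. Qed.

Lemma plane_coord_continuous phi p : atlas phi -> chart_dom phi p ->
  {for p, continuous (plane_coord phi)}.
Proof.
move=> /atlas_chart[oD _ cD _ _] Dp.
have cphi : {for p, continuous phi}.
  by move: cD; rewrite continuous_open_subspace// => /(_ p (mem_set Dp)).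
by apply: (@continuous_comp _ _ _ phi ofC p cphi); exact: continuous_ofC.
Qed.

Lemma coord_inv_continuous phi z : atlas phi ->
  (plane_coord phi @` chart_dom phi) z -> {for z, continuous (coord_inv phi)}.
Proof.
move=> /atlas_chart[_ oD _ cD _] [p Dp <-].
have ci : {for phi p, continuous (chart_inv phi)}.
  move: cD; rewrite continuous_open_subspace// => /(_ (phi p)); apply.
  by apply: mem_set; exists p.
apply: continuous_comp; first exact: continuous_toC.
by rewrite plane_coordE ofCK.
Qed.

Lemma plane_coord_open phi E : atlas phi -> open E -> E `<=` chart_dom phi ->
  open (plane_coord phi @` E).
Proof.
move=> aphi oE ED; have [_ oD _ _ _] := atlas_chart aphi.
rewrite openE => _ [p Ep <-]; have Dp := ED _ Ep.
have imD : (plane_coord phi @` chart_dom phi) (plane_coord phi p) by exists p.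
have nE : \forall z \near plane_coord phi p, E (coord_inv phi z).
  apply: (coord_inv_continuous aphi imD); rewrite coord_invK//.
  exact: open_nbhs_nbhs.
have nD : \forall z \near plane_coord phi p, (phi @` chart_dom phi) (toC z).
  apply: (@continuous_toC R (plane_coord phi p)); apply: open_nbhs_nbhs; split => //.
  by rewrite plane_coordE ofCK; exists p.
near=> z; exists (coord_inv phi z); first by near: z.
have [q Dq qz] : (phi @` chart_dom phi) (toC z) by near: z.
by rewrite /coord_inv -qz; have /= := coord_invK aphi Dq;
   rewrite /coord_inv plane_coordE ofCK => ->; rewrite plane_coordE qz toCK.
Unshelve. all: by end_near. Qed.

Definition trans_plane phi psi (z : R * R) : R * R :=
  plane_coord psi (coord_inv phi z).

Lemma trans_plane_continuous phi psi p : atlas phi -> atlas psi ->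
  chart_dom phi p -> chart_dom psi p ->
  {for plane_coord phi p, continuous (trans_plane phi psi)}.
Proof.
move=> aphi apsi Dp Dp'; apply: continuous_comp.
  by apply: coord_inv_continuous => //; exists p.
by rewrite coord_invK//; exact: plane_coord_continuous.
Qed.

(** One image is the preimage of the other under a continuous transition map, so the measurability
    condition on the pieces in [area] does not depend on the chart. *)
Lemma plane_coord_measurable phi psi E : atlas phi -> atlas psi ->
  E `<=` chart_dom phi -> E `<=` chart_dom psi ->
  measurable (plane_coord phi @` E) -> measurable (plane_coord psi @` E).
Proof.
move=> aphi apsi ED ED' mE.
pose D := chart_dom phi `&` chart_dom psi.
have oD : open D by apply: openI; exact: atlas_open.
have oW : open (plane_coord psi @` D).
  by apply: plane_coord_open => //; exact: subIsetr.
have mT : measurable_fun (plane_coord psi @` D) (trans_plane psi phi).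
  apply: continuous_on_measurable2_2 => // _ [p [Dp Dp'] <-].
  exact: trans_plane_continuous.
have -> : plane_coord psi @` E =
    (plane_coord psi @` D) `&` (trans_plane psi phi @^-1` (plane_coord phi @` E)).
  apply/seteqP; split => z.
    move=> [p Ep <-]; split; first by exists p => //; split; [exact: ED|exact: ED'].
    by exists p => //; rewrite /trans_plane coord_invK//; exact: ED'.
  move=> [[p [Dp Dp'] <-]] [q Eq]; rewrite /trans_plane coord_invK// => qp.
  exists q => //; rewrite -(coord_invK aphi Dp) -qp coord_invK//; exact: ED.
by apply: mT => //; exact: open_measurable2.
Qed.

(** The conformal factor [|d psi / d phi|] at [p]: a density changes chart by
    [rho phi = rho psi * stretch phi psi]. *)
Definition stretch phi psi p : R := cnorm ('D_1 (transition phi psi) (phi p)).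

Lemma chart_continuous phi p : atlas phi -> chart_dom phi p ->
  {for p, continuous phi}.
Proof.
move=> /atlas_chart[oD _ cD _ _] Dp.
by move: cD; rewrite continuous_open_subspace// => /(_ p (mem_set Dp)).
Qed.

Lemma chart_invK phi p : atlas phi -> chart_dom phi p -> chart_inv phi (phi p) = p.
Proof. by move=> /atlas_chart[_ _ _ _ h] Dp; rewrite h//; exact: mem_set. Qed.

Lemma near_chart_dom phi p : atlas phi -> chart_dom phi p ->
  \forall q \near p, chart_dom phi q.
Proof. by move=> aphi Dp; apply: open_nbhs_nbhs; split => //; exact: atlas_open. Qed.

Lemma cnorm_dist (c d : R[i]) : `|cnorm c - cnorm d| <= cnorm (c - d).
Proof.
rewrite ler_norml; apply/andP; split.
  rewrite lerNl opprB lerBlDr -[leLHS](congr1 (@cnorm R) (subrK c d)).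
  by rewrite -opprB -(cnormN (c - d)) cnormD.
by rewrite lerBlDr -[leLHS](congr1 (@cnorm R) (subrK d c)) cnormD.
Qed.

(** Complex differentiability in real first-order form at a point of [X]. Holomorphy of the atlas
    enters only through this estimate. *)
Lemma transition_local phi psi p : atlas phi -> atlas psi ->
  chart_dom phi p -> chart_dom psi p -> forall e : R, 0 < e ->
  \forall q \near p,
    `|cnorm (psi q - psi p) - stretch phi psi p * cnorm (phi q - phi p)|
     <= e * cnorm (phi q - phi p).
Proof.
move=> aphi apsi Dp Dp' e e0.
have dT := atlas_holomorphic aphi apsi Dp Dp'.
have e0' : 0 < (e%:C)%C :> R[i] by rewrite ltcR.
have /cvgrPdist_lt/(_ _ e0') hh := dT.
have [d /= d0 hd] := iffLR (@nbhs_ballP _ (R[i])^o 0 _) hh.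
have nq : \forall q \near p, `|phi p - phi q| < d.
  exact: (@cvgr_dist_lt _ _ _ _ _ phi (phi p) (chart_continuous aphi Dp) d d0).
apply: filterS3 nq (near_chart_dom aphi Dp) (near_chart_dom apsi Dp').
move=> q bq Dq Dq'.
(* The difference quotient is meaningless when [phi q = phi p]; injectivity of the chart then gives
   [q = p]. *)
have [tE|t0] := eqVneq (phi q) (phi p).
  have -> : q = p by rewrite -(chart_invK aphi Dq) tE chart_invK.
  by rewrite !subrr /cnorm normr0 /= !mulr0 subr0 normr0.
have t0' : phi q - phi p != 0 by rewrite subr_eq0.
have bt : ball (0 : (R[i])^o) d (phi q - phi p) by rewrite -ball_normE/= sub0r opprB.
have := hd _ bt t0'; rewrite /stretch /derive; set D := lim _.
rewrite /= /shift/= scaler1 subrK /transition/= !chart_invK// normC_cnorm ltcR => /ltW h.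
rewrite -cnormM.
apply: le_trans (cnorm_dist _ _) _.
have /(congr1 (@cnorm R)) E : psi q - psi p - D * (phi q - phi p) =
    - (D - (phi q - phi p)^-1 * (psi q - psi p)) * (phi q - phi p).
  by rewrite mulNr mulrBl mulrAC mulVf// mul1r opprB.
by rewrite [X in X <= _]E cnormM cnormN ler_wpM2r// cnorm_ge0.
Qed.

Lemma stretch_ge0 phi psi p : 0 <= stretch phi psi p.
Proof. exact: cnorm_ge0. Qed.

End Charts.

(** * Measurability of the stretch and distortion of areas *)

Lemma continuous_cnorm_toC {R : realType} :
  continuous (fun z : R * R => cnorm (toC z)).
Proof.
move=> z; rewrite (_ : (fun z => _) = fun z => Num.sqrt (z.1 * z.1 + z.2 * z.2)); last first.
  by apply/funext => ?; rewrite cnormE !expr2.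
apply: (@continuous_comp _ _ _ (fun z : R * R => z.1 * z.1 + z.2 * z.2) Num.sqrt).
  by apply: cvgD; apply: cvgM; (exact: cvg_fst || exact: cvg_snd).
exact: sqrt_continuous.
Qed.

Section StretchMeasurable.
Context {R : realType} {X : riemann_surface R}.
Variables (phi psi : chart R X).
Hypotheses (aphi : atlas phi) (apsi : atlas psi).

Let W := plane_coord phi @` (chart_dom phi `&` chart_dom psi).
Let T := trans_plane phi psi.
Let w z := stretch phi psi (coord_inv phi z).

Let oW : open W.
Proof.
apply: (plane_coord_open aphi); last exact: subIsetl.
exact: openI (atlas_open aphi) (atlas_open apsi).
Qed.

Let cT z : W z -> {for z, continuous T}.
Proof. by move=> [p [Dp Dp'] <-]; exact: trans_plane_continuous. Qed.

Lemma stretch_local z (e : R) : W z -> 0 < e ->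
  \forall z' \near z, `|cnorm (toC (T z' - T z)) - w z * cnorm (toC (z' - z))|
     <= e * cnorm (toC (z' - z)).
Proof.
move=> Wz e0; have [p [Dp Dp'] pz] := Wz.
have loc := transition_local aphi apsi Dp Dp' e0.
have Wdom z1 : W z1 -> (plane_coord phi @` chart_dom phi) z1.
  by move=> [q [Dq _] <-]; exists q.
have ciz : coord_inv phi z = p by rewrite -pz coord_invK.
have cont : {for z, continuous (coord_inv phi)}.
  exact: (coord_inv_continuous aphi (Wdom _ Wz)).
have nz : \forall z' \near z, `|cnorm (psi (coord_inv phi z') - psi p) -
    stretch phi psi p * cnorm (phi (coord_inv phi z') - phi p)|
     <= e * cnorm (phi (coord_inv phi z') - phi p).
  have cont' : coord_inv phi @ z --> p by rewrite -ciz.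
  exact: (cont' _ loc).
have nW : nbhs z W by exact: open_nbhs_nbhs.
apply: filterS2 nz nW => z' h [q [Dq Dq'] qz'].
have key : phi (coord_inv phi z') - phi p = toC (z' - z).
  by rewrite -qz' coord_invK// -pz -toCB !plane_coordE !ofCK.
have key2 : psi (coord_inv phi z') - psi p = toC (T z' - T z).
  by rewrite -toCB /T /trans_plane -qz' -pz !coord_invK// !plane_coordE !ofCK.
by move: h; rewrite key key2 /w ciz.
Qed.

Let e_ (n : nat) : R * R := (n.+1%:R^-1, 0).

(** The stretch is the pointwise limit of the moduli of difference quotients along the real step
    [1 / (n + 1)], each measurable by continuity. *)
Lemma measurable_stretch : measurable_fun W w.
Proof.
have mW := open_measurable2 oW.
pose Wn n : set (R * R) := W `&` [set z | W (z + e_ n)].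
have oWn n : open (Wn n).
  apply: openI => //; apply: open_comp => // z _.
  by apply: cvgD; [exact: cvg_id|exact: cvg_cst].
(* Where the shifted point leaves [W] the quotient is set to 0; at a fixed point of [W] this happens
   for finitely many [n] only. *)
pose h (n : nat) (z : R * R) : R := if z + e_ n \in W then n.+1%:R * cnorm (toC (T (z + e_ n) - T z)) else 0.
apply: (measurable_fun_cvg (h := h)) => [n|z Wz].
- have -> : W = Wn n `|` (W `\` Wn n) by rewrite setDUK//; exact: subIsetl.
  apply/measurable_funU.
  + exact: open_measurable2.
  + by apply: measurableD => //; exact: open_measurable2.
  + split.
    * apply: (@eq_measurable_fun _ _ _ _ _
        (fun z : R * R => n.+1%:R * cnorm (toC (T (z + e_ n) - T z)))).
        by move=> z /set_mem[_ /= Wz]; rewrite /h mem_set.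
      apply: (continuous_on_measurable2 (oWn n)) => z [Wz Wz'].
      have cs : {for z, continuous (fun z1 : R * R => T (z1 + e_ n))}.
        apply: continuous_comp; last exact: cT.
        by apply: cvgD; [exact: cvg_id|exact: cvg_cst].
      have cd : {for z, continuous (fun z1 : R * R => T (z1 + e_ n) - T z1)}.
        by apply: cvgB; [exact: cs|exact: cT].
      apply: cvgM; first exact: cvg_cst.
      exact: (continuous_comp cd (@continuous_cnorm_toC _ _)).
    * apply: (@eq_measurable_fun _ _ _ _ _ (fun _ : R * R => 0 : R)); last exact: measurable_cst.
      move=> z /set_mem[Wz nWz]; rewrite /h; case: ifPn => // /set_mem Wz'.
      by exfalso; apply: nWz.
- apply/cvgrPdist_le => e e0.
  have /nbhs_ballP[d /= d0 hd] := stretch_local Wz e0.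
  have nW : nbhs z W by exact: open_nbhs_nbhs.
  have /nbhs_ballP[d' /= d'0 hd'] := nW.
  near=> n.
  have e_n : `|e_ n| = n.+1%:R^-1.
    rewrite /e_ prod_normE/= normr0 ger0_norm ?invr_ge0//.
    by apply/max_idPl; rewrite invr_ge0.
  have bd r : n.+1%:R^-1 < r -> ball z r (z + e_ n).
    by rewrite -ball_normE/= opprD addrA subrr sub0r normrN e_n.
  have zn : n.+1%:R^-1 < d by near: n; exact: (near_infty_natSinv_lt (PosNum d0)).
  have zn' : n.+1%:R^-1 < d' by near: n; exact: (near_infty_natSinv_lt (PosNum d'0)).
  rewrite /h mem_set; last by apply: hd'; exact: bd.
  have ez : z + e_ n - z = e_ n by rewrite addrC addKr.
  have := hd _ (bd _ zn); rewrite ez.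
  have -> : cnorm (toC (e_ n)) = n.+1%:R^-1.
    by rewrite cnormE /= expr0n addr0 sqrtr_sqr ger0_norm// invr_ge0.
  set t := cnorm _ => ht.
  have n0 : 0 < n.+1%:R :> R by rewrite ltr0n.
  rewrite -(ler_pM2r (x := n.+1%:R^-1)) ?invr_gt0//; apply: le_trans ht.
  rewrite -[X in _ * X <= _]ger0_norm ?invr_ge0// -normrM mulrBl mulrAC mulfV ?gt_eqF// mul1r.
  by rewrite distrC.
Unshelve. all: by end_near. Qed.

End StretchMeasurable.

Section StretchArea.
Context {R : realType} {X : riemann_surface R}.
Variables (phi psi : chart R X).
Hypotheses (aphi : atlas phi) (apsi : atlas psi).

Let D := chart_dom phi `&` chart_dom psi.
Let W := plane_coord phi @` D.
Let T := trans_plane phi psi.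
Let w z := stretch phi psi (coord_inv phi z).

Let oW : open W.
Proof.
apply: (plane_coord_open aphi); last exact: subIsetl.
exact: openI (atlas_open aphi) (atlas_open apsi).
Qed.

Let cT z : W z -> {for z, continuous T}.
Proof. by move=> [p [Dp Dp'] <-]; exact: trans_plane_continuous. Qed.

Let mW : measurable W. Proof. exact: open_measurable2. Qed.

Let mw : measurable_fun W w. Proof. exact: measurable_stretch. Qed.

Let mT : measurable_fun W T.
Proof. exact: (continuous_on_measurable2_2 oW cT). Qed.

(** Expansion by [q / 4] at scale [2 ^- k]. The 4 absorbs a factor 2 from the first-order error
    [w z / 2] and a factor 2 between modulus and sup norm. *)
Let expands (q : R) (k : nat) : set (R * R) :=
  [set z | W z /\ forall z', W z' -> `|z - z'| < (2 ^+ k)^-1 ->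
     q * `|z - z'| <= 4 * `|T z - T z'|].

(** A point [z'] that violates the inequality for [z] violates it for all points near [z], so the
    complement in [W] is open. *)
Let measurable_expands q k : measurable (expands q k).
Proof.
have -> : expands q k = W `\` (W `\` expands q k).
  by rewrite setDD setIidr// => z [].
apply: measurableD => //; apply: open_measurable2; rewrite openE => z [Wz nH].
have [z' /not_implyP[Wz' /not_implyP[zz' /negP]]] :
    exists z', ~ (W z' -> `|z - z'| < (2 ^+ k)^-1 ->
     q * `|z - z'| <= 4 * `|T z - T z'|).
  by apply/existsNP => h; apply: nH.
rewrite -ltNge => lt.
have c1 : (fun z1 => `|z1 - z'|) @ z --> `|z - z'|.
  by apply: cvg_norm; apply: cvgB; [exact: cvg_id|exact: cvg_cst].
have c2 : (fun z1 => q * `|z1 - z'| - 4 * `|T z1 - T z'|) @ z -->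
    q * `|z - z'| - 4 * `|T z - T z'|.
  apply: cvgB; apply: cvgM; try exact: cvg_cst; first exact: c1.
  by apply: cvg_norm; apply: cvgB; [exact: cT|exact: cvg_cst].
have n1 : \forall z1 \near z, `|z1 - z'| < (2 ^+ k)^-1 by exact: (cvgr_lt _ c1).
have n2 : \forall z1 \near z, 0 < q * `|z1 - z'| - 4 * `|T z1 - T z'|.
  by apply: (cvgr_gt _ c2); rewrite subr_gt0.
have nW : nbhs z W by exact: open_nbhs_nbhs.
apply: filterS3 n1 n2 nW => z1 h1 h2 Wz1; split => // -[_ /(_ z' Wz' h1)].
by rewrite leNgt -subr_gt0 h2.
Qed.

(** On a piece the stretch is known up to a factor 2, and any two points are at distance at most
    [2 ^- k.+1], within the scale at which [expands] applies. *)
Let piece (q : rat) (k : nat) (c : int * int) : set (R * R) :=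
  expands (ratr q) k `&` (W `&` [set z | ratr q <= w z <= 2 * ratr q]) `&` cell k.+1 c.

Let measurable_piece q k c : measurable (piece q k c).
Proof.
apply: measurableI; last exact: measurable_cell.
apply: measurableI; first exact: measurable_expands.
rewrite (_ : [set z | _] = w @^-1` `[ratr q, 2 * ratr q]%classic).
  by apply: mw => //; exact: measurable_itv.
by apply/seteqP; split => z /=; rewrite in_itv.
Qed.

(** For [q > 0], [w ^ 2 <= 4 q ^ 2] and the area is at most [4 (4 / q) ^ 2] times that of the image;
    the product of the factors is 256. For [q = 0] the integrand vanishes. *)
Let piece_le q k c (B : set (R * R)) : measurable B -> B `<=` piece q k c ->
  0 <= q -> measurable (T @` B) ->
  (\int[lam2 R]_(z in B) ((w z) ^+ 2)%:E <= 256%:E * lam2 R (T @` B))%E.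
Proof.
move=> mB BP q0 mTB.
have q0' : 0 <= ratr q :> R by rewrite ler0q.
have BW : B `<=` W by move=> z /BP[[[]]].
have mwB : measurable_fun B (fun z => (w z ^+ 2)%:E).
  by apply/measurable_EFinP/measurable_funX; apply: measurable_funS mw.
apply: (@le_trans _ _ (\int[lam2 R]_(z in B) (4 * (ratr q) ^+ 2)%:E)%E).
  apply: ge0_le_integral => //.
  - by move=> z _; rewrite lee_fin sqr_ge0.
  - by move=> z /BP[[_ [_ /= /andP[a b]]] _]; rewrite lee_fin; nra.
rewrite integral_cst//.
have [->|qn0] := eqVneq q 0.
  rewrite rmorph0 expr0n mulr0 mul0e; apply: mule_ge0; [by rewrite lee_fin|exact: measure_ge0].
have q1 : 0 < ratr q :> R by rewrite ltr0q lt_def qn0.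
have : (lam2 R (B `&` T @^-1` (T @` B)) <=
    (4 * (4 / ratr q) ^+ 2)%:E * lam2 R (T @` B))%E.
  apply: lam2_expanding => //; first by rewrite divr_ge0.
    by apply: measurable_funS mT.
  move=> z z' Bz Bz'; have [[[_ h] _] kz] := BP _ Bz; have [_ kz'] := BP _ Bz'.
  rewrite mulrAC ler_pdivlMr// mulrC; apply: h; first exact: BW.
  apply: le_lt_trans (cell_dist kz kz') _.
  by rewrite ltf_pV2 ?posrE ?exprn_gt0// exprS ltr_pMl ?exprn_gt0// ltr1n.
rewrite (_ : B `&` _ = B); last by apply/setIidPl => z Bz; exists z.
move=> h; apply: (@le_trans _ _ ((4 * ratr q ^+ 2)%:E *
    ((4 * (4 / ratr q) ^+ 2)%:E * lam2 R (T @` B)))%E).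
  by rewrite lee_wpmul2l// lee_fin mulr_ge0// sqr_ge0.
rewrite muleA -EFinM (_ : 4 * _ * _ = 256)//.
by field; rewrite gt_eqF.
Qed.

Let cover z : W z -> exists q k c, 0 <= q /\ piece q k c z.
Proof.
move=> Wz.
have w0 : 0 <= w z by exact: stretch_ge0.
have [q q0 /andP[qw wq]] : exists2 q : rat, 0 <= q & ratr q <= w z <= 2 * ratr q.
  have [->|wn0] := eqVneq (w z) 0.
    by exists 0; rewrite // rmorph0 mulr0 lexx.
  have w1 : 0 < w z by rewrite lt_def wn0.
  have half : w z / 2 < w z by rewrite ltr_pdivrMr// ltr_pMr// ltr1n.
  have [q] := rat_in_itvoo half.
  rewrite in_itv/= => /andP[a b]; exists q.
    by rewrite -(ler0q R) ltW// (lt_trans _ a)// divr_gt0.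
  by rewrite ltW//= mulrC -ler_pdivrMr// ltW.
have [k hk] : exists k, expands (ratr q) k z.
  have [w1|w1] := ltP 0 (w z); last first.
    exists 0%N; split => // z' Wz' _.
    have -> : ratr q = 0 :> R by apply/eqP; rewrite eq_le ler0q q0 andbT (le_trans qw).
    by rewrite mul0r mulr_ge0.
  have /nbhs_ballP[d /= d0 hd] := stretch_local aphi apsi Wz (divr_gt0 w1 (@ltr0n R 2)).
  have [k _ /(_ k (leqnn k)) kd] := near_infty_natSinv_lt (PosNum d0).
  exists k; split => // z' Wz' zz'.
  have /hd : ball z d z'.
    rewrite -ball_normE/=; apply: lt_trans zz' _; apply: le_lt_trans kd => /=.
    by rewrite lef_pV2 ?posrE ?exprn_gt0// -natrX ler_nat ltn_expl.
  rewrite (distrC z) (distrC (T z)) -/T -/(w z) ler_distl => /andP[h _].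
  have a : `|z' - z| <= cnorm (toC (z' - z)).
    by rewrite -{1}(toCK (z' - z)) le_ofC_cnorm.
  have b : cnorm (toC (T z' - T z)) <= 2 * `|T z' - T z|.
    by rewrite -{2}(toCK (T z' - T z)) cnorm_le_ofC.
  have s1 : ratr q * `|z' - z| <= w z * `|z' - z| by rewrite ler_wpM2r.
  have s2 : w z * `|z' - z| <= w z * cnorm (toC (z' - z)) by rewrite ler_wpM2l.
  lra.
exists q, k, (Num.floor (2 ^+ k.+1 * z.1), Num.floor (2 ^+ k.+1 * z.2)).
by split => //; split => //; split => //; split => //=; rewrite qw wq.
Qed.

(* Only the differentiability of the transition is used: the domain is cut into
   countably many pieces on which the transition expands distances by a factor
   comparable to its derivative. *)
Lemma stretch_area (E : set X) : E `<=` chart_dom phi -> E `<=` chart_dom psi ->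
  measurable (plane_coord phi @` E) ->
  (\int[lam2 R]_(z in plane_coord phi @` E)
     ((stretch phi psi (coord_inv phi z)) ^+ 2)%:E
   <= 256%:E * lam2 R (plane_coord psi @` E))%E.
Proof.
move=> ED ED' mE; set A := plane_coord phi @` E.
have AW : A `<=` W by move=> _ [p Ep <-]; exists p => //; split; [exact: ED|exact: ED'].
have imT (E' : set X) : E' `<=` E -> T @` (plane_coord phi @` E') = plane_coord psi @` E'.
  move=> E'E; rewrite image_comp; apply: eq_imagel => p E'p /=.
  by rewrite /T /trans_plane coord_invK//; exact/ED/E'E.
have mTB (B : set (R * R)) : measurable B -> B `<=` A -> measurable (T @` B).
  move=> mB BA; have BE : B = plane_coord phi @` (E `&` plane_coord phi @^-1` B).
    apply/seteqP; split => [z Bz|_ [p [Ep Bp] <-]//].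
    by have [p Ep pz] := BA _ Bz; exists p => //; split => //=; rewrite pz.
  rewrite BE imT; last by move=> ? [].
  apply: (plane_coord_measurable aphi apsi); rewrite -?BE// => p [Ep _].
    exact: ED.
  exact: ED'.
(* The pieces have countably many indices; once enumerated, they are made disjoint by [seqDU]. *)
pose G (n : nat) : set (R * R) :=
  if @pickle_inv (rat * nat * (int * int))%type n is Some i then
    if 0 <= i.1.1 then piece i.1.1 i.1.2 i.2 else set0 else set0.
have mG n : measurable (G n).
  by rewrite /G; case: pickle_inv => // i; case: ifP => // _; exact: measurable_piece.
pose F n := A `&` seqDU G n.
have mF n : measurable (F n).
  apply: measurableI => //; rewrite /seqDU; apply: measurableD => //.
  exact: bigsetU_measurable.
have tF : trivIset setT F by apply: trivIset_setIl; exact: trivIset_seqDU.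
have AF : A = \bigcup_n F n.
  rewrite -setI_bigcupr -seqDU_bigcup_eq; apply/esym/setIidPl => z Az.
  have [q [k [c [q0 Pz]]]] := cover (AW _ Az).
  exists (pickle (q, k, c)); [exact: Logic.I|].
  by rewrite /G pickleK_inv /= q0.
have mwA : measurable_fun A (fun z => (w z ^+ 2)%:E).
  by apply/measurable_EFinP/measurable_funX; apply: measurable_funS mw.
(* Injectivity keeps the images of the disjoint pieces disjoint, so that their areas add up. *)
have TI z z' : A z -> A z' -> T z = T z' -> z = z'.
  move=> [p Ep <-] [p' Ep' <-]; rewrite /T /trans_plane !coord_invK//.
  - by move=> /(congr1 (coord_inv psi)); rewrite !coord_invK//; [move=> ->|exact: ED'..].
  - exact: ED.
  - exact: ED.
have tTF : trivIset setT (fun n => T @` F n).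
  apply/trivIsetP => i j _ _ ij; apply/seteqP; split => // y [[z [Az Fz] <-] [z' [Az' Fz'] e]].
  have zz' := TI _ _ Az' Az e; rewrite zz' in Fz'.
  move/trivIsetP : (trivIset_seqDU G) => /(_ i j Logic.I Logic.I ij) /seteqP[h _].
  exact: (h z (conj Fz Fz')).
have mTF n : measurable (T @` F n) by apply: mTB => // z [].
rewrite -(imT E)// -/A {1}AF ge0_integral_bigcup//.
- rewrite [X in T @` X]AF image_bigcup measure_semi_bigcup//; last first.
    exact: bigcupT_measurable.
  rewrite -nneseriesZl; last by move=> i _; exact: measure_ge0.
  apply: lee_nneseries => [n _ _|n _].
    by apply: integral_ge0 => z _; rewrite lee_fin sqr_ge0.
  have sub : F n `<=` G n by move=> z [_ []].
  move: sub; rewrite {1}/G; case: pickle_inv => [i|] sub; last first.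
    have -> : F n = set0 by apply/seteqP; split.
    by rewrite integral_set0 image_set0 measure0 mule0.
  case: ifP sub => [q0|_] sub; first exact: (piece_le _ sub).
  have -> : F n = set0 by apply/seteqP; split.
  by rewrite integral_set0 image_set0 measure0 mule0.
- by rewrite -AF.
- by move=> z _; rewrite lee_fin sqr_ge0.
Qed.

End StretchArea.

(** * Line integrals *)

Section StieltjesRegular.
Context {R : realType}.
Variables (s : cumulative R R) (a b : R).
Let mu := lebesgue_stieltjes_measure s.

Lemma lebesgue_stieltjes_itvoc (c d : R) : c <= d -> mu `]c, d] = (s d - s c)%:E.
Proof.
move=> cd; have -> : mu `]c, d] = wlength s `]c, d]%classic.
  rewrite /mu /lebesgue_stieltjes_measure /measure_extension/=.
  by rewrite measurable_mu_extE//; exact: is_ocitv.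
rewrite wlength_itv/= lte_fin; case: ltgtP cd => // -[->] _.
by rewrite subrr.
Qed.

(* Outer regularity on the line, from that in the plane. *)
Lemma stieltjes_outer_regular (F : set R) (e : R) : a <= b -> measurable F ->
  0 < e -> exists U, [/\ open U, F `<=` U
    & (mu (U `&` `]a, b]) <= mu (F `&` `]a, b]) + e%:E)%E].
Proof.
move=> ab mF e0; pose j (t : R) : R * R := (t, 0).
have cj : continuous j by move=> t; apply: (@cvg_pair _ _ _ (nbhs t) (nbhs t) (nbhs (0 : R)));
    [exact: cvg_id|exact: cvg_cst].
have mj : @measurable_fun _ _ (measurableTypeR R) (plane R) setT j.
  by apply: measurable_fun_pair; [exact: measurable_id|exact: measurable_cst].
have mI : @measurable _ (measurableTypeR R) `]a, b]%classic by exact: measurable_itv.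
pose m0 : {measure set (measurableTypeR R) -> \bar R} := mrestr mu mI.
pose m : {measure set (plane R) -> \bar R} :=
  measure_function_pushforward__canonical__measure_function_Measure m0 mj.
have mE A : m A = mu (j @^-1` A `&` `]a, b]%classic) by [].
have mfin : (m setT < +oo)%E.
  by rewrite mE preimage_setT setTI lebesgue_stieltjes_itvoc// ltry.
have mA : measurable (F `*` setT : set (R * R)) by apply: measurableX.
have [V [oV FV hV]] := finite_measure_outer_regular mfin mA e0.
exists (j @^-1` V); split => //.
- by apply: open_comp => // t _; exact: cj.
- by move=> t Ft; apply: FV.
- move: hV; rewrite !mE (_ : j @^-1` (F `*` setT) = F)//.
  by apply/seteqP; split => // t [].
Qed.

End StieltjesRegular.

(** * Growth of a function along a Stieltjes measure *)

Section GrowthBound.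
Context {R : realType}.
Implicit Types (f G : R -> R).

(** The supremum of the points up to which the inequality holds satisfies it by the local estimate
    on its left and, if less than [b], is passed by the one on its right. *)
Lemma local_increments_global f G (c b : R) : c <= b ->
  {in `[c, b] &, {homo G : x y / x <= y}} ->
  (forall t, c <= t <= b -> exists2 d, 0 < d & forall u, c <= u <= b ->
    `|u - t| < d -> `|f u - f t| <= `|G u - G t|) ->
  `|f b - f c| <= G b - G c.
Proof.
move=> cb ndG loc.
have ndG' x y : c <= x -> x <= y -> y <= b -> G x <= G y.
  by move=> cx xy yb; apply: ndG => //; rewrite in_itv/=; apply/andP; split;
    [|exact: le_trans yb|exact: le_trans xy|].
pose S := [set u | c <= u <= b /\ `|f u - f c| <= G u - G c].
have Sc : S c by split; rewrite ?lexx ?cb// !subrr normr0.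
have hS : has_sup S by split; [exists c|exists b => u [/andP[]]].
pose t := sup S.
have ct : c <= t by apply: ub_le_sup => //; exact: hS.2.
have tb : t <= b by apply: ge_sup; [exists c|move=> u [/andP[]]].
have [|d d0 hd] := loc t; first by rewrite ct tb.
have [u [/andP[cu ub] fu] tu] := sup_adherent d0 hS.
have ut : u <= t by apply: ub_le_sup; [exact: hS.2|split; rewrite ?cu].
have St : S t.
  split; first by rewrite ct tb.
  have : `|f u - f t| <= `|G u - G t|.
    apply: hd; first by rewrite cu ub.
    by rewrite ltr_distl; apply/andP; split; [|rewrite (le_lt_trans ut)// ltrDl].
  rewrite distrC (distrC (G u)) (ger0_norm (_ : 0 <= G t - G u)) ?subr_ge0 ?ndG'//.
  move=> h; rewrite (_ : f t - f c = (f t - f u) + (f u - f c)); last by ring.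
  apply: le_trans (ler_normD _ _) _; lra.
have [/eqP tb'|tb'] := boolP (t == b); first by rewrite -tb'; case: St.
have tlb : t < b by rewrite lt_neqAle tb' tb.
pose v := Num.min b (t + d / 2).
have tv : t < v by rewrite lt_min tlb ltrDl divr_gt0.
have vb : v <= b by rewrite ge_min lexx.
have Sv : S v.
  split; first by rewrite vb (le_trans ct)// ltW.
  have : `|f v - f t| <= `|G v - G t|.
    apply: hd; first by rewrite vb (le_trans ct)// ltW.
    rewrite ger0_norm ?subr_ge0 1?ltW// ltrBlDl.
    by rewrite (le_lt_trans (_ : v <= t + d / 2)) ?ge_min ?lexx ?orbT// ltrD2l ltr_pdivrMr// ltr_pMr// ltr1n.
  have tvG : 0 <= G v - G t by rewrite subr_ge0; apply: ndG' => //; exact: ltW.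
  rewrite (ger0_norm tvG).
  move=> h; rewrite (_ : f v - f c = (f v - f t) + (f t - f c)); last by ring.
  apply: le_trans (ler_normD _ _) _; case: St => _ h'; lra.
have : v <= t by apply: ub_le_sup => //; exact: hS.2.
by rewrite leNgt tv.
Qed.

Variables (s : cumulative R R) (a b : R) (w f : R -> R).
Let mu := lebesgue_stieltjes_measure s.
Hypothesis ab : a < b.
Hypothesis w_ge0 : forall t, a < t <= b -> 0 <= w t.
Hypothesis mw : measurable_fun `]a, b]%classic w.
Hypothesis fw : forall t, a <= t <= b -> forall e, 0 < e ->
  exists2 d, 0 < d & forall u, a <= u <= b -> `|u - t| < d ->
    `|f u - f t| <= (w t + e) * `|s u - s t|.

Let I := (\int[mu]_(t in `]a, b]) (w t)%:E)%E.

Let le_mu (A B : set R) : measurable A -> measurable B -> A `<=` B -> (mu A <= mu B)%E.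
Proof. by move=> mA mB; exact: (@le_measure _ _ _ mu A B (mem_set mA) (mem_set mB)). Qed.

Let mI : measurable (`]a, b]%classic : set R). Proof. exact: measurable_itv. Qed.

Let level (eta : R) (j : nat) : set R :=
  `]a, b] `&` [set t | j%:R * eta <= w t < j.+1%:R * eta].

Let m_level eta j : measurable (level eta j).
Proof.
rewrite /level (_ : [set t | _] = w @^-1` `[j%:R * eta, j.+1%:R * eta[%classic).
  by apply: mw => //; exact: measurable_itv.
by apply/seteqP; split => t /=; rewrite in_itv.
Qed.

(** As [w] is only measurable, its values are cut into levels of height [eta], and each level set is
    enlarged to an open set [U j] of almost the same measure. A function whose density with respect
    to [ds] is at least [(j + 2) eta] on [U j] then grows at least as fast as [f] near each point.
    The point [a] belongs to no level set, hence the start at [c > a]. *)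
Let growth_aux (eta c : R) : 0 < eta -> a < c <= b ->
  (`|f b - f c|%:E <= I + (2 * eta * (s b - s a) + eta)%:E)%E.
Proof.
move=> eta0 /andP[ac cb].
have [Iy|Ify] := eqVneq I +oo%E; first by rewrite Iy addye// leey.
have If : I \is a fin_num.
  by rewrite ge0_fin_numE ?lt_neqAle ?Ify ?leey//; apply: integral_ge0 => t /=;
    rewrite in_itv/= => h; rewrite lee_fin w_ge0.
have mL' j : @measurable _ (measurableTypeR R) (level eta j) := m_level eta j.
have mI' : @measurable _ (measurableTypeR R) `]a, b]%classic := mI.
have eta2 : 0 <= 2 * eta by rewrite mulr_ge0// ltW.
(* With the weight [(j + 2) eta] on [U j], the excess measure of [U j] costs [eta / 2 ^ j.+1], and
   these costs sum to [eta]. *)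
pose e_ (j : nat) : R := (j.+2%:R * (2 ^ j.+1)%:R)^-1.
have e_gt0 j : 0 < e_ j by rewrite invr_gt0 mulr_gt0// ltr0n expn_gt0.
have hU j : exists U, [/\ open U, level eta j `<=` U
    & (mu (U `&` `]a, b]) <= mu (level eta j) + (e_ j)%:E)%E].
  have [U [oU LU h]] := stieltjes_outer_regular s (ltW ab) (m_level eta j) (e_gt0 j).
  by exists U; split => //; rewrite (_ : level eta j `&` `]a, b] = level eta j)// in h;
    apply/setIidPl => t [].
have {hU}[U hU] := choice hU.
have mU j : measurable (U j) by apply: open_measurable; case: (hU j).
pose Ge (u : R) := (\sum_(j <oo) (j.+2%:R * eta)%:E * mu (U j `&` `]a, u]))%E.
have coef0 (j : nat) : 0 <= j.+2%:R * eta by rewrite mulr_ge0// ltW.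
have term0 (j : nat) (A : set R) : (0 <= (j.+2%:R * eta)%:E * mu A)%E.
  by apply: mule_ge0; [rewrite lee_fin|exact: measure_ge0].
have mUI j u : measurable (U j `&` `]a, u]) by apply: measurableI => //; exact: measurable_itv.
have Ge_b : (Ge b <= I + (2 * eta * (s b - s a) + eta)%:E)%E.
  apply: (@le_trans _ _ (\sum_(j <oo)
     (\int[mu]_(t in level eta j) ((w t)%:E + (2 * eta)%:E) + (eta / (2 ^ j.+1)%:R)%:E))%E).
    apply: lee_nneseries => // j _; have [_ _ h] := hU j.
    apply: (@le_trans _ _ ((j.+2%:R * eta)%:E * (mu (level eta j) + (e_ j)%:E))%E).
      by rewrite lee_wpmul2l ?lee_fin.
    rewrite ge0_muleDr//; last by rewrite lee_fin ltW.
    apply: leeD.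
      have -> : ((j.+2%:R * eta)%:E * mu (level eta j) =
        \int[mu]_(t in level eta j) (j.+2%:R * eta)%:E)%E by rewrite integral_cst.
      apply: ge0_le_integral => //.
      + by move=> t _; rewrite lee_fin.
      + apply: emeasurable_funD; last exact: measurable_cst.
        by apply/measurable_EFinP; apply: measurable_funS mw => // t [].
      + move=> t [/= tab /andP[h1 h2]]; rewrite -EFinD lee_fin.
        by rewrite -(natr1 j.+1) -(natr1 j); lra.
    rewrite -EFinM lee_fin /e_.
    have x0 : j.+2%:R != 0 :> R by rewrite pnatr_eq0.
    have y0 : (2 ^ j.+1)%:R != 0 :> R by rewrite pnatr_eq0 expn_eq0.
    move: (j.+2%:R : R) ((2 ^ j.+1)%:R : R) x0 y0 => x y x0 y0.
    suff -> : x * eta * (x * y)^-1 = eta / y by [].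
    by field; rewrite x0 y0.
  apply: le_trans (epsilon_trick xpredT _ (ltW eta0)) _.
    move=> j; apply: integral_ge0 => t [/= tab _]; rewrite -EFinD lee_fin addr_ge0//.
    by apply: w_ge0; rewrite in_itv in tab.
  rewrite EFinD addeA leeD2r//.
  have tL : trivIset setT (level eta).
    apply/trivIsetP => i j _ _ ij; apply/seteqP; split => // t [[_ /andP[h1 h2]] [_ /andP[h3 h4]]].
    have : i%:R * eta < j.+1%:R * eta by exact: le_lt_trans h4.
    have : j%:R * eta < i.+1%:R * eta by exact: le_lt_trans h2.
    rewrite !ltr_pM2r// !ltr_nat !ltnS => ji ij'.
    by case/eqP: ij; apply/eqP; rewrite eqn_leq ij' ji.
  have UL : \bigcup_j level eta j = `]a, b]%classic.
    apply/seteqP; split => [t [j _ []]//|t tab].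
    have wt : 0 <= w t / eta by apply: divr_ge0; [apply: w_ge0; rewrite /= in_itv in tab|exact: ltW].
    exists (Num.truncn (w t / eta)) => //; split => //=.
    rewrite -ler_pdivlMr// -ltr_pdivrMr//.
    by have /andP[-> ->] := truncn_itv wt.
  rewrite -ge0_integral_bigcup//; last first.
  + move=> t; rewrite UL /= in_itv/= => tab; rewrite -EFinD lee_fin addr_ge0 ?w_ge0//.
  + rewrite UL; apply: emeasurable_funD; last exact: measurable_cst.
    exact/measurable_EFinP.
  have w0E t : `]a, b]%classic t -> (0 <= (w t)%:E)%E.
    by rewrite /= in_itv/= => tab; rewrite lee_fin w_ge0.
  have mwE : @measurable_fun _ _ (measurableTypeR R) _ `]a, b]%classic (EFin \o w).
    exact/measurable_EFinP.
  rewrite UL (ge0_integralD _ mI' w0E mwE); last exact: measurable_cst.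
    rewrite leeD2l// integral_cst//.
    by rewrite [X in (_ * X)%E](lebesgue_stieltjes_itvoc s (ltW ab)) -EFinM.
  by move=> t _; rewrite lee_fin.
have Ge_fin u : u <= b -> Ge u \is a fin_num.
  move=> ub; rewrite ge0_fin_numE; last by apply: nneseries_ge0 => j _ _.
  apply: (@le_lt_trans _ _ (Ge b)).
    apply: lee_nneseries => // j _; rewrite lee_wpmul2l ?lee_fin//; apply: le_mu => //.
    by apply: setIS => t /=; rewrite !in_itv/= => /andP[-> /le_trans]; apply.
  by apply: (le_lt_trans Ge_b); rewrite -(fineK If) -EFinD ltry.
(* The [j]-th term of the series alone accounts for this growth; the others do not decrease. *)
have Ge_step j t u : a < t -> t <= u -> u <= b -> `]t, u] `<=` U j ->
    (Ge t + ((j.+2%:R * eta) * (s u - s t))%:E <= Ge u)%E.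
  move=> at_ tu ub tuU.
  rewrite /Ge !(@nneseriesD1 _ _ j xpredT)//; try by move=> *; exact: term0.
  rewrite addeAC; apply: leeD.
    rewrite (EFinM _ (s u - s t)) -[X in (_ + _ * X)%E](lebesgue_stieltjes_itvoc s tu) -ge0_muleDr//.
    rewrite lee_wpmul2l ?lee_fin//.
    have -> : (mu (U j `&` `]a, t]) + mu `]t, u] = mu ((U j `&` `]a, t]) `|` `]t, u]))%E.
      apply/esym; apply: measureU; [exact: mUI|exact: measurable_itv|].
      apply/seteqP; split => // x [[_ /=]]; rewrite !in_itv/= => /andP[_ h].
      by move=> /andP[/lt_le_trans/(_ h)]; rewrite ltxx.
    apply: le_mu => //; first by apply: measurableU => //; exact: measurable_itv.
    move=> x [[Ux]|xtu].
      by rewrite /= !in_itv/= => /andP[ax xt]; split => //; rewrite /= ?in_itv/= ?ax ?(le_trans xt).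
    split; first exact: tuU.
    by move: xtu; rewrite /= !in_itv/= => /andP[tx ->]; rewrite (lt_trans at_ tx).
  apply: lee_nneseries => [*|i _]; first exact: term0.
  rewrite lee_wpmul2l ?lee_fin//; apply: le_mu => //.
  by apply: setIS => x /=; rewrite !in_itv/= => /andP[-> /le_trans]; apply.
pose G u := fine (Ge u).
have GE u : u <= b -> Ge u = (G u)%:E by move=> ub; rewrite /G fineK// Ge_fin.
have step j t u : a < t -> t <= u -> u <= b -> `]t, u] `<=` U j ->
    (j.+2%:R * eta) * (s u - s t) <= G u - G t.
  move=> at_ tu ub tuU; have := Ge_step j t u at_ tu ub tuU.
  by rewrite !GE// ?(le_trans tu)// -EFinD lee_fin lerBrDl.
have G0 u : 0 <= G u by rewrite fine_ge0//; apply: nneseries_ge0 => *; exact: term0.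
apply: le_trans Ge_b; rewrite GE// lee_fin.
apply: (@le_trans _ _ (G b - G c)); last by rewrite gerBl.
apply: local_increments_global => // [x y|t /andP[ct tb]].
  rewrite !in_itv/= => /andP[cx xb] /andP[cy yb] xy.
  rewrite -lee_fin -!GE//; apply: lee_nneseries => [*|i _]; first exact: term0.
  rewrite lee_wpmul2l ?lee_fin//; apply: le_mu => //.
  by apply: setIS => z /=; rewrite !in_itv/= => /andP[-> /le_trans]; apply.
have at_ : a < t by exact: lt_le_trans ct.
have wt0 : 0 <= w t by rewrite w_ge0// at_.
pose j := Num.truncn (w t / eta).
have Lt : level eta j t.
  split; first by rewrite /= in_itv/= at_.
  rewrite /= -ler_pdivlMr// -ltr_pdivrMr//.
  by have /andP[-> ->] := truncn_itv (divr_ge0 wt0 (ltW eta0)).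
have [oU LU _] := hU j.
have [d1 /= d10 hd1] : exists2 d1, 0 < d1 & ball t d1 `<=` U j.
  by apply/nbhs_ballP; apply: open_nbhs_nbhs; split => //; exact: LU.
have [|d2 d20 hd2] := fw (t := t) _ eta0; first by rewrite ltW.
exists (Num.min d1 d2); first by rewrite lt_min d10.
move=> u /andP[cu ub]; rewrite lt_min => /andP[ud1 ud2].
apply: le_trans (hd2 u _ ud2) _; first by rewrite ub andbT (le_trans (ltW ac)).
have wj : w t + eta <= j.+2%:R * eta.
  by case: Lt => _ /andP[_]; rewrite -(natr1 j.+1); lra.
apply: (@le_trans _ _ (j.+2%:R * eta * `|s u - s t|)); first by rewrite ler_wpM2r.
have [tu|ut] := leP t u.
  rewrite ger0_norm ?subr_ge0 ?cumulative_is_nondecreasing//.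
  apply: le_trans (step j t u _ _ _ _) (ler_norm _) => // x; rewrite /= in_itv/= => /andP[tx xu].
  apply: hd1; rewrite /ball/= ltr_distlC; rewrite ltr_distl in ud1.
  by case/andP: ud1 => h1 h2; apply/andP; split; lra.
have sut : 0 <= s t - s u by rewrite subr_ge0 cumulative_is_nondecreasing// ltW.
rewrite distrC (distrC (G u)) (ger0_norm sut).
apply: le_trans (step j u t _ (ltW ut) tb _) (ler_norm _).
  exact: lt_le_trans cu.
move=> x; rewrite /= in_itv/= => /andP[ux xt].
apply: hd1; rewrite /ball/= ltr_distlC; rewrite ltr_distl in ud1.
by case/andP: ud1 => h1 h2; apply/andP; split; lra.
Qed.

(** The half-open interval of integration leaves out [a]; there the increment of [f] is made small
    by the right continuity of [s]. *)
Lemma growth_le_integral : (`|f b - f a|%:E <= I)%E.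
Proof.
have I0 : (0 <= I)%E.
  by apply: integral_ge0 => t /=; rewrite in_itv/= => h; rewrite lee_fin w_ge0.
have M0 : 0 <= s b - s a by rewrite subr_ge0 cumulative_is_nondecreasing// ltW.
apply/lee_addgt0Pr => e e0.
have e40 : 0 < e / 4 by rewrite divr_gt0.
have wa0 : 0 < `|w a| + 1 by rewrite ltr_wpDl.
have [|d d0 hd] := fw (t := a) _ (@ltr01 R); first by rewrite lexx ltW.
have [dd] := nondecreasing_right_continuousP a s (divr_gt0 e40 wa0).
pose d' : R := dd%:num; have d'0 : 0 < d' by rewrite /d'.
rewrite -/d' => hd'.
pose c := Num.min b (a + Num.min (d / 2) d').
have ac : a < c by rewrite lt_min ab ltrDl lt_min divr_gt0.
have cb : c <= b by rewrite ge_min lexx.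
have fca : `|f c - f a| <= e / 4.
  have cd : `|c - a| < d.
    rewrite ger0_norm ?subr_ge0 1?ltW// ltrBlDl.
    apply: (@le_lt_trans _ _ (a + d / 2)).
      by rewrite ge_min; apply/orP; right; rewrite lerD2l ge_min lexx.
    by rewrite ltrD2l ltr_pdivrMr// ltr_pMr// ltr1n.
  apply: le_trans (hd c _ cd) _; first by rewrite ltW.
  have sca : 0 <= s c - s a by rewrite subr_ge0 cumulative_is_nondecreasing// ltW.
  rewrite (ger0_norm sca); apply: (@le_trans _ _ ((`|w a| + 1) * (s c - s a))).
    by rewrite ler_wpM2r// lerD2r ler_norm.
  rewrite mulrC -ler_pdivlMr// lerBlDl; apply: le_trans hd'.
  apply: cumulative_is_nondecreasing; rewrite /c ge_min; apply/orP; right.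
  by rewrite lerD2l ge_min lexx orbT.
(* Chosen so that the error [2 * eta * (s b - s a) + eta] of [growth_aux] is exactly [e / 4]. *)
pose eta := e / 4 / (2 * (s b - s a) + 1).
have den0 : 0 < 2 * (s b - s a) + 1 by rewrite ltr_wpDl// mulr_ge0.
have eta0 : 0 < eta by rewrite divr_gt0.
have := growth_aux eta0 (_ : a < c <= b); rewrite ac cb => /(_ isT) h.
apply: (@le_trans _ _ (`|f b - f c|%:E + (e / 4)%:E)%E).
  rewrite -EFinD lee_fin (_ : f b - f a = (f b - f c) + (f c - f a)); last by ring.
  by apply: le_trans (ler_normD _ _) _; rewrite lerD2l.
apply: (@le_trans _ _ (I + (2 * eta * (s b - s a) + eta)%:E + (e / 4)%:E)%E).
  by rewrite leeD2r.
rewrite -addeA leeD2l// -EFinD lee_fin.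
have -> : 2 * eta * (s b - s a) + eta = e / 4.
  by rewrite /eta; field; rewrite gt_eqF.
lra.
Qed.

End GrowthBound.

(** * Arc length and line integrals in charts *)

Section ArcLength.
Context {R : realType}.
Implicit Types (f : R -> (R[i])^o) (s : cumulative R R).

Lemma arc_length_function_ge f (a b : R) s t u : arc_length_function f a b s ->
  a <= t -> t <= u -> u <= b -> cnorm (f u - f t) <= s u - s t.
Proof.
move=> h at_ tu ub; have := h t u at_ tu ub; rewrite /arc_length => E.
rewrite -lee_fin E; apply: ereal_sup_ubound.
have [tu'|ut] := ltP t u.
  exists [:: u]; first exact: itv_partition1.
  by rewrite /polygon_length big_nat1.
have -> : u = t by apply/eqP; rewrite eq_le ut tu.
exists [::]; first by split.
by rewrite /polygon_length big_geq// subrr /cnorm normr0.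
Qed.

Lemma arc_length_function_sub f (a b a' b' : R) s : a <= a' -> b' <= b ->
  arc_length_function f a b s -> arc_length_function f a' b' s.
Proof.
move=> aa bb h t u at_ tu ub.
by apply: h => //; [exact: le_trans at_|exact: le_trans bb].
Qed.

Lemma eq_arc_length_function f f' (a b : R) s :
  (forall t, a <= t <= b -> f t = f' t) ->
  arc_length_function f a b s -> arc_length_function f' a b s.
Proof.
move=> ff h t u at_ tu ub; rewrite (h t u at_ tu ub) /arc_length; congr ereal_sup.
apply: eq_imagel => p tup /=; rewrite /polygon_length; congr EFin.
apply: eq_big_nat => n /= np.
have nth_in m : (m < (size p).+1)%N -> a <= nth u (t :: p) m <= b.
  move=> mp; rewrite (le_trans at_) ?(itv_partition_nth_ge mp tup)//.
  by rewrite (le_trans _ ub)// (itv_partition_nth_le mp tup).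
by rewrite (ff _ (nth_in n.+1 np)) (ff _ (nth_in n (ltnW np))).
Qed.

End ArcLength.

Section LineIntegral.
Context {R : realType} {X : riemann_surface R}.
Implicit Types (rho : density X) (gamma : R -> X) (phi : chart R X).

(** The part of [allowable] on which estimates of line integrals rest. A competitor has it before
    its area is known to be finite and nonzero. *)
Record measurable_density rho : Prop := MeasurableDensity {
  mdensity_ge0 : forall phi p, atlas phi -> chart_dom phi p -> 0 <= rho phi (phi p);
  mdensity_measurable : forall phi, atlas phi ->
    measurable_fun (plane_coord phi @` chart_dom phi)
      (fun z : R * R => rho phi (z.1 +i* z.2)%C) }.

Lemma allowable_measurable_density rho : allowable rho -> measurable_density rho.
Proof. by case=> h1 h2 *; split. Qed.

Lemma line_integral_le rho gamma a b l : line_integral rho gamma a b l -> a <= b.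
Proof. by elim=> // ? ? ? ? ? _ h1 _ h2; exact: le_trans h2. Qed.

(* [s + Re (phi o gamma)] and [s] are nondecreasing, hence measurable. *)
Lemma measurable_chart_curve phi gamma (a b : R) (s : cumulative R R) :
  arc_length_function (phi \o gamma) a b s ->
  measurable_fun `]a, b]%classic (fun t => plane_coord phi (gamma t)).
Proof.
move=> hs; have mI : measurable (`]a, b]%classic : set R) by exact: measurable_itv.
have key (p : R -> R) : (forall t u, a <= t -> t <= u -> u <= b ->
     `|p u - p t| <= cnorm (phi (gamma u) - phi (gamma t))) ->
    measurable_fun `]a, b]%classic p.
  move=> hp; have [ab|ba] := leP a b; last first.
    rewrite (_ : `]a, b]%classic = set0); first exact: measurable_fun_set0.
    by apply/seteqP; split => // t /=; rewrite in_itv/= => /andP[/lt_le_trans h /h /lt_trans/(_ ba)]; rewrite ltxx.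
  (* [c] clamps [t] to [[a, b]], outside which monotonicity is not known. *)
  pose c (t : R) := Num.max a (Num.min b t).
  have cI t : a <= c t <= b by rewrite /c le_max lexx ge_max ab ge_min lexx.
  have ndc : nondecreasing_fun c.
    by move=> t u tu; rewrite /c; apply: le_max2 => //; apply: le_min2.
  apply: (@eq_measurable_fun _ _ _ _ _ (fun t => (s (c t) + p (c t)) - s (c t))).
    move=> t; rewrite inE /= in_itv/= => /andP[at_ tb].
    rewrite addrC addKr /c; congr p.
    by rewrite (min_idPr tb) (max_idPr (ltW at_)).
  apply: measurable_funB; apply: nondecreasing_measurable => // t u tu.
    have /andP[h1 _] := cI t; have /andP[_ h2] := cI u.
    have h3 := arc_length_function_ge hs h1 (ndc _ _ tu) h2.
    have := le_trans (hp _ _ h1 (ndc _ _ tu) h2) h3.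
    by rewrite ler_norml => /andP[h _]; lra.
  exact/cumulative_is_nondecreasing/ndc.
have m1 : measurable_fun `]a, b]%classic (fun t => complex.Re (phi (gamma t))).
  apply: key => t u _ _ _; apply: le_trans (le_ofC_cnorm _).
  by rewrite prod_normE le_max; case: (phi _) => ? ?; case: (phi _) => ? ?; rewrite lexx.
have m2 : measurable_fun `]a, b]%classic (fun t => complex.Im (phi (gamma t))).
  apply: key => t u _ _ _; apply: le_trans (le_ofC_cnorm _).
  by rewrite prod_normE le_max; case: (phi _) => ? ?; case: (phi _) => ? ?; rewrite lexx orbT.
exact: (measurable_fun_pairD mI m1 m2).
Qed.

Lemma measurable_density_curve rho phi gamma (a b : R) (s : cumulative R R) :
  measurable_density rho -> atlas phi ->
  (forall t, a <= t <= b -> chart_dom phi (gamma t)) ->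
  arc_length_function (phi \o gamma) a b s ->
  measurable_fun `]a, b]%classic (fun t => (rho phi (phi (gamma t)))%:E).
Proof.
move=> [_ mrho] aphi dphi hs; apply/measurable_EFinP.
pose D := plane_coord phi @` chart_dom phi.
have mD : measurable D.
  exact: (open_measurable2 (plane_coord_open aphi (atlas_open aphi) (@subset_refl _ _))).
have : measurable_fun `]a, b]%classic
   ((fun z : R * R => rho phi (z.1 +i* z.2)%C) \o (fun t => plane_coord phi (gamma t))).
  apply: (measurable_comp mD _ (mrho phi aphi)); last exact: measurable_chart_curve hs.
  move=> _ [t /= tab <-]; exists (gamma t) => //; apply: dphi.
  by move: tab; rewrite in_itv/= => /andP[/ltW -> ->].
apply: eq_measurable_fun => t _ /=; congr (rho phi _).
by rewrite /plane_coord; case: (phi _).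
Qed.

Lemma density_curve_ge0 rho phi gamma (a b : R) : measurable_density rho ->
  atlas phi -> (forall t, a <= t <= b -> chart_dom phi (gamma t)) ->
  forall t, `]a, b]%classic t -> (0 <= (rho phi (phi (gamma t)))%:E)%E.
Proof.
move=> [rho0 _] aphi dphi t /=; rewrite in_itv/= => /andP[/ltW at_ tb].
by rewrite lee_fin; apply: rho0 => //; apply: dphi; rewrite at_.
Qed.

Lemma line_integral_ge0 rho gamma a b l : measurable_density rho ->
  line_integral rho gamma a b l -> (0 <= l)%E.
Proof.
move=> mrho; elim=> [phi a' b' s aphi ab dphi hs|? ? ? ? ? _ h1 _ h2].
  by apply: integral_ge0; exact: density_curve_ge0.
exact: adde_ge0.
Qed.

Lemma eq_line_integral rho gamma gamma' a b l :
  line_integral rho gamma a b l -> (forall t, a <= t <= b -> gamma t = gamma' t) ->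
  line_integral rho gamma' a b l.
Proof.
elim=> [phi a' b' s aphi ab dphi hs gg|a' b' c' k' l' h1 IH1 h2 IH2 gg].
- have -> : (\int[lebesgue_stieltjes_measure s]_(t in `]a', b']%classic)
      (rho phi (phi (gamma t)))%:E =
    \int[lebesgue_stieltjes_measure s]_(t in `]a', b']%classic)
      (rho phi (phi (gamma' t)))%:E)%E.
    apply: eq_integral => t; rewrite inE /= in_itv/= => /andP[/ltW h1 h2].
    by rewrite gg// h1.
  apply: line_integral_chart => //; first by move=> t tab; rewrite -gg//; exact: dphi.
  by apply: eq_arc_length_function hs => t tab /=; rewrite gg.
- have ab := line_integral_le h1; have bc := line_integral_le h2.
  apply: line_integral_cat; [apply: IH1|apply: IH2] => t /andP[t1 t2]; apply: gg.
    by rewrite t1 (le_trans t2).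
  by rewrite t2 (le_trans _ t1).
Qed.

(** Line integrals are given by a relation, so the comparison produces a value for [rho] from the
    same subdivision, charts and arc-length functions. *)
Lemma le_line_integral rho rho' gamma a b l : measurable_density rho ->
  measurable_density rho' -> line_integral rho' gamma a b l ->
  (forall t phi, a <= t <= b -> atlas phi -> chart_dom phi (gamma t) ->
     rho phi (phi (gamma t)) <= rho' phi (phi (gamma t))) ->
  exists2 l', (l' <= l)%E & line_integral rho gamma a b l'.
Proof.
move=> mrho mrho'.
elim=> [phi a' b' s aphi ab dphi hs le|a' b' c' k' l' h1 IH1 h2 IH2 le].
- eexists; last exact: line_integral_chart _ aphi ab dphi hs.
  apply: ge0_le_integral.
  + exact: measurable_itv.
  + exact: density_curve_ge0.
  + exact: measurable_density_curve hs.
  + exact: measurable_density_curve hs.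
  + move=> t /=; rewrite in_itv/= => /andP[/ltW t1 t2].
    by rewrite lee_fin; apply: le => //; [rewrite t1|apply: dphi; rewrite t1].
- have ab := line_integral_le h1; have bc := line_integral_le h2.
  have [|k1 k1k' H1] := IH1.
    by move=> t phi /andP[t1 t2]; apply: le; rewrite t1 (le_trans t2).
  have [|k2 k2l' H2] := IH2.
    by move=> t phi /andP[t1 t2]; apply: le; rewrite t2 (le_trans _ t1).
  by exists (k1 + k2)%E; [exact: leeD|exact: line_integral_cat H2].
Qed.

Lemma line_integral_split rho gamma a c l u : measurable_density rho ->
  line_integral rho gamma a c l -> a <= u <= c ->
  exists k k', [/\ line_integral rho gamma a u k, line_integral rho gamma u c k'
                 & l = (k + k')%E].
Proof.
move=> mrho; move=> h; elim: h u => [phi a' b' s aphi ab dphi hs|a' b' c' k l' h1 IH1 h2 IH2] u.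
- move=> /andP[au ub].
  have d1 t : a' <= t <= u -> chart_dom phi (gamma t).
    by move=> /andP[t1 t2]; apply: dphi; rewrite t1 (le_trans t2).
  have d2 t : u <= t <= b' -> chart_dom phi (gamma t).
    by move=> /andP[t1 t2]; apply: dphi; rewrite t2 (le_trans _ t1).
  eexists; eexists; split.
  + exact: (line_integral_chart _ aphi au d1 (arc_length_function_sub (lexx _) ub hs)).
  + exact: (line_integral_chart _ aphi ub d2 (arc_length_function_sub au (lexx _) hs)).
  + have E : `]a', b']%classic = `]a', u] `|` `]u, b'] :> set R.
      by rewrite -itv_bndbnd_setU// bnd_simp.
    rewrite E ge0_integral_setU//.
    * by rewrite -E; exact: measurable_density_curve hs.
    * by rewrite -E; exact: density_curve_ge0.
    * rewrite disj_set2E; apply/eqP/seteqP; split => // x [/=]; rewrite !in_itv/=.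
      by move=> /andP[_ xu] /andP[/lt_le_trans/(_ xu)]; rewrite ltxx.
- have ab := line_integral_le h1; have bc := line_integral_le h2.
  move=> /andP[au uc]; have [ub|bu] := leP u b'.
    have [|k1 [k2 [H1 H2 ->]]] := IH1 u; first by rewrite au.
    exists k1, (k2 + l')%E; split => //; last by rewrite addeA.
    exact: line_integral_cat H2 h2.
  have [|k1 [k2 [H1 H2 ->]]] := IH2 u; first by rewrite uc ltW.
  exists (k + k1)%E, k2; split => //; last by rewrite addeA.
  exact: line_integral_cat h1 H1.
Qed.

Lemma line_integral_sub rho gamma a b l a' b' : measurable_density rho ->
  line_integral rho gamma a b l -> a <= a' -> a' <= b' -> b' <= b ->
  exists2 l', (l' <= l)%E & line_integral rho gamma a' b' l'.
Proof.
move=> mrho h aa ab bb.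
have [|k [k' [h1 h2 ->]]] := line_integral_split (u := a') mrho h.
  by rewrite aa (le_trans ab).
have [|k1 [k2 [h3 h4 ->]]] := line_integral_split (u := b') mrho h2.
  by rewrite ab bb.
exists k1 => //; apply: (@le_trans _ _ (k1 + k2)%E).
  by rewrite leeDl// (line_integral_ge0 mrho h4).
by rewrite leeDr// (line_integral_ge0 mrho h1).
Qed.

(* [|dg| <= rho |dz|] at [p]. *)
Definition dominates rho (g : X -> R) (p : X) := forall phi, atlas phi ->
  chart_dom phi p -> forall e : R, 0 < e -> \forall q \near p,
    `|g q - g p| <= (rho phi (phi p) + e) * cnorm (phi q - phi p).

(** In a chart [dominates] bounds the increments of [g] by [rho] times chords, and a chord is at
    most the arc; [growth_le_integral] integrates this. Positive lower bounds for lengths all come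
    from here. *)
Lemma line_integral_ge_variation rho (g : X -> R) gamma a b l :
  measurable_density rho -> {within `[a, b], continuous gamma} ->
  (forall t, a <= t <= b -> dominates rho g (gamma t)) ->
  line_integral rho gamma a b l -> (`|g (gamma b) - g (gamma a)|%:E <= l)%E.
Proof.
move=> mrho cg dom h; elim: h cg dom => [phi a' b' s aphi ab dphi hs|a' b' c' k l' h1 IH1 h2 IH2] cg dom.
- have [ab0|ab'] := eqVneq a' b'.
    rewrite ab0 subrr normr0; apply: integral_ge0 => t /=; rewrite in_itv/= => /andP[h1 h2].
    by have := lt_le_trans h1 h2; rewrite ltxx.
  apply: (@growth_le_integral _ s a' b' (fun t => rho phi (phi (gamma t))) (g \o gamma)).
  + by rewrite lt_neqAle ab' ab.
  + move=> t /andP[t1 t2]; apply: mdensity_ge0 => //; apply: dphi.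
    by rewrite t2 ltW.
  + by apply/measurable_EFinP; exact: measurable_density_curve hs.
  + move=> t tab e e0; have nq := dom t tab phi aphi (dphi t tab) e e0.
    have ct := iffLR (subspace_continuousP _ _) cg t.
    have [|d /= d0 hd] := iffLR (nbhs_ballP _ _) (ct _ _ nq); first by rewrite /= in_itv.
    exists d => // u uab ut.
    have {}hd : `|g (gamma u) - g (gamma t)| <=
        (rho phi (phi (gamma t)) + e) * cnorm (phi (gamma u) - phi (gamma t)).
      by apply: hd; [rewrite -ball_normE/= distrC|rewrite /= in_itv].
    apply: le_trans hd _; rewrite ler_wpM2l//.
      by apply: addr_ge0; [apply: mdensity_ge0 => //; exact: dphi|exact: ltW].
    have /andP[t1 t2] := tab; have /andP[u1 u2] := uab.
    have [tu|ut'] := leP t u.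
      by apply: le_trans (arc_length_function_ge hs t1 tu u2) (ler_norm _).
    rewrite -cnormN opprB distrC.
    by apply: le_trans (arc_length_function_ge hs u1 (ltW ut') t2) (ler_norm _).
- have ab := line_integral_le h1; have bc := line_integral_le h2.
  rewrite (_ : g _ - g _ = (g (gamma c') - g (gamma b')) + (g (gamma b') - g (gamma a'))); last by ring.
  apply: (@le_trans _ _ (`|g (gamma b') - g (gamma a')|%:E + `|g (gamma c') - g (gamma b')|%:E)%E).
    by rewrite -EFinD lee_fin addrC ler_normD.
  apply: leeD; [apply: IH1|apply: IH2].
  + apply: continuous_subspaceW cg => t /=; rewrite !in_itv/= => /andP[-> t2].
    exact: le_trans bc.
  + by move=> t /andP[t1 t2]; apply: dom; rewrite t1 (le_trans t2).
  + apply: continuous_subspaceW cg => t /=; rewrite !in_itv/= => /andP[t1 ->].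
    by rewrite (le_trans ab).
  + by move=> t /andP[t1 t2]; apply: dom; rewrite t2 (le_trans _ t1).
Qed.

End LineIntegral.

(** * Coordinate squares and competitors *)

Section Discs.
Context {R : realType} {X : riemann_surface R}.

(* The norm of [R * R] is the sup norm, so that this is a coordinate square. *)
Record disc := Disc {
  dchart : chart R X;
  dcenter : R * R;
  dradius : R;
  dchart_atlas : atlas dchart;
  dradius_gt0 : 0 < dradius;
  dsub : forall z, `|dcenter - z| <= dradius ->
     (plane_coord dchart @` chart_dom dchart) z }.
Implicit Types (d : disc) (x : X).

(** The sup-norm distance to the centre, cut off at the radius so as to extend continuously by a
    constant to all of [X]. Concentric squares and their boundaries become sublevel and level sets
    in [X]. *)
Definition gauge d x : R :=
  if x \in chart_dom (dchart d)
  then Num.min `|dcenter d - plane_coord (dchart d) x| (dradius d)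
  else dradius d.

Lemma gauge_le_radius d x : gauge d x <= dradius d.
Proof. by rewrite /gauge; case: ifP => // _; rewrite ge_min lexx orbT. Qed.

Lemma gauge_ge0 d x : 0 <= gauge d x.
Proof.
have r0 := ltW (dradius_gt0 d).
by rewrite /gauge; case: ifP => // _; rewrite le_min normr_ge0 r0.
Qed.

Lemma gauge_lt d x : gauge d x < dradius d -> chart_dom (dchart d) x /\
  gauge d x = `|dcenter d - plane_coord (dchart d) x|.
Proof.
rewrite /gauge; case: ifPn => [/set_mem Dx|]; last by rewrite ltxx.
by rewrite gt_min ltxx orbF => h; split => //; apply/min_idPl/ltW.
Qed.

Lemma gauge_coord d z : `|dcenter d - z| <= dradius d ->
  [/\ chart_dom (dchart d) (coord_inv (dchart d) z),
      plane_coord (dchart d) (coord_inv (dchart d) z) = z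
    & gauge d (coord_inv (dchart d) z) = `|dcenter d - z|].
Proof.
move=> h; have [D E] := plane_coordK (dchart_atlas d) (dsub h); split => //.
by rewrite /gauge mem_set// E; apply/min_idPl.
Qed.

Let K d : set X := coord_inv (dchart d) @` [set z | `|dcenter d - z| <= dradius d].

Lemma compact_square (c : R * R) (r : R) : compact [set z | `|c - z| <= r].
Proof.
have -> : [set z | `|c - z| <= r] = `[c.1 - r, c.1 + r] `*` `[c.2 - r, c.2 + r].
  apply/seteqP; split => w /=; rewrite prod_normE/= ge_max !ler_distlC !in_itv/=.
    by move=> /andP[-> ->].
  by move=> [-> ->].
by apply: compact_setX; exact: segment_compact.
Qed.

Let compact_K d : compact (K d).
Proof.
apply: continuous_compact; last exact: compact_square.
apply/subspace_continuousP => z zr; apply: cvg_within_filter.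
exact: (coord_inv_continuous (dchart_atlas d) (dsub zr)).
Qed.

(** The case to exclude is a point outside the chart that is a limit of points of the square: the
    closed square is compact, hence closed in the Hausdorff space [X], and [gauge d] is constant off
    it. *)
Lemma gauge_continuous d : continuous (gauge d).
Proof.
move=> x; have [Dx|nDx] := pselect (chart_dom (dchart d) x).
  have c1 : {for x, continuous (fun y =>
      Num.min `|dcenter d - plane_coord (dchart d) y| (dradius d))}.
    apply: continuous_min; last exact: cvg_cst.
    apply: cvg_norm; apply: cvgB; first exact: cvg_cst.
    exact: (plane_coord_continuous (dchart_atlas d) Dx).
  have E y : chart_dom (dchart d) y -> gauge d y =
      Num.min `|dcenter d - plane_coord (dchart d) y| (dradius d).
    by move=> Dy; rewrite /gauge mem_set.
  rewrite /continuous_at (E x Dx).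
  apply: cvg_trans c1; apply: near_eq_cvg.
  by near=> y; rewrite E//; near: y; exact: (near_chart_dom (dchart_atlas d)).
have oK : open (~` K d).
  by apply: closed_openC; exact: compact_closed (@surface_hausdorff _ X) (@compact_K d).
have E y : ~ K d y -> gauge d y = dradius d.
  move=> nK; apply/eqP; rewrite eq_le gauge_le_radius leNgt; apply/negP => /gauge_lt[Dy e].
  apply: nK; exists (plane_coord (dchart d) y); last by rewrite coord_invK//; exact: dchart_atlas.
  by rewrite /= -e gauge_le_radius.
have nKx : ~ K d x by move=> [z /gauge_coord[Dz _ _] zx]; apply: nDx; rewrite -zx.
rewrite /continuous_at (E x nKx).
apply: cvg_near_cst; near=> y; apply: E; near: y; exact: open_nbhs_nbhs.
Unshelve. all: by end_near. Qed.

Lemma exists_disc x : exists d, gauge d x = 0.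
Proof.
have [psi apsi Dx] := atlas_cover x.
have oV : open (plane_coord psi @` chart_dom psi).
  exact: (plane_coord_open apsi (atlas_open apsi) (@subset_refl _ _)).
have : nbhs (plane_coord psi x) (plane_coord psi @` chart_dom psi).
  by apply: open_nbhs_nbhs; split => //; exists x.
move=> /nbhs_ballP[e /= e0 he].
have e20 : 0 < e / 2 by rewrite divr_gt0.
have sub z : `|plane_coord psi x - z| <= e / 2 -> (plane_coord psi @` chart_dom psi) z.
  move=> h; apply: he; rewrite -ball_normE/=; apply: le_lt_trans h _.
  by rewrite ltr_pdivrMr// ltr_pMr// ltr1n.
exists (Disc apsi e20 sub); rewrite /gauge/= mem_set// subrr normr0.
exact/min_idPl/ltW.
Qed.

(** Recentring within one chart: areas must decay around every point of a square, while the segments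
    issued from different points have to end at a common point of the same chart. *)
Lemma exists_subdisc d x : gauge d x <= dradius d / 2 ->
  exists d', [/\ dchart d' = dchart d, dcenter d' = plane_coord (dchart d) x
    & dradius d' = dradius d / 2].
Proof.
move=> h; have r0 := dradius_gt0 d.
have [|Dx e] := @gauge_lt d x.
  by apply: le_lt_trans h _; rewrite ltr_pdivrMr// ltr_pMr// ltr1n.
have r20 : 0 < dradius d / 2 by rewrite divr_gt0.
have sub z : `|plane_coord (dchart d) x - z| <= dradius d / 2 ->
    (plane_coord (dchart d) @` chart_dom (dchart d)) z.
  move=> hz; apply: dsub; rewrite e in h.
  rewrite (_ : dcenter d - z = (dcenter d - plane_coord (dchart d) x) +
     (plane_coord (dchart d) x - z)); last by rewrite addrA subrK.
  by apply: le_trans (ler_normD _ _) _; rewrite [leRHS]splitr lerD.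
by exists (Disc (dchart_atlas d) r20 sub).
Qed.

End Discs.
Arguments disc {R} X.

Section StretchChain.
Context {R : realType} {X : riemann_surface R}.
Implicit Types (phi psi : chart R X) (p : X).

(** A nearby point with nonzero displacement, by which first-order estimates can be divided. *)
Lemma near_point_neq phi p (N : set X) : atlas phi -> chart_dom phi p -> nbhs p N ->
  exists2 q, N q & 0 < cnorm (phi q - phi p).
Proof.
move=> aphi Dp nN; have imD : (plane_coord phi @` chart_dom phi) (plane_coord phi p) by exists p.
have n1 : \forall z \near plane_coord phi p, N (coord_inv phi z).
  by apply: (coord_inv_continuous aphi imD); rewrite coord_invK.
have n2 : \forall z \near plane_coord phi p, (plane_coord phi @` chart_dom phi) z.
  apply: open_nbhs_nbhs; split => //.
  exact: (plane_coord_open aphi (atlas_open aphi) (@subset_refl _ _)).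
have n12 : nbhs (plane_coord phi p) [set z | N (coord_inv phi z) /\
    (plane_coord phi @` chart_dom phi) z] by exact: filterI n1 n2.
have [e /= e0 he] := iffLR (nbhs_ballP _ _) n12.
pose z := plane_coord phi p + (e / 2, 0).
have e20 : 0 < e / 2 by rewrite divr_gt0.
have nz : `|(e / 2, 0) : R * R| = e / 2.
  by rewrite prod_normE/= normr0 ger0_norm ?ltW//; apply/max_idPl/ltW.
have [|Nz Dz] := he z.
  rewrite -ball_normE/= opprD addrA subrr sub0r normrN nz.
  by rewrite ltr_pdivrMr// ltr_pMr// ltr1n.
exists (coord_inv phi z) => //.
have [_ E] := plane_coordK aphi Dz.
apply: lt_le_trans (le_ofC_cnorm _); rewrite ofCB.
by rewrite -!plane_coordE E /z addrC addKr nz.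
Qed.

Lemma stretch_refl phi p : atlas phi -> chart_dom phi p -> stretch phi phi p = 1.
Proof.
move=> aphi Dp; apply/eqP; rewrite -subr_eq0 -normr_le0; apply/ler_addgt0Pr => e e0.
rewrite add0r; have [q] := near_point_neq aphi Dp (transition_local aphi aphi Dp Dp e0).
move=> h q0; rewrite -(ler_pM2r q0) -[X in _ * X <= _](ger0_norm (ltW q0)) -normrM.
by rewrite mulrBl mul1r distrC.
Qed.

(** [x], [y], [z] are the displacements of one nearby point in the charts [phi], [phi'], [psi], and
    [A], [B], [C] the stretches from [phi] to [psi], from [phi'] to [psi] and from [phi] to
    [phi']. *)
Let chain_bound (A B C e e0 x y z : R) : 0 <= B -> 0 <= C -> 0 < e -> e <= 1 ->
  e * (3 + B + C) <= e0 -> 0 < x -> `|z - A * x| <= e * x ->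
  `|z - B * y| <= e * y -> `|y - C * x| <= e * x -> `|A - B * C| <= e0.
Proof.
move=> B0 C0 e_gt0 e_le1 e_le x0.
rewrite !ler_norml => /andP[a1 a2] /andP[b1 b2] /andP[c1 c2].
have yb : y <= (C + 1) * x by nra.
have eyb : e * y <= e * ((C + 1) * x) by rewrite ler_wpM2l// ltW.
have Bc1 : B * (y - C * x) <= B * (e * x) by rewrite ler_wpM2l.
have Bc2 : B * (- (e * x)) <= B * (y - C * x) by rewrite ler_wpM2l.
have ex0 : 0 <= e * x by rewrite mulr_ge0// ltW.
have fin : e * (3 + B + C) * x <= e0 * x by rewrite ler_wpM2r// ltW.
by apply/andP; split; rewrite -(ler_pM2r x0); nra.
Qed.

Lemma stretch_chain phi phi' psi p : atlas phi -> atlas phi' -> atlas psi ->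
  chart_dom phi p -> chart_dom phi' p -> chart_dom psi p ->
  stretch phi psi p = stretch phi' psi p * stretch phi phi' p.
Proof.
move=> aphi aphi' apsi Dp Dp' Ds; have := stretch_ge0 phi' psi p.
have := stretch_ge0 phi phi' p.
have h1 := fun e => transition_local aphi apsi Dp Ds (e := e).
have h2 := fun e => transition_local aphi' apsi Dp' Ds (e := e).
have h3 := fun e => transition_local aphi aphi' Dp Dp' (e := e).
move: (stretch phi psi p) (stretch phi' psi p) (stretch phi phi' p) h1 h2 h3.
move=> A B C h1 h2 h3 C0 B0.
apply/eqP; rewrite -subr_eq0 -normr_le0; apply/ler_addgt0Pr => e0 e00; rewrite add0r.
have den : 0 < 3 + B + C by rewrite -addrA ltr_pwDl// addr_ge0.
pose e := Num.min 1 (e0 / (3 + B + C)).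
have e_gt0 : 0 < e by rewrite lt_min ltr01 divr_gt0.
have e_le1 : e <= 1 by rewrite ge_min lexx.
have e_le : e * (3 + B + C) <= e0 by rewrite -ler_pdivlMr// ge_min lexx orbT.
have [q [[b1 b2] b3] q0] :=
  near_point_neq aphi Dp (filterI (filterI (h1 _ e_gt0) (h2 _ e_gt0)) (h3 _ e_gt0)).
exact: (chain_bound B0 C0 e_gt0 e_le1 e_le q0 b1 b2 b3).
Qed.

End StretchChain.

(** * Area over subsets of the surface *)

Section AreaOn.
Context {R : realType} {X : riemann_surface R}.
Implicit Types (rho : density X) (G E : set X) (phi psi : chart R X).

Definition pieces n (phi : 'I_n -> chart R X) (E : 'I_n -> set X) :=
  [/\ forall i, atlas (phi i) /\ E i `<=` chart_dom (phi i),
      forall i, measurable (plane_coord (phi i) @` E i)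
    & trivIset [set: 'I_n] E].

(** [area] is a supremum over families of pieces rather than a measure; this is its localization to
    [G], monotone in [G] and superadditive over disjoint sets. *)
Definition area_on rho G : \bar R :=
  ereal_sup [set A | exists (n : nat) (phi : 'I_n -> chart R X) (E : 'I_n -> set X),
    [/\ pieces phi E, forall i, E i `<=` G
      & A = (\sum_(i < n) area_in rho (phi i) (E i))%E]].

Lemma area_onT rho : area rho = area_on rho setT.
Proof.
congr ereal_sup; apply/seteqP; split => A [n [phi [E]]].
  by case=> h1 h2 h3 ->; exists n, phi, E; split.
by case=> -[h1 h2 h3] _ ->; exists n, phi, E; split.
Qed.

Lemma area_in_ge0 rho phi E : (0 <= area_in rho phi E)%E.
Proof. by apply: integral_ge0 => z _; rewrite lee_fin sqr_ge0. Qed.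

Lemma area_on_ge0 rho G : (0 <= area_on rho G)%E.
Proof.
have f : 'I_0 -> chart R X by case.
apply: ereal_sup_ubound; exists 0%N, f, (fun _ => set0).
by split; [split; [case|case|apply/trivIsetP => -[]]|case|rewrite big_ord0].
Qed.

Lemma le_area_on rho G G' : G `<=` G' -> (area_on rho G <= area_on rho G')%E.
Proof.
move=> GG'; apply: ge_ereal_sup => A [n [phi [E [h1 h2 ->]]]].
by apply: ereal_sup_ubound; exists n, phi, E; split => // i; apply: (subset_trans (h2 i)).
Qed.

Lemma le_area_on_sum rho G n (phi : 'I_n -> chart R X) (E : 'I_n -> set X) : pieces phi E ->
  (forall i, E i `<=` G) ->
  (\sum_(i < n) area_in rho (phi i) (E i) <= area_on rho G)%E.
Proof. by move=> h1 h2; apply: ereal_sup_ubound; exists n, phi, E. Qed.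

Lemma area_in_le_area_on rho phi E G : atlas phi -> E `<=` chart_dom phi ->
  E `<=` G -> measurable (plane_coord phi @` E) ->
  (area_in rho phi E <= area_on rho G)%E.
Proof.
move=> aphi ED EG mE; apply: ereal_sup_ubound.
exists 1%N, (fun _ => phi), (fun _ => E); split => //; last by rewrite big_ord1.
split => //; apply/trivIsetP => i j _ _; by rewrite !ord1.
Qed.

(** Families over disjoint sets are juxtaposed. This direction turns [area rho = 1] into an upper
    bound for the inner area once the outer area is bounded below. *)
Lemma area_on_setU rho G G' : G `&` G' = set0 ->
  (area_on rho G + area_on rho G' <= area_on rho (G `|` G'))%E.
Proof.
move=> GG'; set M := area_on rho (G `|` G').
have key n (phi : 'I_n -> chart R X) (E : 'I_n -> set X) m
     (phi' : 'I_m -> chart R X) (E' : 'I_m -> set X) : @pieces n phi E -> (forall i, E i `<=` G) ->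
    @pieces m phi' E' -> (forall i, E' i `<=` G') ->
    (\sum_(i < n) area_in rho (phi i) (E i) +
     \sum_(i < m) area_in rho (phi' i) (E' i) <= M)%E.
  move=> [h1 h2 h3] h4 [h1' h2' h3'] h4'; apply: ereal_sup_ubound.
  pose f T (a : 'I_n -> T) (b : 'I_m -> T) (i : 'I_(n + m)) : T :=
    match fintype.split i with inl j => a j | inr j => b j end.
  exists (n + m)%N, (f _ phi phi'), (f _ E E'); split.
  - split.
    + by move=> i; rewrite /f; case: (fintype.split i) => j; [exact: h1|exact: h1'].
    + by move=> i; rewrite /f; case: (fintype.split i) => j; [exact: h2|exact: h2'].
    + apply/trivIsetP => i j _ _ ij; apply/seteqP; split => // x; rewrite /f.
      have := splitK i; have := splitK j.
      case: (fintype.split j) => j' ej; case: (fintype.split i) => i' ei [x1 x2].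
      * move/trivIsetP : h3 => /(_ i' j' Logic.I Logic.I).
        have -> : i' != j' by apply: contra_neq ij => e; rewrite -ei -ej e.
        by move=> /(_ isT) /seteqP[h _]; exact: (h x).
      * suff : (G `&` G') x by rewrite GG'.
        by split; [exact: h4 x2|exact: h4' x1] || by split; [exact: h4 x1|exact: h4' x2].
      * suff : (G `&` G') x by rewrite GG'.
        by split; [exact: h4 x2|exact: h4' x1] || by split; [exact: h4 x1|exact: h4' x2].
      * move/trivIsetP : h3' => /(_ i' j' Logic.I Logic.I).
        have -> : i' != j' by apply: contra_neq ij => e; rewrite -ei -ej e.
        by move=> /(_ isT) /seteqP[h _]; exact: (h x).
  - move=> i; rewrite /f; case: (fintype.split i) => j x Ex; [left; exact: h4 Ex|right; exact: h4' Ex].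
  - rewrite big_split_ord /f/=; congr (_ + _)%E; apply: eq_bigr => i _.
      by rewrite (unsplitK (inl i)).
    by rewrite (unsplitK (inr i)).
(* The two suprema are removed one at a time by subtraction, which requires finite values. *)
have [->|My] := eqVneq M +oo%E; first by rewrite leey.
have Mf : M \is a fin_num by rewrite ge0_fin_numE ?area_on_ge0// lt_neqAle My leey.
have le1 : (area_on rho G <= M)%E by apply: le_area_on; exact: subsetUl.
have le2 : (area_on rho G' <= M)%E by apply: le_area_on; exact: subsetUr.
have Gf : area_on rho G \is a fin_num.
  by rewrite ge0_fin_numE ?area_on_ge0//; apply: le_lt_trans le1 _; rewrite -ge0_fin_numE ?area_on_ge0.
rewrite -leeBrDl//; apply: ge_ereal_sup => _ [m [phi' [E' [p' s' ->]]]].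
have [G'f|] := boolP ((\sum_(i < m) area_in rho (phi' i) (E' i))%E \is a fin_num); last first.
  rewrite ge0_fin_numE; last by apply: sume_ge0 => *; exact: area_in_ge0.
  rewrite -leNgt leye_eq => /eqP sy.
  have := le_area_on_sum rho p' s'; rewrite sy leye_eq => /eqP h.
  by move: le2; rewrite h leye_eq (negbTE My).
rewrite leeBrDr// -leeBrDl//; apply: ge_ereal_sup => _ [n [phi [E [p s ->]]]].
by rewrite leeBrDr//; exact: key.
Qed.

End AreaOn.

(** * The competitor metric and its area *)

Section Competitor.
Context {R : realType} {X : riemann_surface R}.
Implicit Types (rho : density X) (phi psi : chart R X) (d : disc X) (E : set X) (a b B : R).

(** The Euclidean metric [|dz|] of the chart of [d] on a closed square, written in all other
    charts. *)
Definition flat_density d (b : R) : density X := fun phi z =>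
  if gauge d (chart_inv phi z) <= b then stretch phi (dchart d) (chart_inv phi z) else 0.

Definition truncated rho d (a : R) : density X := fun phi z =>
  if gauge d (chart_inv phi z) < a then 0 else rho phi z.

Definition competitor rho d (a b B : R) : density X := fun phi z =>
  truncated rho d a phi z + B * flat_density d b phi z.

Lemma competitorE rho d a b B phi p : atlas phi -> chart_dom phi p ->
  competitor rho d a b B phi (phi p) =
  (if gauge d p < a then 0 else rho phi (phi p)) +
  B * (if gauge d p <= b then stretch phi (dchart d) p else 0).
Proof.
by move=> aphi Dp; rewrite /competitor /truncated /flat_density chart_invK.
Qed.

Lemma measurable_fun_ite (D : set (R * R)) (P : R * R -> bool) (f g : R * R -> R) :
  measurable D -> measurable (D `&` [set z | P z]) ->
  measurable_fun (D `&` [set z | P z]) f ->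
  measurable_fun (D `&` [set z | ~~ P z]) g ->
  measurable_fun D (fun z => if P z then f z else g z).
Proof.
move=> mD mP mf mg.
have mN : measurable (D `&` [set z | ~~ P z]).
  rewrite (_ : _ `&` _ = D `\` (D `&` [set z | P z])); first exact: measurableD.
  apply/seteqP; split => z [Dz /= h]; split => //; first by move=> [_]; apply/negP.
  by apply/negP => Pz; apply: h.
have -> : D = (D `&` [set z | P z]) `|` (D `&` [set z | ~~ P z]).
  rewrite -setIUr; apply/esym/setIidPl => z _ /=.
  by case: (P z); [left|right].
apply/measurable_funU => //; split.
  by apply: eq_measurable_fun mf => z /set_mem[_ /= ->].
by apply: eq_measurable_fun mg => z /set_mem[_ /= /negbTE ->].
Qed.

Let V phi := plane_coord phi @` chart_dom phi.

Let oV phi : atlas phi -> open (V phi).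
Proof.
by move=> aphi; exact: (plane_coord_open aphi (atlas_open aphi) (@subset_refl _ _)).
Qed.

Let gauge_plane_cont d phi z : atlas phi -> V phi z ->
  {for z, continuous (fun z => gauge d (coord_inv phi z))}.
Proof.
move=> aphi Vz.
exact: (continuous_comp (coord_inv_continuous aphi Vz) (@gauge_continuous _ _ d _)).
Qed.

Lemma measurable_gauge d phi : atlas phi ->
  measurable_fun (V phi) (fun z => gauge d (coord_inv phi z)).
Proof.
move=> aphi; apply: (continuous_on_measurable2 (oV aphi)) => z Vz.
exact: gauge_plane_cont.
Qed.

Let measurable_gauge_le d phi b : atlas phi ->
  measurable (V phi `&` [set z | gauge d (coord_inv phi z) <= b]).
Proof.
move=> aphi; rewrite (_ : [set z | _] = (fun z => gauge d (coord_inv phi z)) @^-1` `]-oo, b]%classic).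
  apply: (measurable_gauge d aphi); first exact: (open_measurable2 (oV aphi)).
  exact: measurable_itv.
by apply/seteqP; split => z /=; rewrite in_itv.
Qed.

Let measurable_gauge_lt d phi b : atlas phi ->
  measurable (V phi `&` [set z | gauge d (coord_inv phi z) < b]).
Proof.
move=> aphi; rewrite (_ : [set z | _] = (fun z => gauge d (coord_inv phi z)) @^-1` `]-oo, b[%classic).
  apply: (measurable_gauge d aphi); first exact: (open_measurable2 (oV aphi)).
  exact: measurable_itv.
by apply/seteqP; split => z /=; rewrite in_itv.
Qed.

Lemma measurable_flat_density d b phi : atlas phi -> b < dradius d ->
  measurable_fun (V phi) (fun z : R * R => flat_density d b phi (z.1 +i* z.2)%C).
Proof.
move=> aphi bd; have mV := open_measurable2 (oV aphi).
apply: (@measurable_fun_ite _ (fun z => gauge d (coord_inv phi z) <= b)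
  (fun z => stretch phi (dchart d) (coord_inv phi z)) (fun=> 0)) => //.
  exact: measurable_gauge_le.
have oW : open (plane_coord phi @` (chart_dom phi `&` chart_dom (dchart d))).
  apply: (plane_coord_open aphi); last exact: subIsetl.
  exact: openI (atlas_open aphi) (atlas_open (dchart_atlas d)).
apply: (measurable_funS (open_measurable2 oW) _
  (measurable_stretch aphi (dchart_atlas d))).
move=> z [[p Dp <-]] /=; rewrite coord_invK// => h.
by exists p => //; split => //; case: (gauge_lt (le_lt_trans h bd)).
Qed.

Lemma competitor_measurable_density rho d a b B : measurable_density rho ->
  b < dradius d -> 0 <= B -> measurable_density (competitor rho d a b B).
Proof.
move=> [rho0 mrho] bd B0; split => [phi p aphi Dp|phi aphi].
  rewrite competitorE//; apply: addr_ge0; first by case: ifP => // _; exact: rho0.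
  by rewrite mulr_ge0//; case: ifP => // _; exact: stretch_ge0.
have mV := open_measurable2 (oV aphi).
apply: measurable_funD; last first.
  by apply: measurable_funM; [exact: measurable_cst|exact: measurable_flat_density].
apply: (@measurable_fun_ite _ (fun z => gauge d (coord_inv phi z) < a)
   (fun=> 0) (fun z : R * R => rho phi (z.1 +i* z.2)%C)) => //.
  exact: measurable_gauge_lt.
by apply: (measurable_funS mV _ (mrho phi aphi)) => z [].
Qed.

Lemma plane_coord_setI phi E (P : set X) : atlas phi -> E `<=` chart_dom phi ->
  plane_coord phi @` (E `&` P) = plane_coord phi @` E `&` [set z | P (coord_inv phi z)].
Proof.
move=> aphi ED; apply/seteqP; split => z.
  move=> [p [Ep Pp] <-]; split; first by exists p.
  by rewrite /= coord_invK//; exact: ED.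
by move=> [[p Ep <-]] /=; rewrite coord_invK//; [exists p|exact: ED].
Qed.

Lemma measurable_plane_coord_setI phi E d (i : interval R) :
  atlas phi -> E `<=` chart_dom phi -> measurable (plane_coord phi @` E) ->
  measurable (plane_coord phi @` (E `&` [set x | gauge d x \in i])).
Proof.
move=> aphi ED mE; rewrite plane_coord_setI//.
have AV : plane_coord phi @` E `<=` V phi by move=> _ [p Ep <-]; exists p => //; exact: ED.
have m := measurable_funS (open_measurable2 (oV aphi)) AV (measurable_gauge d aphi).
exact: (m mE _ (measurable_itv i)).
Qed.

End Competitor.

Section CompetitorArea.
Context {R : realType} {X : riemann_surface R}.
Implicit Types (rho : density X) (phi psi : chart R X) (d : disc X) (E : set X) (a b B : R).

Lemma measurable_density_piece rho phi E : measurable_density rho -> atlas phi ->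
  E `<=` chart_dom phi -> measurable (plane_coord phi @` E) ->
  measurable_fun (plane_coord phi @` E)
    (fun z : R * R => ((rho phi (z.1 +i* z.2)%C) ^+ 2)%:E).
Proof.
move=> [_ mrho] aphi ED mE; apply/measurable_EFinP/measurable_funX.
have mV := open_measurable2 (plane_coord_open aphi (atlas_open aphi) (@subset_refl _ _)).
apply: (measurable_funS mV _ (mrho phi aphi)).
by move=> _ [p Ep <-]; exists p => //; exact: ED.
Qed.

Lemma le_area_in rho phi E E' : measurable_density rho -> atlas phi ->
  E `<=` E' -> E' `<=` chart_dom phi -> measurable (plane_coord phi @` E) ->
  measurable (plane_coord phi @` E') -> (area_in rho phi E <= area_in rho phi E')%E.
Proof.
move=> mrho aphi EE' E'D mE mE'; apply: ge0_subset_integral => //.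
- exact: measurable_density_piece.
- by move=> z _; rewrite lee_fin sqr_ge0.
- exact: image_subset.
Qed.

Lemma pieces_setI n (phi : 'I_n -> chart R X) (E : 'I_n -> set X) d (i : interval R) :
  pieces phi E -> pieces phi (fun k => E k `&` [set x | gauge d x \in i]).
Proof.
move=> [h1 h2 h3]; split.
- by move=> k; have [? ED] := h1 k; split => // x [Ex _]; exact: ED.
- move=> k; have [? ED] := h1 k; exact: measurable_plane_coord_setI.
- by apply: trivIset_setIr.
Qed.

Lemma flat_density_area_in d b phi E : atlas phi -> b < dradius d ->
  E `<=` chart_dom phi -> measurable (plane_coord phi @` E) ->
  (area_in (flat_density d b) phi E <= 256%:E *
   lam2 R (plane_coord (dchart d) @` (E `&` [set x | (gauge d x \in `]-oo, b])%R])))%E.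
Proof.
move=> aphi bd ED mE; set S := _ `&` _.
have SD : S `<=` chart_dom phi by move=> x [Ex _]; exact: ED.
have SD' : S `<=` chart_dom (dchart d).
  by move=> x [_ /=]; rewrite in_itv/= => h; case: (gauge_lt (le_lt_trans h bd)).
have mS : measurable (plane_coord phi @` S) by exact: measurable_plane_coord_setI.
apply: le_trans (stretch_area aphi (dchart_atlas d) SD SD' mS).
have -> : plane_coord phi @` S = plane_coord phi @` E `&` plane_coord phi @` S.
  by apply/esym/setIidPr/image_subset => x [].
rewrite integral_mkcondr le_eqVlt; apply/orP; left; apply/eqP.
apply: eq_integral => z /set_mem[p Ep <-]; rewrite /flat_density /patch.
rewrite -/(toC (plane_coord phi p)) plane_coordE ofCK chart_invK//; last exact: ED.
case: ifPn => [gb|ngb].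
  rewrite mem_set ?coord_invK//; first exact: ED.
  by exists p => //; split => //=; rewrite in_itv.
case: ifPn => [/set_mem[q [Eq qS] qp]|_]; last by rewrite expr0n.
have qpe : q = p by rewrite -(coord_invK aphi (ED _ Eq)) qp coord_invK//; exact: ED.
by move: qS; rewrite /= in_itv/= qpe (negbTE ngb).
Qed.

(** In the chart of [d] the pieces become disjoint parts of a square of area [4 * b ^ 2]; the
    remaining factor 256 in 1024 is the loss in [stretch_area]. *)
Lemma flat_density_area d b n (phi : 'I_n -> chart R X) (E : 'I_n -> set X) :
  0 <= b < dradius d -> pieces phi E ->
  (\sum_(i < n) area_in (flat_density d b) (phi i) (E i) <= (1024 * b ^+ 2)%:E)%E.
Proof.
move=> /andP[b0 bd] pE; have [h1 h2 _] := pE.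
pose S i := E i `&` [set x | (gauge d x \in `]-oo, b])%R].
have [_ mS tS] := pieces_setI d `]-oo, b] pE.
have SD i : S i `<=` chart_dom (phi i) by move=> x [Ex _]; have [_ ED] := h1 i; exact: ED.
have SD' i : S i `<=` chart_dom (dchart d).
  by move=> x [_ /=]; rewrite in_itv/= => h; case: (gauge_lt (le_lt_trans h bd)).
pose F i := plane_coord (dchart d) @` S i.
have mF i : measurable (F i).
  by apply: (plane_coord_measurable (h1 i).1 (dchart_atlas d)) => //; exact: mS.
apply: (@le_trans _ _ (\sum_(i < n) 256%:E * lam2 R (F i))%E).
  by apply: lee_sum => i _; apply: flat_density_area_in => //; have [] := h1 i.
rewrite -ge0_sume_distrr; last by move=> i _; exact: measure_ge0.
have tF : trivIset setT F.
  apply/trivIsetP => i j _ _ ij; apply/seteqP; split => // z [[p Sp <-] [q Sq qp]].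
  have e : q = p by rewrite -(coord_invK (dchart_atlas d) (SD' _ _ Sq)) qp coord_invK//;
    [exact: dchart_atlas|exact: SD' Sp].
  move/trivIsetP : tS => /(_ i j Logic.I Logic.I ij) /seteqP[h _].
  by apply: (h p); split => //; rewrite -e.
have -> : 1024 * b ^+ 2 = 256 * (4 * b ^+ 2) by rewrite mulrA; congr (_ * _); ring.
rewrite EFinM -(lam2_closed_ball (dcenter d) b0); apply: lee_wpmul2l; first by rewrite lee_fin.
have mU : measurable (\big[setU/set0]_(i < n) F i) by exact: bigsetU_measurable.
have E' : (lam2 R (\big[setU/set0]_(i < n) F i) = \sum_(i < n) lam2 R (F i))%E.
  exact: (@measure_bigsetU_ord _ _ _ (lam2 R) n predT F).
rewrite -E'; apply: le_plane_measure => //; first exact: measurable_closed_ball2.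
apply: (big_ind (fun S : set (R * R) => S `<=` _)) => [//|S1 S2 hS1 hS2 z []|i _ z].
- exact: hS1.
- exact: hS2.
- move=> [p [_ /=]]; rewrite in_itv/= => h <-.
  by have [_ <-] := gauge_lt (le_lt_trans h bd).
Qed.

(** On the overlap [a <= gauge d <= b] one has [(x + B y) ^ 2 <= 2 x ^ 2 + 2 (B y) ^ 2]; one copy of
    [x ^ 2] is counted in the first term, the other in the second. *)
Lemma area_in_competitor rho d a b B phi E : measurable_density rho ->
  a <= b < dradius d -> 0 <= B -> atlas phi -> E `<=` chart_dom phi ->
  measurable (plane_coord phi @` E) ->
  (area_in (competitor rho d a b B) phi E <=
     area_in rho phi (E `&` [set x | (gauge d x \in `[a, +oo[)%R]) +
     area_in rho phi (E `&` [set x | (gauge d x \in `[a, b])%R]) +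
     (2 * B ^+ 2)%:E * area_in (flat_density d b) phi E)%E.
Proof.
move=> mrho /andP[ab bd] B0 aphi ED mE.
set S1 := E `&` _; set S2 := E `&` _.
pose A := plane_coord phi @` E.
have SI S : S `<=` E -> plane_coord phi @` S = A `&` plane_coord phi @` S.
  by move=> SE; apply/esym/setIidPr/image_subset.
have mS1 : measurable (plane_coord phi @` S1) by exact: measurable_plane_coord_setI.
have mS2 : measurable (plane_coord phi @` S2) by exact: measurable_plane_coord_setI.
have memS (S : set X) p : S `<=` E -> E p ->
    (plane_coord phi p \in plane_coord phi @` S) = (p \in S).
  move=> SE Ep; apply/idP/idP => /set_mem h; apply: mem_set; last by exists p.
  have [q Sq qp] := h; suff <- : q = p by [].
  by rewrite -(coord_invK aphi (ED _ (SE _ Sq))) qp coord_invK//; exact: ED.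
have mr := measurable_density_piece mrho aphi ED mE.
pose r (z : R * R) := ((rho phi (z.1 +i* z.2)%C) ^+ 2)%:E.
have mr1 (S : set X) : S `<=` E -> measurable (plane_coord phi @` S) ->
    measurable_fun A (r \_ (plane_coord phi @` S)).
  move=> SE mS; apply/(measurable_restrict r mS mE).
  by apply: (measurable_funS mE) => // z [].
have r_ge0 (S : set (R * R)) z : A z -> (0 <= (r \_ S) z)%E.
  by move=> _; rewrite /patch; case: ifP => // _; rewrite lee_fin sqr_ge0.
have mcomp := @competitor_measurable_density _ _ rho d a b B mrho bd B0.
have mflat : measurable_fun A
    (fun z : R * R => ((flat_density d b phi (z.1 +i* z.2)%C) ^+ 2)%:E).
  apply/measurable_EFinP/measurable_funX.
  have mV := open_measurable2 (plane_coord_open aphi (atlas_open aphi) (@subset_refl _ _)).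
  apply: (measurable_funS mV _ (measurable_flat_density aphi bd)).
  by move=> _ [p Ep <-]; exists p => //; exact: ED.
have B2 : 0 <= 2 * B ^+ 2 by rewrite mulr_ge0// sqr_ge0.
have -> : area_in rho phi S1 = (\int[lam2 R]_(z in A) (r \_ (plane_coord phi @` S1)) z)%E.
  by rewrite -integral_mkcondr -SI// => x [].
have -> : area_in rho phi S2 = (\int[lam2 R]_(z in A) (r \_ (plane_coord phi @` S2)) z)%E.
  by rewrite -integral_mkcondr -SI// => x [].
rewrite /area_in -/A.
have mA : @measurable _ (plane R) A := mE.
have S1E : S1 `<=` E by move=> ? [].
have S2E : S2 `<=` E by move=> ? [].
have m1 := mr1 _ S1E mS1; have m2 := mr1 _ S2E mS2.
rewrite -(ge0_integralZl_EFin _ mA _ mflat B2); last by move=> z _; rewrite lee_fin sqr_ge0.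
rewrite -(ge0_integralD _ mA (r_ge0 _) m1 (r_ge0 _) m2).
rewrite -ge0_integralD//; first last.
- by apply/measurable_EFinP/measurable_funM; [exact: measurable_cst|exact/measurable_EFinP].
- by move=> z _; rewrite -EFinM lee_fin mulr_ge0// sqr_ge0.
- exact: emeasurable_funD.
- by move=> z Az; apply: adde_ge0; exact: r_ge0.
apply: ge0_le_integral => //.
- by move=> z _; rewrite lee_fin sqr_ge0.
- exact: measurable_density_piece.
- apply: emeasurable_funD; first exact: emeasurable_funD.
  by apply/measurable_EFinP/measurable_funM; [exact: measurable_cst|exact/measurable_EFinP].
move=> _ [p Ep <-]; have Dp := ED _ Ep.
rewrite /patch !memS// /r -/(toC (plane_coord phi p)) plane_coordE ofCK competitorE//.
rewrite /flat_density chart_invK//.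
have -> : (p \in S1) = (a <= gauge d p).
  by apply/idP/idP => [/set_mem[_ /=]|h]; [rewrite in_itv/= andbT|
    apply: mem_set; split => //=; rewrite in_itv/= andbT].
have -> : (p \in S2) = (a <= gauge d p <= b).
  by apply/idP/idP => [/set_mem[_ /=]|h]; [rewrite in_itv|
    apply: mem_set; split => //=; rewrite in_itv].
move: (rho phi (phi p)) (stretch phi (dchart d) p) => x y.
rewrite ltNge; case: (leP a (gauge d p)) => /= _; case: (leP (gauge d p) b) => /= _;
  rewrite -?EFinM -?EFinD lee_fin; have := sqr_ge0 (x - B * y); rewrite ?expr2; nra.
Qed.

Lemma area_competitor rho d a b B : measurable_density rho ->
  0 <= a <= b -> b < dradius d -> 0 <= B ->
  (area (competitor rho d a b B) <=
     area_on rho [set x | (a <= gauge d x)%R] +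
     area_on rho [set x | (a <= gauge d x <= b)%R] +
     (2048 * B ^+ 2 * b ^+ 2)%:E)%E.
Proof.
move=> mrho /andP[a0 ab] bd B0; rewrite area_onT.
apply: ge_ereal_sup => _ [n [phi [E [pE _ ->]]]]; have [h1 h2 _] := pE.
have b0 := le_trans a0 ab.
apply: (@le_trans _ _ (\sum_(i < n)
   (area_in rho (phi i) (E i `&` [set x | (gauge d x \in `[a, +oo[)%R]) +
     area_in rho (phi i) (E i `&` [set x | (gauge d x \in `[a, b])%R]) +
     (2 * B ^+ 2)%:E * area_in (flat_density d b) (phi i) (E i)))%E).
  apply: lee_sum => i _; apply: area_in_competitor => //; rewrite ?ab ?bd//.
  - exact: (h1 i).1.
  - exact: (h1 i).2.
have s1 := @le_area_on_sum _ _ rho [set x | a <= gauge d x] n phi _ (pieces_setI d `[a, +oo[ pE).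
have s2 := @le_area_on_sum _ _ rho [set x | a <= gauge d x <= b] n phi _ (pieces_setI d `[a, b] pE).
have big_split3 (f g h : 'I_n -> \bar R) : (\sum_(i < n) (f i + g i + h i) =
    \sum_(i < n) f i + \sum_(i < n) g i + \sum_(i < n) h i)%E by rewrite !big_split.
rewrite big_split3; apply: leeD; first apply: leeD.
- by apply: s1 => i x [_ /=]; rewrite in_itv/= andbT.
- by apply: s2 => i x [_ /=]; rewrite in_itv.
- rewrite -ge0_sume_distrr; last by move=> i _; exact: area_in_ge0.
  apply: (@le_trans _ _ ((2 * B ^+ 2)%:E * (1024 * b ^+ 2)%:E)%E).
    rewrite lee_wpmul2l ?lee_fin ?mulr_ge0 ?sqr_ge0//.
    by apply: flat_density_area => //; rewrite b0.
  by rewrite -EFinM lee_fin le_eqVlt; apply/orP; left; apply/eqP; ring.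
Qed.

Lemma competitor_allowable rho d a b B : allowable rho ->
  0 <= a <= b -> 0 < b < dradius d -> 0 < B ->
  allowable (competitor rho d a b B).
Proof.
move=> Arho /andP[a0 ab] /andP[b0 bd] B0.
have mrho := allowable_measurable_density Arho.
have mc := @competitor_measurable_density _ _ rho d a b B mrho bd (ltW B0).
have fin_area : (area rho < +oo)%E.
  by rewrite lt_neqAle leey andbT; apply/eqP; exact: area_neqy.
split.
- exact: mdensity_ge0.
- exact: mdensity_measurable.
- move=> phi psi p aphi apsi Dp Dp'; rewrite !competitorE// -/(stretch phi psi p).
  have e1 : (if gauge d p < a then 0 else rho phi (phi p)) =
      (if gauge d p < a then 0 else rho psi (psi p)) * stretch phi psi p.
    by case: ifP => _; rewrite ?mul0r//; exact: density_transition.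
  have e2 : (if gauge d p <= b then stretch phi (dchart d) p else 0) =
      (if gauge d p <= b then stretch psi (dchart d) p else 0) * stretch phi psi p.
    have [h|h] := leP (gauge d p) b; last by rewrite mul0r.
    have [Dd _] := gauge_lt (le_lt_trans h bd).
    exact: (stretch_chain aphi apsi (dchart_atlas d) Dp Dp' Dd).
  have comb (x x' y y' k : R) : x = x' * k -> y = y' * k -> x + B * y = (x' + B * y') * k.
    by move=> -> ->; rewrite mulrDl mulrA.
  exact: (comb _ _ _ _ _ e1 e2).
- move=> phi p aphi Dp; have [E [oE Ep ED fE]] := density_locally_L2 Arho aphi Dp.
  exists E; split => //; have mE := open_measurable2 (plane_coord_open aphi oE ED).
  have mEi (i : interval R) : measurable (plane_coord phi @` (E `&` [set x | gauge d x \in i])).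
    exact: measurable_plane_coord_setI.
  apply: le_lt_trans (area_in_competitor mrho (_ : a <= b < dradius d) (ltW B0) aphi ED mE) _.
    by rewrite ab bd.
  apply: lte_add_pinfty; first apply: lte_add_pinfty.
  + by apply: le_lt_trans fE; apply: le_area_in => // x [].
  + by apply: le_lt_trans fE; apply: le_area_in => // x [].
  + have fa : (area_in (flat_density d b) phi E <= (1024 * b ^+ 2)%:E)%E.
      have := @flat_density_area d b 1 (fun=> phi) (fun=> E) (_ : 0 <= b < dradius d).
      rewrite big_ord1; apply; first by rewrite ltW.
      by split => //; apply/trivIsetP => i j _ _; rewrite !ord1.
    apply: lte_mul_pinfty => //; first by rewrite lee_fin mulr_ge0 ?sqr_ge0.
    by apply: le_lt_trans fa _; rewrite ltry.
(* Nonzero area: in the chart of [d] itself the stretch is 1, so the density is at least [B] on a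
   square of area [4 * b ^ 2]. *)
- apply/eqP; rewrite gt_eqF//.
  pose E := [set x | gauge d x < b].
  have ED : E `<=` chart_dom (dchart d) by move=> x h; case: (gauge_lt (lt_trans h bd)).
  have EE : plane_coord (dchart d) @` E = ball (dcenter d) b.
    apply/seteqP; split => z; rewrite -ball_normE/=.
      by move=> [x h <-]; have [_ <-] := gauge_lt (lt_trans h bd).
    move=> h; have [|D1 D2 D3] := @gauge_coord _ _ d z; first exact: ltW (lt_trans h bd).
    by exists (coord_inv (dchart d) z); rewrite // /E/= D3.
  have mE : measurable (plane_coord (dchart d) @` E).
    by rewrite EE; apply: open_measurable2; exact: ball_open.
  rewrite area_onT; apply: lt_le_trans (area_in_le_area_on _ (dchart_atlas d) ED (@subsetT _ _) mE).
  apply: (@lt_le_trans _ _ (B ^+ 2 * (4 * b ^+ 2))%:E).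
    by rewrite lte_fin !mulr_gt0// exprn_gt0.
  rewrite EFinM -(lam2_ball (dcenter d) (ltW b0)) -EE -integral_cst//.
  apply: ge0_le_integral => //.
  + by move=> z _; rewrite lee_fin sqr_ge0.
  + exact: (measurable_density_piece mc (dchart_atlas d) ED mE).
  + move=> _ [p Ep <-]; have Dp := ED _ Ep.
    rewrite -/(toC (plane_coord (dchart d) p)) plane_coordE ofCK competitorE//; last exact: dchart_atlas.
    rewrite (ltW Ep) stretch_refl//; last exact: dchart_atlas.
    rewrite mulr1 lee_fin.
    have : 0 <= (if gauge d p < a then 0 else rho (dchart d) (dchart d p)).
      by case: ifP => // _; apply: (mdensity_ge0 mrho (dchart_atlas d)).
    move: (if gauge d p < a then 0 else _) => t t0.
    by rewrite !expr2; nra.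
- apply/eqP; rewrite lt_eqF//.
  apply: le_lt_trans (area_competitor mrho (_ : 0 <= a <= b) bd (ltW B0)) _; first by rewrite a0.
  have fin_on G : (area_on rho G < +oo)%E.
    by apply: le_lt_trans fin_area; rewrite area_onT; exact: le_area_on.
  by apply: lte_add_pinfty; [apply: lte_add_pinfty; exact: fin_on|rewrite ltry].
Qed.

End CompetitorArea.

(** * Hitting times and the cost of crossing a ring *)

Section Hitting.
Context {R : realType}.
Implicit Types (f : R -> R) (a b s t u : R).

Lemma within_itv_dist f a b t e : {within `[a, b], continuous f} ->
  a <= t <= b -> 0 < e ->
  exists2 d, 0 < d & forall u, a <= u <= b -> `|t - u| < d -> `|f t - f u| < e.
Proof.
move=> cf tab e0; have tI : `[a, b]%classic t by rewrite /= in_itv.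
have nb : nbhs (f t) [set y | `|f t - y| < e].
  by apply/nbhs_ballP; exists e => //= y; rewrite -ball_normE.
have [d /= d0 hd] := iffLR (nbhs_ballP _ _) (iffLR (subspace_continuousP _ _) cf t tI _ nb).
exists d => // u uab tu; apply: hd; first by rewrite -ball_normE.
by rewrite /= in_itv.
Qed.

Lemma first_hit f a b s : a <= b -> {within `[a, b], continuous f} ->
  f a < s -> s <= f b ->
  exists t, [/\ a < t <= b, f t = s & forall u, a <= u -> u < t -> f u < s].
Proof.
move=> ab cf fa fb; pose S := [set t | a <= t <= b /\ s <= f t].
have Sb : S b by split; rewrite ?lexx ?ab.
have hS : has_inf S by split; [exists b|exists a => t [/andP[]]].
pose t := inf S.
have at_ : a <= t by apply: lb_le_inf; [exists b|move=> u [/andP[]]].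
have tb : t <= b by apply: ge_inf => //; exact: hS.2.
have lt_t u : a <= u -> u < t -> f u < s.
  move=> au ut; rewrite ltNge; apply/negP => su.
  have : t <= u by apply: ge_inf; [exact: hS.2|split; rewrite // au (le_trans (ltW ut))].
  by rewrite leNgt ut.
have tab : a <= t <= b by rewrite at_.
have ft1 : s <= f t.
  rewrite leNgt; apply/negP => fts.
  have e0 : 0 < s - f t by rewrite subr_gt0.
  have [d d0 hd] := within_itv_dist cf tab e0.
  have [u [/andP[au ub] su] ut] := inf_adherent d0 hS.
  have tu : t <= u by apply: ge_inf; [exact: hS.2|split; rewrite ?au].
  have := hd u; rewrite au ub distrC ger0_norm ?subr_ge0// ltrBlDl => /(_ isT ut).
  by rewrite distrC => /ltr_normlW; rewrite ltrBlDl subrKC ltNge su.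
have ta : a < t by rewrite lt_neqAle at_ andbT; apply: contraTneq ft1 => <-; rewrite -ltNge.
exists t; split => //; first by rewrite ta.
apply/eqP; rewrite eq_le ft1 andbT leNgt; apply/negP => sft.
have e0 : 0 < f t - s by rewrite subr_gt0.
have [d d0 hd] := within_itv_dist cf tab e0.
pose u := Num.max a (t - d / 2).
have ut : u < t by rewrite gt_max ta ltrBlDr ltrDl divr_gt0.
have au : a <= u by rewrite le_max lexx.
have := lt_t u au ut; have := hd u; rewrite au (le_trans (ltW ut) tb).
rewrite ger0_norm ?subr_ge0 1?ltW// => /(_ isT) h.
have tud : t - u < d.
  rewrite ltrBlDl -ltrBlDr; apply: lt_le_trans (_ : t - d / 2 <= u).
    by rewrite ltrD2l ltrN2 ltr_pdivrMr// ltr_pMr// ltr1n.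
  by rewrite le_max lexx orbT.
have /ltr_normlW := h tud.
by rewrite ltrD2l ltrN2 => h1 /(lt_trans h1); rewrite ltxx.
Qed.

(** Time reversal of [first_hit]. *)
Lemma last_exit f a b s : a <= b -> {within `[a, b], continuous f} ->
  s <= f a -> f b < s ->
  exists t, [/\ a <= t < b, f t = s & forall u, t < u -> u <= b -> f u < s].
Proof.
move=> ab cf fa fb.
have cg : {within `[- b, - a], continuous (f \o -%R)}.
  apply/subspace_continuousP => t; rewrite /= in_itv/= => tab.
  have tab' : a <= - t <= b by rewrite lerNr (lerNl t) andbC.
  move=> A /= fA; have nfA : nbhs (f (- t)) A by [].
  have /nbhs_ballP[e /= e0 eA] := nfA.
  have [d d0 hd] := within_itv_dist cf tab' e0.
  apply/nbhs_ballP; exists d => //= u; rewrite -ball_normE/= => tu.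
  rewrite in_itv/= => uab; apply: eA; rewrite -ball_normE/=; apply: hd.
    by rewrite lerNr (lerNl u) andbC.
  by rewrite -opprD normrN.
have nab : - b <= - a by rewrite lerN2.
have g1 : (f \o -%R) (- b) < s by rewrite /= opprK.
have g2 : s <= (f \o -%R) (- a) by rewrite /= opprK.
have [t [/andP[bt ta] ft ht]] := first_hit nab cg g1 g2.
exists (- t); split => //; first by rewrite lerNr ta ltrNl.
by move=> u tu ub; have := ht (- u); rewrite /= opprK lerN2 ltrNl; exact.
Qed.

End Hitting.

Section Crossing.
Context {R : realType} {X : riemann_surface R}.
Implicit Types (rho : density X) (d : disc X) (gamma : R -> X) (a b B : R).

(** [gauge d] is 1-Lipschitz for the sup norm of the chart, hence for the modulus, which varies at
    rate [stretch]; the term [B * stretch] of the competitor pays for it. *)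
Lemma competitor_dominates rho d a b B p : measurable_density rho ->
  b < dradius d -> 0 <= B -> gauge d p <= b ->
  dominates (competitor rho d a b B) (fun q => B * gauge d q) p.
Proof.
move=> mrho bd B0 pb phi aphi Dp e e0.
have [Dd gp] := gauge_lt (le_lt_trans pb bd).
rewrite competitorE// pb.
have B1 : 0 < B + 1 by rewrite ltr_wpDl.
have h1 := transition_local aphi (dchart_atlas d) Dp Dd (divr_gt0 e0 B1).
have h2 := near_chart_dom (dchart_atlas d) Dd.
have t0 : 0 <= (if gauge d p < a then 0 else rho phi (phi p)).
  by case: ifP => // _; apply: (mdensity_ge0 mrho aphi).
apply: filterS2 h1 h2 => q h Dq.
have gq : `|gauge d q - gauge d p| <= cnorm (dchart d q - dchart d p).
  apply: le_trans (le_ofC_cnorm _); rewrite ofCB -!plane_coordE.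
  have lip : `|gauge d q - gauge d p| <=
     `| `|dcenter d - plane_coord (dchart d) q| - `|dcenter d - plane_coord (dchart d) p| |.
    have pl : `|dcenter d - plane_coord (dchart d) p| <= dradius d.
      by rewrite -gp (le_trans pb)// ltW.
    have minlip (x y r : R) : y <= r -> `|Num.min x r - y| <= `|x - y|.
      move=> yr; case: (leP x r) => // rx; have yr0 : 0 <= r - y by rewrite subr_ge0.
      by rewrite (ger0_norm yr0); apply: le_trans (ler_norm _); lra.
    by rewrite gp /gauge mem_set//; exact: minlip.
  apply: le_trans lip _; apply: le_trans (ler_dist_dist _ _) _.
  have e3 (x y z : R * R) : x - y - (x - z) = - (y - z).
    by rewrite !opprB addrC addrA subrK.
  by rewrite e3 normrN.
rewrite -mulrBr normrM (ger0_norm B0).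
have := stretch_ge0 phi (dchart d) p.
move: h gq t0 (cnorm_ge0 (phi q - phi p)).
move: (cnorm (dchart d q - dchart d p)) (cnorm (phi q - phi p)) (stretch _ _ _) (`|gauge d q - gauge d p|) (if _ then _ else _).
move=> y x k z t; rewrite ler_norml => /andP[_ h] zy t0 x0 k0.
have e1 : B * (e / (B + 1)) <= e.
  by rewrite mulrA ler_pdivrMr// mulrC ler_wpM2l// ?lerDl// ltW.
have s1 : B * z <= B * y by rewrite ler_wpM2l.
have s2 : B * (y - k * x) <= B * (e / (B + 1) * x) by rewrite ler_wpM2l.
have s3 : B * (e / (B + 1)) * x <= e * x by rewrite ler_wpM2r.
have s4 : 0 <= t * x by rewrite mulr_ge0.
by nra.
Qed.

Lemma within_gauge_continuous d gamma (A : set R) :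
  {within A, continuous gamma} -> {within A, continuous (gauge d \o gamma)}.
Proof.
move=> cg; apply/subspace_continuousP => t At.
exact: (cvg_comp _ _ (iffLR (subspace_continuousP _ _) cg t At) (@gauge_continuous _ _ d _)).
Qed.

(** From [t0] to the first time at level [b] met in the direction of [t1], the curve stays where the
    flat metric lives, and [B * gauge d] varies by at least [B * (b - r)]. *)
Lemma competitor_crossing rho d a b B gamma u v l t0 t1 r : measurable_density rho ->
  b < dradius d -> 0 <= B -> {within `[u, v], continuous gamma} ->
  line_integral (competitor rho d a b B) gamma u v l ->
  u <= t0 <= v -> u <= t1 <= v -> gauge d (gamma t0) <= r -> r < b ->
  b <= gauge d (gamma t1) -> ((B * (b - r))%:E <= l)%E.
Proof.
move=> mrho bd B0 cg li /andP[ut0 t0v] /andP[ut1 t1v] g0 rb g1.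
have mc := @competitor_measurable_density _ _ rho d a b B mrho bd B0.
have cgg u' v' : u <= u' -> v' <= v -> {within `[u', v'], continuous (gauge d \o gamma)}.
  move=> uu vv; apply: within_gauge_continuous; apply: continuous_subspaceW cg => t /=.
  rewrite !in_itv/= => /andP[h1 h2].
  by rewrite (le_trans uu h1) (le_trans h2 vv).
have key x y : u <= x -> x <= y -> y <= v -> (forall t, x <= t <= y -> gauge d (gamma t) <= b) ->
    ((`|B * gauge d (gamma y) - B * gauge d (gamma x)|)%:E <= l)%E.
  move=> ux xy yv hb; have [l' ll' li'] := line_integral_sub mc li ux xy yv.
  apply: le_trans ll'.
  apply: (line_integral_ge_variation (g := fun q => B * gauge d q) mc _ _ li').
    apply: continuous_subspaceW cg => t /=; rewrite !in_itv/= => /andP[h1 h2].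
    by rewrite (le_trans ux h1) (le_trans h2 yv).
  by move=> t /hb; exact: competitor_dominates.
have fin x y : gauge d (gamma x) <= r -> gauge d (gamma y) = b ->
   B * (b - r) <= `|B * gauge d (gamma y) - B * gauge d (gamma x)|.
  move=> gx gy; apply: le_trans (ler_norm _); rewrite gy -mulrBr ler_wpM2l//.
  by rewrite lerD2l lerN2.
have [t01|t10] := leP t0 t1.
  have [t [/andP[t0t tt1] gt lt]] := first_hit t01 (cgg _ _ ut0 t1v) (le_lt_trans g0 rb) g1.
  apply: le_trans (key t0 t ut0 (ltW t0t) (le_trans tt1 t1v) _); first by rewrite lee_fin fin.
  move=> x /andP[t0x]; rewrite le_eqVlt => /predU1P[->|xt]; first by rewrite -gt.
  exact: ltW (lt _ t0x xt).
have [t [/andP[t1t tt0] gt lt]] := last_exit (ltW t10) (cgg _ _ ut1 t0v) g1 (le_lt_trans g0 rb).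
apply: le_trans (key t t0 (le_trans ut1 t1t) (ltW tt0) t0v _).
  by rewrite lee_fin distrC fin.
move=> x /andP[+ xt0]; rewrite le_eqVlt => /predU1P[<-|tx]; first by rewrite -gt.
exact: ltW (lt _ tx xt0).
Qed.

End Crossing.

(** * Rerouting closed curves *)

Lemma continuous_fst_plane (R : realType) (z : R * R) :
  (fun w : R * R => w.1) @ nbhs z --> z.1.
Proof. exact: cvg_fst. Qed.

Lemma continuous_snd_plane (R : realType) (z : R * R) :
  (fun w : R * R => w.2) @ nbhs z --> z.2.
Proof. exact: cvg_snd. Qed.

Lemma closed_rectangle (R : realType) (A B : set R) :
  closed A -> closed B -> closed (A `*` B).
Proof.
move=> cA cB.
rewrite (_ : A `*` B = (fun w => w.1) @^-1` A `&` (fun w => w.2) @^-1` B)//.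
by apply: closedI; apply: preimage_closed => // z _;
  [exact: continuous_fst_plane|exact: continuous_snd_plane].
Qed.

Lemma eq_within_continuous (T U : topologicalType) (A : set T) (f g : T -> U) :
  (forall x, A x -> f x = g x) ->
  {within A, continuous f} -> {within A, continuous g}.
Proof.
move=> e; apply: (@subspace_eq_continuous _ A U f g) => x /set_mem Ax; exact: e.
Qed.

Section Homotopy.
Context {R : realType} {X : riemann_surface R}.
Implicit Types (d : disc X) (gamma : R -> X) (s t : R).

Let I01 := (`[0, 1]%classic : set R).

Lemma freely_homotopic_trans gamma gamma' gamma'' : freely_homotopic gamma gamma' ->
  freely_homotopic gamma' gamma'' -> freely_homotopic gamma gamma''.
Proof.
move=> [H [cH H0 H1 Hs]] [K [cK K0 K1 Ks]].
pose h (z : R * R) := if z.1 <= 2^-1 then H (2 * z.1, z.2) else K (2 * z.1 - 1, z.2).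
pose A := (`[0, 2^-1]%classic : set R) `*` I01.
pose B := (`[2^-1, 1]%classic : set R) `*` I01.
have AB : I01 `*` I01 = A `|` B.
  apply/seteqP; split => z /=; rewrite /A /B /I01/= !in_itv/=.
    move=> [/andP[h1 h2] ->]; case: (leP z.1 2^-1) => hz; [left|right]; rewrite ?h1 ?h2//=.
    by rewrite ltW.
  by move=> [[/andP[h1 h2] ->]|[/andP[h1 h2] ->]]; split => //; apply/andP; split => //; lra.
have affine (k e : R) (S : set (R * R)) (L : R * R -> X) :
    {within I01 `*` I01, continuous L} ->
    (forall z, S z -> I01 (k * z.1 + e) /\ I01 z.2) ->
    {within S, continuous (fun z => L (k * z.1 + e, z.2))}.
  move=> cL hS; apply/subspace_continuousP => z Sz.
  have cs : (fun z : R * R => (k * z.1 + e, z.2)) @ within S (nbhs z) -->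
      within (I01 `*` I01) (nbhs (k * z.1 + e, z.2)).
    move=> C /= hC.
    have cf : (fun z : R * R => (k * z.1 + e, z.2)) @ z --> (k * z.1 + e, z.2).
      apply: (@cvg_pair _ _ _ (nbhs z) (nbhs (k * z.1 + e)) (nbhs z.2)); last exact: continuous_snd_plane.
      have cm := @cvgM R (R * R)%type (nbhs z) _ (fun=> k) (fun w => w.1) k z.1
        (cvg_cst _) (@continuous_fst_plane _ z).
      exact: (@cvgD R R (R * R)%type (nbhs z) _ (fun w => k * w.1) (fun=> e) (k * z.1) e (cm _ _) (cvg_cst _)).
    by apply: (@filterS _ (nbhs z) _ _ _ _ (cf _ hC)) => w hw Sw; apply: hw; split; case: (hS _ Sw).
  have z' : (I01 `*` I01) (k * z.1 + e, z.2) by exact: hS.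
  exact: (cvg_comp _ _ cs (iffLR (subspace_continuousP _ _) cL _ z')).
have half : 2 * 2^-1 = 1 :> R by rewrite divff.
exists h; split.
- rewrite AB; apply: withinU_continuous.
  + by apply: closed_rectangle; exact: interval_closed.
  + by apply: closed_rectangle; exact: interval_closed.
  + apply: (@eq_within_continuous (R * R)%type X _ (fun z => H (2 * z.1 + 0, z.2))).
      move=> z [/= + _]; rewrite in_itv/= => /andP[_ z1].
      by rewrite /h z1 addr0.
    apply: affine => // z [/=]; rewrite /I01/= !in_itv/= => /andP[h1 h2] ->; split => //.
    by apply/andP; split; lra.
  + apply: (@eq_within_continuous (R * R)%type X _ (fun z => K (2 * z.1 + -1, z.2))).
      move=> z [/= + z2]; rewrite in_itv/= => /andP[z1 _].
      rewrite /h; case: (leP z.1 2^-1) => // z1'.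
      have -> : z.1 = 2^-1 by apply/eqP; rewrite eq_le z1 z1'.
      by rewrite half subrr H1 ?K0//; move: z2; rewrite /I01/= in_itv.
    apply: affine => // z [/=]; rewrite /I01/= !in_itv/= => /andP[h1 h2] ->; split => //.
    by apply/andP; split; lra.
- by move=> t t01; rewrite /h/= invr_ge0 ler0n mulr0 H0.
- move=> t t01; rewrite /h/= leNgt invf_lt1// ltr1n/= mulr1.
  by rewrite (_ : 2 - 1 = 1 :> R) ?K1//; ring.
- move=> s /andP[s0 s1]; rewrite /h/=; case: (leP s 2^-1) => hs.
    by apply: Hs; apply/andP; split; lra.
  by apply: Ks; apply/andP; split; lra.
Qed.

(* Straight-line homotopy in the coordinate square. *)
Lemma local_homotopy d s gamma gamma' : s < dradius d ->
  closed_curve gamma -> closed_curve gamma' ->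
  (forall t, 0 <= t <= 1 -> gamma t = gamma' t \/
     (gauge d (gamma t) <= s /\ gauge d (gamma' t) <= s)) ->
  freely_homotopic gamma gamma'.
Proof.
move=> sd [cg g01] [cg' g01'] hyp; set psi := dchart d.
pose in_sq x y := (gauge d x <= s) && (gauge d y <= s).
pose lin (u : R) (x y : X) : R * R := plane_coord psi x + u *: (plane_coord psi y - plane_coord psi x).
pose h (u : R) (x y : X) : X := if in_sq x y then coord_inv psi (lin u x y) else x.
have cgg := @within_gauge_continuous _ _ d _ _ cg; have cgg' := @within_gauge_continuous _ _ d _ _ cg'.
(* Two closed sets cover the parameter interval: on [TA] both points lie in the square, on [TB] the
   curves agree. On [TB] the straight-line formula is constant in the homotopy parameter, so the two
   definitions paste. *)
pose TA := I01 `&` [set t | gauge d (gamma t) <= s] `&` [set t | gauge d (gamma' t) <= s].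
pose TB := I01 `&` [set t | gamma t = gamma' t].
have cI : closed I01 by exact: interval_closed.
have closed_le (f : R -> R) : {within I01, continuous f} ->
    closed (I01 `&` [set t | f t <= s]).
  move=> /continuous_closedP /(_ _ (@num_normedtype.closed_le R s)).
  by move=> /(closed_subspaceP _ _)[V cV VE]; rewrite setIC -VE; apply: closedI.
have cTA : closed TA.
  rewrite /TA (_ : _ `&` _ = (I01 `&` [set t | gauge d (gamma t) <= s]) `&`
     (I01 `&` [set t | gauge d (gamma' t) <= s])).
    by apply: closedI; exact: closed_le.
  by apply/seteqP; split => t; [move=> [[]]|move=> [[? ?] []]].
have cTB : closed TB.
  move=> t ct; have It : I01 t.
    by apply: (cI t) => N nN; have [x [[Ix _] Nx]] := ct N nN; exists x.
  split => //=; apply: (@surface_hausdorff _ X) => U V nU nV.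
  have n1 : within I01 (nbhs t) (gamma @^-1` U).
    exact: (iffLR (subspace_continuousP _ _) cg t It U nU).
  have n2 : within I01 (nbhs t) (gamma' @^-1` V).
    exact: (iffLR (subspace_continuousP _ _) cg' t It V nV).
  have [x [[Ix gx] /(_ Ix)[Ux Vx]]] := ct _ (filterI n1 n2).
  by exists (gamma x); split; [exact: Ux|rewrite gx; exact: Vx].
have TAB : I01 `*` I01 = (I01 `*` TA) `|` (I01 `*` TB).
  apply/seteqP; split => z; last by move=> [[z1 [[z2 _] _]]|[z1 [z2 _]]].
  move=> [z1 z2]; have [|e|[h1 h2]] := hyp z.2; first by move: z2; rewrite /I01/= in_itv.
    by right; split.
  by left; split.
have snd_cvg (T : set R) (z : R * R) (f : R -> X) : T `<=` I01 -> T z.2 -> {within I01, continuous f} ->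
    (fun w : R * R => f w.2) @ within (I01 `*` T) (nbhs z) --> f z.2.
  move=> TI Tz cf; have Iz := TI _ Tz.
  have cs : (fun w : R * R => w.2) @ within (I01 `*` T) (nbhs z) --> within I01 (nbhs z.2).
    move=> C hC.
    have nC : nbhs z (fun w : R * R => I01 w.2 -> C w.2).
      exact: (@continuous_snd_plane _ z (fun x => I01 x -> C x) hC).
    by apply: (@filterS _ (nbhs z) _ _ _ _ nC) => w hw [_ /TI Iw]; exact: hw.
  exact: (cvg_comp _ _ cs (iffLR (subspace_continuousP _ _) cf _ Iz)).
have TAI : TA `<=` I01 by move=> t [[]].
have TBI : TB `<=` I01 by move=> t [].
exists (fun z => h z.1 (gamma z.2) (gamma' z.2)); split.
- rewrite TAB; apply: withinU_continuous.
  + exact: closed_rectangle.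
  + exact: closed_rectangle.
  + apply: (@eq_within_continuous (R * R)%type X _ (fun z => coord_inv psi (lin z.1 (gamma z.2) (gamma' z.2)))).
      by move=> z [_ [[_ /= h1] h2]]; rewrite /h /in_sq h1 h2.
    apply/subspace_continuousP => z [z1 z2].
    have [[_ /= h1] /= h2] := z2.
    have [D1 e1] := gauge_lt (le_lt_trans h1 sd).
    have [D2 e2] := gauge_lt (le_lt_trans h2 sd).
    have c1 : (fun z : R * R => plane_coord psi (gamma z.2)) @ within (I01 `*` TA) (nbhs z) -->
        plane_coord psi (gamma z.2).
      exact: (cvg_comp _ _ (snd_cvg _ _ _ TAI z2 cg) (plane_coord_continuous (dchart_atlas d) D1)).
    have c2 : (fun z : R * R => plane_coord psi (gamma' z.2)) @ within (I01 `*` TA) (nbhs z) -->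
        plane_coord psi (gamma' z.2).
      exact: (cvg_comp _ _ (snd_cvg _ _ _ TAI z2 cg') (plane_coord_continuous (dchart_atlas d) D2)).
    have cl : (fun z : R * R => lin z.1 (gamma z.2) (gamma' z.2)) @ within (I01 `*` TA) (nbhs z) -->
        lin z.1 (gamma z.2) (gamma' z.2).
      apply: cvgD; first exact: c1.
      apply: cvgZ; last by apply: cvgB; [exact: c2|exact: c1].
      by apply: cvg_within_filter; exact: continuous_fst_plane.
    apply: (cvg_comp _ _ cl); apply: (coord_inv_continuous (dchart_atlas d)).
    apply: dsub; rewrite /lin -/psi.
    move: z1; rewrite /I01/= in_itv/= => /andP[u0 u1].
    rewrite e1 in h1; rewrite e2 in h2.
    have -> : dcenter d - (plane_coord psi (gamma z.2) +
        z.1 *: (plane_coord psi (gamma' z.2) - plane_coord psi (gamma z.2))) =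
      (1 - z.1) *: (dcenter d - plane_coord psi (gamma z.2)) +
      z.1 *: (dcenter d - plane_coord psi (gamma' z.2)).
      rewrite scalerBl scale1r -addrA [- _ + _]addrC -scalerBr opprB.
      by rewrite [_ - _ + (_ - _)]addrC addrA subrK opprD addrA -scalerN opprB.
    apply: le_trans (ler_normD _ _) _; rewrite !normrZ (ger0_norm u0) ger0_norm ?subr_ge0//.
    apply: (@le_trans _ _ ((1 - z.1) * s + z.1 * s)); last by rewrite -mulrDl subrK mul1r ltW.
    by apply: lerD; apply: ler_wpM2l; rewrite ?subr_ge0.
  + apply: (@eq_within_continuous (R * R)%type X _ (fun w : R * R => gamma w.2)).
      move=> z [_ [_ /= e]]; rewrite /h -e; case: ifP => // /andP[h1 _].
      rewrite /lin subrr scaler0 addr0 coord_invK//; first exact: dchart_atlas.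
      by case: (gauge_lt (le_lt_trans h1 sd)).
    by apply/subspace_continuousP => z [z1 z2]; exact: snd_cvg.
- move=> t t01; rewrite /h; case: ifP => // /andP[h1 _].
  rewrite /lin scale0r addr0 coord_invK//; first exact: dchart_atlas.
  by case: (gauge_lt (le_lt_trans h1 sd)).
- move=> t t01; rewrite /h /in_sq; have [->|[h1 h2]] := hyp t t01.
    case: ifP => // /andP[h1 _].
    rewrite /lin subrr scaler0 addr0 coord_invK//; first exact: dchart_atlas.
    by case: (gauge_lt (le_lt_trans h1 sd)).
  rewrite h1 h2/= /lin scale1r addrC subrK coord_invK//; first exact: dchart_atlas.
  by case: (gauge_lt (le_lt_trans h2 sd)).
- by move=> u _; rewrite g01 g01'.
Qed.

(** Inside a coordinate square the curve would contract along straight lines to the point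
    [gamma' 0]. *)
Lemma nontrivial_leaves_square d s gamma gamma' : s < dradius d ->
  homotopically_nontrivial gamma -> freely_homotopic gamma gamma' ->
  closed_curve gamma' -> exists2 t, 0 <= t <= 1 & s < gauge d (gamma' t).
Proof.
move=> sd nt gg cg; apply: contrapT => h.
have in_sq t : 0 <= t <= 1 -> gauge d (gamma' t) <= s.
  by move=> t01; rewrite leNgt; apply/negP => st; apply: h; exists t.
apply: (nt (gamma' 0)); apply: (freely_homotopic_trans gg).
apply: (@local_homotopy d s) => //.
  by split => //; apply: continuous_subspaceT => t; exact: cvg_cst.
by move=> t t01; right; split; apply: in_sq; rewrite // lexx ler01.
Qed.

End Homotopy.

(** * Pasting curves and replacing excursions *)

Section Intervals.
Context {R : realType}.

(** Compactness of [[a, b]] in the form of Cousin's lemma; it stands in for a subdivision finer than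
    a Lebesgue number. *)
Lemma interval_induction (P : R -> R -> Prop) (a b : R) : a <= b ->
  (forall u v w, P u v -> P v w -> P u w) ->
  (forall t, a <= t <= b -> exists2 e, 0 < e &
     forall u v, a <= u -> u <= t -> t <= v -> v <= b -> t - e < u -> v < t + e ->
       P u v) ->
  P a b.
Proof.
move=> ab trP locP; pose S := [set t | a <= t <= b /\ P a t].
have Sa : S a.
  split; first by rewrite lexx.
  by have [|e e0] := locP a; [rewrite lexx|apply => //; lra].
have Sb : has_ubound S by exists b => t [/andP[]].
have hS : has_sup S by split; [exists a|].
have ca : a <= sup S by exact: ub_le_sup.
have cb : sup S <= b by apply: ge_sup; [exists a|move=> t [/andP[]]].
have [|e e0 he] := locP (sup S); first by rewrite ca.
have [t [/andP[at_ tb] Pt] te] := sup_adherent e0 hS.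
have tc : t <= sup S by apply: ub_le_sup => //; split => //; rewrite at_.
have [cb'|cb'] := leP b (sup S + e / 2).
  by apply: (trP _ _ _ Pt); apply: he => //; lra.
have : S (sup S + e / 2).
  split; first by apply/andP; split; lra.
  by apply: (trP _ _ _ Pt); apply: he => //; lra.
by move=> /(ub_le_sup Sb); lra.
Qed.

Context {X : topologicalType}.
Implicit Types f g : R -> X.

Definition glue (b : R) f g : R -> X := fun t => if t <= b then f t else g t.

Lemma continuous_glue (a b c : R) f g : a <= b -> b <= c -> f b = g b ->
  {within `[a, b], continuous f} -> {within `[b, c], continuous g} ->
  {within `[a, c], continuous (glue b f g)}.
Proof.
move=> ab bc fg cf cg.
have -> : `[a, c]%classic = `[a, b]%classic `|` `[b, c]%classic.
  apply/seteqP; split => t /=; rewrite !in_itv/=.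
    by move=> /andP[-> ->]; case: (leP t b) => h; [left|right]; rewrite ?ltW.
  by move=> [/andP[h1 h2]|/andP[h1 h2]]; apply/andP; split => //;
     [exact: le_trans bc|exact: le_trans h1].
apply: withinU_continuous; [exact: interval_closed|exact: interval_closed| |].
  apply: (@eq_within_continuous _ _ _ f) cf => t /=; rewrite in_itv/= /glue.
  by move=> /andP[_ ->].
apply: (@eq_within_continuous _ _ _ g) cg => t /=; rewrite in_itv/= /glue.
move=> /andP[bt _]; case: ifP => // tb.
by have -> : t = b by apply/eqP; rewrite eq_le tb.
Qed.

Lemma continuous_sub_itv (a b a' b' : R) f : a <= a' -> b' <= b ->
  {within `[a, b], continuous f} -> {within `[a', b'], continuous f}.
Proof.
move=> aa bb; apply: continuous_subspaceW => t /=; rewrite !in_itv/= => /andP[h1 h2].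
by rewrite (le_trans aa h1) (le_trans h2 bb).
Qed.

End Intervals.

Section Excursions.
Context {R : realType} {X : riemann_surface R}.
Implicit Types (rho : density X) (d : disc X) (gamma : R -> X).

Definition length_le rho gamma (a b L : R) :=
  exists2 l, line_integral rho gamma a b l & (l <= L%:E)%E.

Lemma length_le_cat rho gamma a b c L L' : length_le rho gamma a b L ->
  length_le rho gamma b c L' -> length_le rho gamma a c (L + L').
Proof.
move=> [l h hL] [l' h' hL']; exists (l + l')%E; first exact: line_integral_cat h h'.
by rewrite EFinD; exact: leeD.
Qed.

Lemma eq_length_le rho gamma gamma' a b L : length_le rho gamma a b L ->
  (forall t, a <= t <= b -> gamma t = gamma' t) -> length_le rho gamma' a b L.
Proof. by move=> [l h hL] e; exists l => //; exact: eq_line_integral h e. Qed.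

Lemma length_le_sub rho gamma a b a' b' L : measurable_density rho ->
  length_le rho gamma a b L -> a <= a' -> a' <= b' -> b' <= b ->
  length_le rho gamma a' b' L.
Proof.
move=> mrho [l h hL] aa ab bb; have [l' hl h'] := line_integral_sub mrho h aa ab bb.
by exists l' => //; exact: le_trans hL.
Qed.

(* The interval is arbitrary because lengths are only defined for curves, and
   curves are reparametrized by choosing another one. *)
Definition joins rho (Z : set X) (x y : X) (L : R) := forall a b : R, a < b ->
  exists gamma, [/\ {within `[a, b], continuous gamma}, gamma a = x, gamma b = y,
    forall t, a <= t <= b -> Z (gamma t) & length_le rho gamma a b L].

Lemma joins_trans rho Z x y z L L' : joins rho Z x y L -> joins rho Z y z L' ->
  joins rho Z x z (L + L').
Proof.
move=> h h' a b ab; pose m := (a + b) / 2.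
have [am mb] : a < m /\ m < b by rewrite /m; split; lra.
have [f [cf fa fm Zf Lf]] := h a m am; have [g [cg gm gb Zg Lg]] := h' m b mb.
exists (glue m f g); split.
- by apply: continuous_glue; rewrite ?(ltW am) ?(ltW mb) ?fm.
- by rewrite /glue (ltW am).
- by rewrite /glue leNgt mb.
- move=> t /andP[at_ tb]; rewrite /glue; case: (leP t m) => tm.
    by apply: Zf; rewrite at_.
  by apply: Zg; rewrite (ltW tm).
- apply: (@length_le_cat _ _ _ m).
    by apply: (eq_length_le Lf) => t /andP[_ tm]; rewrite /glue tm.
  apply: (eq_length_le Lg) => t /andP[mt _]; rewrite /glue; case: ifP => // tm.
  by rewrite (_ : t = m) ?gm ?fm//; apply/eqP; rewrite eq_le tm.
Qed.

Lemma joins_weaken rho (Z Z' : set X) x y (L L' : R) : Z `<=` Z' -> L <= L' ->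
  joins rho Z x y L -> joins rho Z' x y L'.
Proof.
move=> ZZ LL h a b /h[f [cf fa fb Zf [l hl lL]]]; exists f; split => //.
  by move=> t /Zf/ZZ.
by exists l => //; apply: (le_trans lL); rewrite lee_fin.
Qed.

(* gamma' is obtained from gamma by rerouting along the square {gauge d = s} an
   excursion that enters {gauge d < r}; the second case is that of an excursion
   through the base point. *)
Inductive excursion rho d (r s beta : R) gamma gamma' : Prop :=
| excursion_inside (u t0 v : R) : 0 <= u -> u < t0 -> t0 < v -> v <= 1 ->
    gauge d (gamma t0) < r -> gauge d (gamma u) = s -> gauge d (gamma v) = s ->
    (forall t, 0 <= t <= u -> gamma' t = gamma t) ->
    (forall t, v <= t <= 1 -> gamma' t = gamma t) ->
    length_le rho gamma' u v beta ->
    excursion rho d r s beta gamma gamma'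
| excursion_ends (u t0 v : R) : 0 < u -> u <= v -> v < 1 ->
    0 <= t0 < u \/ v < t0 <= 1 ->
    gauge d (gamma t0) < r -> gauge d (gamma u) = s -> gauge d (gamma v) = s ->
    (forall t, u <= t <= v -> gamma' t = gamma t) ->
    length_le rho gamma' 0 u beta -> length_le rho gamma' v 1 beta ->
    excursion rho d r s beta gamma gamma'.

(* Last clause: an interval on which gamma stays in the open square is either left
   alone or rerouted as a whole. *)
Lemma excursion_exists rho d r s beta gamma t0 :
  closed_curve gamma -> 0 <= t0 <= 1 -> gauge d (gamma t0) < r -> r < s ->
  (exists2 t1, 0 <= t1 <= 1 & s <= gauge d (gamma t1)) ->
  (forall x y, gauge d x = s -> gauge d y = s ->
     joins rho [set z | gauge d z = s] x y beta) ->
  exists gamma', [/\ excursion rho d r s beta gamma gamma', closed_curve gamma',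
    gauge d (gamma' t0) = s,
    forall t, 0 <= t <= 1 -> gamma t = gamma' t \/
      (gauge d (gamma t) <= s /\ gauge d (gamma' t) = s)
  & forall p q, 0 <= p -> q <= 1 ->
      (forall t, p <= t <= q -> gauge d (gamma t) < s) ->
      (forall t, p <= t <= q -> gamma' t = gamma t) \/
      (forall t, p <= t <= q -> gauge d (gamma' t) = s)].
Proof.
move=> [cg g01] /andP[t00 t01] gt0r rs hit bj; have gt0 := lt_trans gt0r rs.
have [t1 /andP[t10 t11] gt1] := hit.
have cf := @within_gauge_continuous _ _ d _ _ cg.
(* Either the curve reaches level [s] on both sides of [t0], or the excursion around [t0] contains
   the base point. *)
have [inside|ends] := pselect ((exists2 a, 0 <= a <= t0 & s <= gauge d (gamma a)) /\
  (exists2 b, t0 <= b <= 1 & s <= gauge d (gamma b))).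
- case: inside => [[a /andP[a0 at0] ga] [b /andP[tb b1] gb]].
  have [u [/andP[au ut] gu hu]] := @last_exit _ _ a t0 s at0
    (continuous_sub_itv a0 t01 cf) ga gt0.
  have [v [/andP[tv vb] gv hv]] := @first_hit _ _ t0 b s tb
    (continuous_sub_itv t00 b1 cf) gt0 gb.
  rewrite /= in gu gv hu hv; have u0 := le_trans a0 au; have v1 := le_trans vb b1; have uv := lt_trans ut tv.
  have inner t : u < t -> t < v -> gauge d (gamma t) < s.
    by move=> h1 h2; have [h|/ltW h] := leP t t0; [exact: hu|exact: hv].
  have [f [cf' fu fv Zf Lf]] := bj _ _ gu gv u v uv.
  pose h := glue u gamma (glue v f gamma).
  have hl t : t <= u -> h t = gamma t by rewrite /h /glue => ->.
  have hr t : v <= t -> h t = gamma t.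
    move=> vt; rewrite /h /glue leNgt (lt_le_trans uv vt)/=; case: ifP => // tv'.
    by have -> : t = v by apply/eqP; rewrite eq_le tv'.
  have hm t : u <= t <= v -> h t = f t.
    move=> /andP[ut' tv']; rewrite /h /glue tv'; case: ifP => // tu'.
    by have -> : t = u by apply/eqP; rewrite eq_le tu'.
  have hb t : u <= t <= v -> gauge d (h t) = s.
    by move=> h1; rewrite hm// Zf.
  have le_s t : u <= t -> t <= v -> gauge d (gamma t) <= s.
    rewrite le_eqVlt => /orP[/eqP<- _|ut']; first by rewrite gu.
    by rewrite le_eqVlt => /orP[/eqP->|tv']; [rewrite gv|apply/ltW/inner].
  exists h; split.
  + apply: (@excursion_inside _ _ _ _ _ _ _ u t0 v) => //.
    * by move=> t /andP[_ /hl].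
    * by move=> t /andP[/hr].
    * by apply: (eq_length_le Lf) => t /hm.
  + split; last by rewrite hl// hr.
    apply: continuous_glue => //; first exact: (le_trans (ltW uv) v1).
    * by rewrite /glue (ltW uv).
    * by apply: continuous_sub_itv cg => //; exact: (le_trans (ltW uv) v1).
    * apply: continuous_glue => //; first exact: ltW.
      by apply: continuous_sub_itv cg => //; exact: (le_trans u0 (ltW uv)).
  + by apply: hb; rewrite !ltW.
  + move=> t _; have [/hl ->|/ltW ut'] := leP t u; first by left.
    have [/hr->|/ltW tv'] := leP v t; first by left.
    by right; rewrite hb ?le_s ?ut'.
  + move=> p q p0 q1 hpq; have [qp|pq] := ltP q p.
      by left=> t /andP[pt tq]; move: (le_trans pt tq); rewrite leNgt qp.
    have nu : ~ (p <= u <= q) by move=> /hpq; rewrite gu ltxx.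
    have nv : ~ (p <= v <= q) by move=> /hpq; rewrite gv ltxx.
    have [qu|uq] := ltP q u.
      by left=> t /andP[_ tq]; apply: hl; apply: le_trans tq _; exact: ltW.
    have [vp|pv] := ltP v p.
      by left=> t /andP[pt _]; apply: hr; apply: le_trans pt; exact: ltW.
    have up : u < p by rewrite ltNge; apply/negP => pu; apply: nu; rewrite pu.
    have qv : q < v by rewrite ltNge; apply/negP => vq; apply: nv; rewrite pv.
    right=> t /andP[pt tq]; apply: hb; rewrite (le_trans (ltW up) pt)/=.
    by rewrite (le_trans tq (ltW qv)).
- have out : (forall a, 0 <= a <= t0 -> gauge d (gamma a) < s) \/
             (forall b, t0 <= b <= 1 -> gauge d (gamma b) < s).
    apply: contrapT => /not_orP[n1 n2]; apply: ends; split.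
      apply: contrapT => h; apply: n1 => a ha; rewrite ltNge; apply/negP => ga.
      by apply: h; exists a.
    apply: contrapT => h; apply: n2 => a ha; rewrite ltNge; apply/negP => ga.
    by apply: h; exists a.
  have g0 : gauge d (gamma 0) < s.
    by case: out => h; [|rewrite g01]; apply: h; rewrite ?t00 ?t01 ?lexx.
  have g1 : gauge d (gamma 1) < s by rewrite -g01.
  have [u [/andP[u0 ut1] gu hu]] := @first_hit _ _ 0 t1 s t10
    (continuous_sub_itv (lexx _) t11 cf) g0 gt1.
  have [v [/andP[tv v1] gv hv]] := @last_exit _ _ t1 1 s t11
    (continuous_sub_itv t10 (lexx _) cf) gt1 g1.
  rewrite /= in gu gv hu hv; have uv := le_trans ut1 tv.
  (* The base point moves to [gamma u]: a loop at [gamma u] on [[0, u]] and an arc from [gamma v] to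
     [gamma u] on [[v, 1]]. Hence two arcs of cost [beta] in this case. *)
  have [f [cf1 f0 fu Zf Lf]] := bj _ _ gu gu 0 u u0.
  have [f' [cf' fv f1 Zf' Lf']] := bj _ _ gv gu v 1 v1.
  pose h := glue u f (glue v gamma f').
  have hl t : t <= u -> h t = f t by rewrite /h /glue => ->.
  have hm t : u <= t <= v -> h t = gamma t.
    move=> /andP[ut' tv']; rewrite /h /glue tv'; case: ifP => // tu'.
    by have -> : t = u by apply/eqP; rewrite eq_le tu'.
  have hr t : v <= t -> h t = f' t.
    move=> vt; rewrite /h /glue; case: ifP => tu.
      have tv' : t = v by apply/eqP; rewrite eq_le vt (le_trans tu uv).
      have tu' : t = u by apply/eqP; rewrite eq_le tu tv' uv.
      by rewrite tv' fv -tv' tu' fu.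
    by case: ifP => // tv'; have -> : t = v by apply/eqP; rewrite eq_le tv'.
  have bl t : 0 <= t -> t <= u -> gauge d (h t) = s.
    by move=> h1 h2; rewrite hl//; apply: Zf; rewrite h1.
  have br t : v <= t -> t <= 1 -> gauge d (h t) = s.
    by move=> h1 h2; rewrite hr//; apply: Zf'; rewrite h1.
  have t0uv : 0 <= t0 < u \/ v < t0 <= 1.
    case: out => out.
      left; rewrite t00 ltNge; apply/negP => ut.
      by have := out u; rewrite (ltW u0) ut gu ltxx => /(_ isT).
    right; rewrite t01 ltNge andbT; apply/negP => vt.
    by have := out v; rewrite (ltW v1) vt gv ltxx => /(_ isT).
  have gsl t : 0 <= t -> t <= u -> gauge d (gamma t) <= s.
    by move=> h1; rewrite le_eqVlt => /orP[/eqP->|h2]; [rewrite gu|apply/ltW/hu].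
  have gsr t : v <= t -> t <= 1 -> gauge d (gamma t) <= s.
    by rewrite le_eqVlt => /orP[/eqP<-|h1]; [rewrite gv|move=> h2; apply/ltW/hv].
  exists h; split.
  + apply: (@excursion_ends _ _ _ _ _ _ _ u t0 v) => //.
    * by apply: (eq_length_le Lf) => t /andP[_ /hl].
    * by apply: (eq_length_le Lf') => t /andP[/hr].
  + split; last by rewrite hl ?ltW// hr ?ltW// f0 f1.
    have uv1 := le_trans uv (ltW v1).
    apply: continuous_glue => //; first exact: ltW.
    * by rewrite /glue uv.
    * apply: continuous_glue => //; first exact: ltW.
      by apply: continuous_sub_itv cg; exact: ltW.
  + by case: t0uv => /andP[h1 h2]; [apply: bl|apply: br] => //; exact: ltW.
  + move=> t /andP[h0 h1]; have [tu|/ltW ut] := leP t u; first by right; rewrite bl ?gsl.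
    have [vt|/ltW tv'] := leP v t; first by right; rewrite br ?gsr.
    by left; rewrite hm ?ut.
  + move=> p q p0 q1 hpq; have [qp|pq] := ltP q p.
      by left=> t /andP[pt tq]; move: (le_trans pt tq); rewrite leNgt qp.
    have nu : ~ (p <= u <= q) by move=> /hpq; rewrite gu ltxx.
    have nv : ~ (p <= v <= q) by move=> /hpq; rewrite gv ltxx.
    have [qu|uq] := ltP q u.
      right=> t /andP[pt tq]; apply: bl; first exact: le_trans pt.
      by apply: le_trans tq _; exact: ltW.
    have [vp|pv] := ltP v p.
      right=> t /andP[pt tq]; apply: br; last exact: le_trans q1.
      by apply: le_trans pt; exact: ltW.
    have up : u < p by rewrite ltNge; apply/negP => pu; apply: nu; rewrite pu.
    have qv : q < v by rewrite ltNge; apply/negP => vq; apply: nv; rewrite pv.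
    left=> t /andP[pt tq]; apply: hm; rewrite (le_trans (ltW up) pt)/=.
    by rewrite (le_trans tq (ltW qv)).
Qed.

(** Continuity covers [[0, 1]] by finitely many intervals on each of which [gamma] is either below
    level [s] or at level at least [r]. Each interval needs at most one rerouting, which spoils none
    of the others, so any [P] stable under rerouting survives. *)
Lemma clear_square rho d r s beta gamma0 gamma (P : (R -> X) -> Prop) :
  r < s -> s < dradius d ->
  (forall x y, gauge d x = s -> gauge d y = s ->
     joins rho [set z | gauge d z = s] x y beta) ->
  (forall f f', closed_curve f -> closed_curve f' ->
     (forall t, 0 <= t <= 1 -> f t = f' t \/ gauge d (f' t) = s) ->
     excursion rho d r s beta f f' -> P f -> P f') ->
  homotopically_nontrivial gamma0 -> freely_homotopic gamma0 gamma ->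
  closed_curve gamma -> P gamma ->
  exists gamma', [/\ closed_curve gamma', freely_homotopic gamma0 gamma', P gamma'
                   & forall t, 0 <= t <= 1 -> r <= gauge d (gamma' t)].
Proof.
move=> rs sd bj stepP nt hom clg Pg; have [cg g01] := clg.
have cf := @within_gauge_continuous _ _ d _ _ cg.
pose tame (f : R -> X) (I : R * R) :=
  (forall t, I.1 <= t <= I.2 -> gauge d (f t) < s) \/
  (forall t, I.1 <= t <= I.2 -> r <= gauge d (f t)).
have [S [S01 Sc St]] : exists S : seq (R * R),
    [/\ forall I, I \in S -> 0 <= I.1 /\ I.2 <= 1,
        forall t, 0 <= t <= 1 -> exists2 I, I \in S & I.1 <= t <= I.2
      & forall I, I \in S -> tame gamma I].
  pose Q (a b : R) := a <= b /\ exists S : seq (R * R),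
    [/\ forall I, I \in S -> a <= I.1 /\ I.2 <= b,
        forall t, a <= t <= b -> exists2 I, I \in S & I.1 <= t <= I.2
      & forall I, I \in S -> tame gamma I].
  suff : Q 0 1 by move=> [].
  apply: interval_induction => //.
    move=> u v w [uv [S [S1 S2 S3]]] [vw [S' [S1' S2' S3']]]; split.
      exact: le_trans vw.
    exists (S ++ S'); split.
    - move=> I; rewrite mem_cat => /orP[/S1[h1 h2]|/S1'[h1 h2]]; split => //.
        exact: le_trans vw.
      exact: le_trans h1.
    - move=> t /andP[ut tw]; have [tv|/ltW vt] := leP t v.
        have [|I IS It] := S2 t; first by rewrite ut.
        by exists I => //; rewrite mem_cat IS.
      have [|I IS It] := S2' t; first by rewrite vt.
      by exists I => //; rewrite mem_cat IS orbT.
    - by move=> I; rewrite mem_cat => /orP[/S3|/S3'].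
  move=> t t01; pose g0 := gauge d (gamma t).
  have [gs|gs] := ltP g0 s.
    have sg : 0 < s - g0 by rewrite subr_gt0.
    have [e e0 he] := within_itv_dist cf t01 sg.
    exists e => // u v u0 ut tv v1 eu ev; split; first exact: le_trans tv.
    exists [:: (u, v)]; split.
    - by move=> I; rewrite inE => /eqP->.
    - by move=> x h; exists (u, v); rewrite ?mem_head.
    - move=> I; rewrite inE => /eqP->; left => x /= /andP[ux xv].
      have : `|(gauge d \o gamma) t - (gauge d \o gamma) x| < s - g0.
        apply: he; first by rewrite (le_trans u0 ux) (le_trans xv v1).
        by rewrite ltr_distlC; apply/andP; split; lra.
      rewrite /= -/g0 ltr_distlC => /andP[_]; lra.
  have sr : 0 < s - r by rewrite subr_gt0.
  have [e e0 he] := within_itv_dist cf t01 sr.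
    exists e => // u v u0 ut tv v1 eu ev; split; first exact: le_trans tv.
    exists [:: (u, v)]; split.
    - by move=> I; rewrite inE => /eqP->.
    - by move=> x h; exists (u, v); rewrite ?mem_head.
    - move=> I; rewrite inE => /eqP->; right => x /= /andP[ux xv].
      have : `|(gauge d \o gamma) t - (gauge d \o gamma) x| < s - r.
        apply: he; first by rewrite (le_trans u0 ux) (le_trans xv v1).
        by rewrite ltr_distlC; apply/andP; split; lra.
      rewrite /= -/g0 ltr_distlC => /andP[+ _]; lra.
(* Invariant: on each interval the current curve is still [gamma], or already avoids [gauge d < r].
   The first alternative keeps the dichotomy [tame] available. *)
pose good (f : R -> X) (I : R * R) :=
  (forall t, I.1 <= t <= I.2 -> f t = gamma t) \/
  (forall t, I.1 <= t <= I.2 -> r <= gauge d (f t)).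
suff : forall S1 S2, S = S1 ++ S2 -> exists gamma', [/\ closed_curve gamma',
    freely_homotopic gamma0 gamma', P gamma', (forall I, I \in S -> good gamma' I)
  & forall I, I \in S1 -> forall t, I.1 <= t <= I.2 -> r <= gauge d (gamma' t)].
  move=> /(_ S [::]); rewrite cats0 => /(_ erefl)[f [cf' hf Pf _ h]].
  by exists f; split => // t /Sc[I /h]; exact.
move=> S1 S2; elim/last_ind: S1 S2 => [|S1 I IH] S2 eS.
  by exists gamma; split => // I _; left.
have [f [clf hf Pf gf rf]] := IH (I :: S2) (etrans eS (cat_rcons _ _ _)).
have IS : I \in S by rewrite eS mem_cat mem_rcons mem_head.
have [I0 I1] := S01 _ IS.
have [h|h] := pselect (forall t, I.1 <= t <= I.2 -> r <= gauge d (f t)).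
  exists f; split => // J; rewrite mem_rcons inE => /orP[/eqP->//|]; exact: rf.
have [t0 t0I gt0] : exists2 t0, I.1 <= t0 <= I.2 & gauge d (f t0) < r.
  apply: contrapT => h'; apply: h => t tI; rewrite leNgt; apply/negP => gt.
  by apply: h'; exists t.
have t001 : 0 <= t0 <= 1.
  by move: t0I => /andP[h1 h2]; rewrite (le_trans I0 h1) (le_trans h2 I1).
have [|f' [ex clf' gt0s eqf' Kf']] := @excursion_exists rho d r s beta f t0 clf t001 gt0 rs _ bj.
  have [t1 t101 /ltW st] := nontrivial_leaves_square sd nt hf clf.
  by exists t1.
have r_f' J t : J.1 <= t <= J.2 -> J \in S -> r <= gauge d (f t) -> r <= gauge d (f' t).
  move=> /andP[h1 h2] /S01[J0 J1] rt.
  have [|<-//|[_ ->]] := eqf' t; first by rewrite (le_trans J0 h1) (le_trans h2 J1).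
  exact: ltW.
exists f'; split => //.
- apply: (freely_homotopic_trans hf); apply: (local_homotopy sd) => // t t01.
  by have [->|[h1 ->]] := eqf' t t01; [left|right].
- apply: (stepP f f') => // t t01.
  by have [->|[_ ->]] := eqf' t t01; [left|right].
- move=> J JS; have [J0 J1] := S01 _ JS.
  have [fg|rJ] := gf _ JS; last by right=> t tJ; apply: (r_f' J) => //; exact: rJ.
  have [small|big] := St _ JS.
    have [|same|bd] := Kf' _ _ J0 J1; first by move=> t tJ; rewrite fg// small.
      by left=> t tJ; rewrite same// fg.
    by right=> t tJ; rewrite bd// ltW.
  by right=> t tJ; apply: (r_f' J) => //; rewrite fg// big.
- move=> J; rewrite mem_rcons inE => /orP[/eqP->|JS1] t tJ; last first.
    apply: (r_f' J) => //; first by rewrite eS mem_cat mem_rcons inE JS1 orbT.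
    exact: (rf _ JS1).
  have [fg|rI] := gf _ IS; last by apply: (r_f' I) => //; exact: rI.
  have [small|big] := St _ IS; last by apply: (r_f' I) => //; rewrite fg// big.
  (* The interval [I] cannot have been left alone, since the new curve has level [s] at [t0]. *)
  have [|same|bd] := Kf' _ _ I0 I1; first by move=> x xI; rewrite fg// small.
    by move: gt0s; rewrite same// => e; move: gt0; rewrite e => /(lt_trans rs); rewrite ltxx.
  by rewrite bd// ltW.
Qed.

End Excursions.

Section Competitors.
Context {R : realType} {X : riemann_surface R}.
Implicit Types (rho : density X) (d : disc X) (gamma : R -> X).

Lemma freely_homotopic_refl gamma : closed_curve gamma -> freely_homotopic gamma gamma.
Proof.
move=> [cg g01]; exists (fun z => gamma z.2); split => //.
apply/subspace_continuousP => z [z1 z2].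
have cs : (fun w : R * R => w.2) @ within (`[0, 1]%classic `*` `[0, 1]%classic) (nbhs z) -->
    within `[0, 1]%classic (nbhs z.2).
  move=> C hC.
  have nC : nbhs z (fun w : R * R => (`[0, 1]%classic : set R) w.2 -> C w.2).
    exact: (@continuous_snd_plane _ z (fun x => (`[0, 1]%classic : set R) x -> C x) hC).
  by apply: (@filterS _ (nbhs z) _ _ _ _ nC) => w hw [_ Iw]; exact: hw.
exact: (cvg_comp _ _ cs (iffLR (subspace_continuousP _ _) cg _ z2)).
Qed.

Lemma le_curve_length rho gamma (m : \bar R) :
  (forall gamma' l, closed_curve gamma' -> freely_homotopic gamma gamma' ->
     line_integral rho gamma' 0 1 l -> (m <= l)%E) ->
  (m <= curve_length rho gamma)%E.
Proof.
move=> h; apply: le_ereal_inf_tmp => _ [gamma' [cg hg] <-].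
by apply: le_ereal_inf_tmp => l hl; exact: (h gamma').
Qed.

Lemma curve_length_le rho gamma gamma' l : closed_curve gamma' ->
  freely_homotopic gamma gamma' -> line_integral rho gamma' 0 1 l ->
  (curve_length rho gamma <= l)%E.
Proof.
move=> cg hg hl; apply: (@le_trans _ _ (path_length rho gamma')).
  by apply: ereal_inf_lbound; exists gamma'.
by apply: ereal_inf_lbound.
Qed.

Lemma joins_competitor rho d a b B s x y L : measurable_density rho ->
  a <= s -> b < s -> b < dradius d -> 0 <= B ->
  joins rho [set z | gauge d z = s] x y L ->
  joins (competitor rho d a b B) [set z | gauge d z = s] x y L.
Proof.
move=> mrho as_ bs bd B0 h u v uv; have [f [cf fu fv Zf [l hl lL]]] := h u v uv.
have mc := @competitor_measurable_density _ _ rho d a b B mrho bd B0.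
exists f; split => //.
have [|l' ll' hl'] := le_line_integral mc mrho hl.
  move=> t phi tuv aphi Dp; rewrite competitorE// (Zf _ tuv).
  by rewrite (ltNge s a) as_/= (leNgt s b) bs/= mulr0 addr0.
by exists l' => //; exact: le_trans lL.
Qed.

(* Every excursion into {gauge d < r} costs at least B r for the competitor, and
   rerouting it costs at most 2 beta. *)
Lemma competitor_curve_length rho d r s B beta gamma : measurable_density rho ->
  0 < r -> 2 * r < s -> s < dradius d -> 0 <= B -> 2 * beta <= B * r ->
  (forall x y, gauge d x = s -> gauge d y = s ->
     joins rho [set z | gauge d z = s] x y beta) ->
  homotopically_nontrivial gamma ->
  (curve_length rho gamma <= curve_length (competitor rho d r (2 * r) B) gamma)%E.
Proof.
move=> mrho r0 rs sd B0 bB bj nt; set rho' := competitor _ _ _ _ _.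
have bd : 2 * r < dradius d by exact: lt_trans sd.
have r2 : r < 2 * r by lra.
have mrho' : measurable_density rho' by exact: competitor_measurable_density.
apply: le_curve_length => g l cg hg hl.
pose P (f : R -> X) := exists2 l', (l' <= l)%E & line_integral rho' f 0 1 l'.
have Br0 : 0 <= B * r by rewrite mulr_ge0// ltW.
have bB1 : (beta%:E <= (B * r)%:E)%E by rewrite lee_fin; lra.
have cross f u v t0 t1 k : closed_curve f -> 0 <= u -> v <= 1 ->
    line_integral rho' f u v k -> u <= t0 <= v -> u <= t1 <= v ->
    gauge d (f t0) < r -> gauge d (f t1) = s -> ((B * r)%:E <= k)%E.
  move=> [cf _] u0 v1 hk tt0 tt1 g0 g1.
  have := @competitor_crossing _ _ rho d r (2 * r) B f u v k t0 t1 r mrho bd B0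
    (continuous_sub_itv u0 v1 cf) hk tt0 tt1 (ltW g0) r2.
  by rewrite g1 (ltW rs) => /(_ isT); rewrite (_ : 2 * r - r = r)//; ring.
have [|||f [cf hf [l' ll' hl'] rf]] := @clear_square _ _ rho' d r s beta gamma g P (lt_trans r2 rs) sd _ _ nt hg cg.
- move=> x y gx gy; apply: joins_competitor => //; last exact: bj.
  exact: ltW (lt_trans r2 rs).
- move=> f f' cf cf' ff' [u t0 v u0 ut tv v1 gt0 gu gv fl fr [k hk kb]
                   |u t0 v u0 uv v1 tuv gt0 gu gv fm [k hk kb] [k' hk' kb']] [l1 ll1 hl1].
  + have uv := ltW (lt_trans ut tv).
    have [|k0 [k1' [h0 h1' e]]] := line_integral_split (u := u) mrho' hl1.
      by rewrite u0 (le_trans uv v1).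
    have [|k1 [k2 [h1 h2 e']]] := line_integral_split (u := v) mrho' h1'.
      by rewrite uv.
    exists (k0 + (k + k2))%E; last first.
      apply: (line_integral_cat (b := u)).
        by apply: (eq_line_integral h0) => t /fl.
      apply: (line_integral_cat hk).
      by apply: (eq_line_integral h2) => t /fr.
    apply: le_trans ll1; rewrite e e'; apply: leeD => //; apply: leeD => //.
    apply: (le_trans kb); apply: (le_trans bB1).
    by apply: (cross f u v t0 u k1) => //; rewrite ?(ltW ut) ?(ltW tv) ?lexx.
  + have [|k0 [k1' [h0 h1' e]]] := line_integral_split (u := u) mrho' hl1.
      by rewrite (ltW u0) (le_trans uv (ltW v1)).
    have [|k1 [k2 [h1 h2 e']]] := line_integral_split (u := v) mrho' h1'.
      by rewrite uv (ltW v1).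
    exists (k + (k1 + k'))%E; last first.
      apply: (line_integral_cat hk); apply: (line_integral_cat (b := v)) => //.
      by apply: (eq_line_integral h1) => t /fm.
    apply: le_trans ll1; rewrite e e' addeCA (addeCA k0); apply: leeD => //.
    (* The two new arcs cost at most [2 * beta <= B * r], while the end arc containing [t0] alone
       costs at least [B * r]. *)
    apply: (@le_trans _ _ (B * r)%:E).
      apply: (@le_trans _ _ (beta%:E + beta%:E)%E); first exact: leeD.
      by rewrite -EFinD lee_fin; lra.
    case: tuv => /andP[t1 t2].
      rewrite -[leLHS]adde0; apply: leeD; last exact: (line_integral_ge0 mrho' h2).
      apply: (cross f 0 u t0 u k0) => //; rewrite ?t1 ?(ltW t2) ?(ltW u0) ?lexx//.
      exact: le_trans uv (ltW v1).
    rewrite -[leLHS]add0e; apply: leeD; first exact: (line_integral_ge0 mrho' h0).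
    apply: (cross f v 1 t0 v k2) => //; rewrite ?t2 ?(ltW t1) ?(ltW v1) ?lexx//.
    exact: le_trans (ltW u0) uv.
- by exists l.
(* The cleared curve stays in [r <= gauge d], where the competitor is at least [rho]. *)
have [|l2 l2l hl2] := le_line_integral mrho mrho' hl'.
  move=> t phi t01 aphi Dp; rewrite /rho' competitorE// ltNge rf//= lerDl mulr_ge0//.
  by case: ifP => // _; exact: stretch_ge0.
by apply: (le_trans (curve_length_le cf hf hl2)); exact: (le_trans l2l).
Qed.

(* Squares with boundaries of finite length are cleared one after the other;
   what survives is made of finitely many arcs on their boundaries. *)
Lemma curve_length_lty rho gamma : measurable_density rho ->
  (forall x, exists d r s beta, [/\ gauge d x < r, r < s, s < dradius d &
     forall y z, gauge d y = s -> gauge d z = s ->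
       joins rho [set w | gauge d w = s] y z beta]) ->
  closed_curve gamma -> homotopically_nontrivial gamma ->
  (curve_length rho gamma < +oo)%E.
Proof.
move=> mrho sq cg nt; pose fin f a b := exists L, length_le rho f a b L.
have fin_sub f a b a' b' : fin f a b -> a <= a' -> a' <= b' -> b' <= b -> fin f a' b'.
  by move=> [L h] h1 h2 h3; exists L; exact: length_le_sub h h1 h2 h3.
have eq_fin f f' a b : fin f a b -> (forall t, a <= t <= b -> f' t = f t) -> fin f' a b.
  by move=> [L h] e; exists L; apply: (eq_length_le h) => t /e.
(* [A] collects the times whose original points have been cleared: an arc of the current curve has
   finite length, or it is an arc of [gamma] at times outside [A]. *)
pose good A f a b := fin f a b \/ forall t, a <= t <= b -> f t = gamma t /\ ~ A t.
have good_sub A f a b a' b' : good A f a b -> a <= a' -> a' <= b' -> b' <= b ->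
    good A f a' b'.
  move=> [h|h] h1 h2 h3; first by left; exact: fin_sub h1 h2 h3.
  by right=> t /andP[h4 h5]; apply: h; rewrite (le_trans h1 h4) (le_trans h5 h3).
have eq_good A f f' a b : good A f a b -> (forall t, a <= t <= b -> f' t = f t) ->
    good A f' a b.
  move=> [h|h] e; first by left; exact: eq_fin e.
  by right=> t tab; rewrite e//; exact: h.
(* One-sided neighbourhoods, because at the end of an excursion a new arc of finite length may meet
   an untouched arc of [gamma]. *)
pose P A (f : R -> X) :=
  (forall t, 0 <= t < 1 -> exists2 w, t < w <= 1 & good A f t w) /\
  (forall t, 0 < t <= 1 -> exists2 w, 0 <= w < t & good A f w t).
have stepP A rho' d r s beta f f' : rho' = rho ->
    excursion rho' d r s beta f f' -> P A f -> P A f'.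
  have right_eq t w1 g g' : P A g -> 0 <= t -> t < w1 -> w1 <= 1 ->
      (forall x, t <= x <= w1 -> g' x = g x) -> exists2 w, t < w <= 1 & good A g' t w.
    move=> [h _] t0 tw w1' e; have [|w /andP[tw' w1''] gw] := h t.
      by rewrite t0 (lt_le_trans tw w1').
    exists (Num.min w w1); first by rewrite lt_min tw' tw ge_min w1' orbT.
    apply: (eq_good _ g).
      by apply: (good_sub _ _ _ _ _ _ gw); rewrite ?le_min ?ge_min ?lexx ?(ltW tw) ?(ltW tw').
    by move=> x /andP[tx]; rewrite le_min => /andP[_ xw]; apply: e; rewrite tx.
  have left_eq t w1 g g' : P A g -> t <= 1 -> w1 < t -> 0 <= w1 ->
      (forall x, w1 <= x <= t -> g' x = g x) -> exists2 w, 0 <= w < t & good A g' w t.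
    move=> [_ h] t0 tw w1' e; have [|w /andP[w1'' tw'] gw] := h t.
      by rewrite t0 (le_lt_trans w1' tw).
    exists (Num.max w w1); first by rewrite gt_max tw' tw le_max w1' orbT.
    apply: (eq_good _ g).
      by apply: (good_sub _ _ _ _ _ _ gw); rewrite ?ge_max ?le_max ?lexx ?(ltW tw) ?(ltW tw').
    by move=> x /andP[+ tx]; rewrite ge_max => /andP[_ xw]; apply: e; rewrite xw.
  move=> -> [u t0 v u0 ut tv v1 _ _ _ fl fr hk
            |u t0 v u0 uv v1 _ _ _ _ fm hk hk'] Pf; split=> t.
  + move=> /andP[t_0 t_1]; have [tu|ut'] := ltP t u.
      apply: (right_eq _ u _ _ Pf) => //; first exact: le_trans (ltW ut) (le_trans (ltW tv) v1).
      by move=> x /andP[tx xu]; apply: fl; rewrite (le_trans t_0 tx).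
    have [tv'|vt] := ltP t v.
      exists v; first by rewrite tv'.
      by left; apply: (fin_sub _ u v); rewrite ?lexx ?(ltW tv')//; exists beta.
    apply: (right_eq _ 1 _ _ Pf) => // x /andP[tx x1]; apply: fr.
    by rewrite (le_trans vt tx).
  + move=> /andP[t_0 t_1]; have [tu|ut'] := leP t u.
      by apply: (left_eq _ 0 _ _ Pf) => // x /andP[x0 xt]; apply: fl; rewrite x0 (le_trans xt tu).
    have [tv'|vt] := leP t v.
      exists u; first by rewrite u0.
      by left; apply: (fin_sub _ u v); rewrite ?lexx ?(ltW ut')//; exists beta.
    apply: (left_eq _ v _ _ Pf) => //; first exact: le_trans u0 (le_trans (ltW ut) (ltW tv)).
    by move=> x /andP[vx xt]; apply: fr; rewrite vx (le_trans xt t_1).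
  + move=> /andP[t_0 t_1]; have [tu|ut'] := ltP t u.
      exists u; first by rewrite tu (le_trans uv (ltW v1)).
      by left; apply: (fin_sub _ 0 u); rewrite ?lexx ?(ltW tu)//; exists beta.
    have [tv'|vt] := ltP t v.
      apply: (right_eq _ v _ _ Pf) => //; first exact: ltW.
      by move=> x /andP[tx xv]; apply: fm; rewrite (le_trans ut' tx).
    exists 1; first by rewrite t_1 lexx.
    by left; apply: (fin_sub _ v 1); rewrite ?lexx ?(ltW t_1)//; exists beta.
  + move=> /andP[t_0 t_1]; have [tu|ut'] := leP t u.
      exists 0; first by rewrite lexx.
      by left; apply: (fin_sub _ 0 u); rewrite ?lexx ?(ltW t_0)//; exists beta.
    have [tv'|vt] := leP t v.
      apply: (left_eq _ u _ _ Pf) => //; first exact: ltW.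
      by move=> x /andP[ux xt]; apply: fm; rewrite ux (le_trans xt tv').
    exists v; first by rewrite vt (le_trans (ltW u0) uv).
    by left; apply: (fin_sub _ v 1); rewrite ?lexx ?(ltW vt)//; exists beta.
pose curve f := closed_curve f /\ freely_homotopic gamma f.
pose Q (a b : R) := forall A f, curve f -> P A f ->
  exists2 f', curve f' & P (A `|` `[a, b]%classic) f'.
have P_sub A A' f : A `<=` A' -> P A' f -> P A f.
  move=> AA [h1 h2]; have gg a b : good A' f a b -> good A f a b.
    by move=> [h|h]; [left|right=> t /h[h3 h4]; split => // /AA].
  by split => t /[dup] => [/h1|/h2] [w w1 /gg h] _; exists w.
have [f [cf hf] [Pr Pl]] : exists2 f, curve f & P (set0 `|` `[0, 1]%classic) f.
  have : Q 0 1.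
    apply: interval_induction => //.
      move=> u v w Quv Qvw A f cf Pf; have [f1 cf1 Pf1] := Quv _ _ cf Pf.
      have [f2 cf2 Pf2] := Qvw _ _ cf1 Pf1; exists f2 => //; apply: P_sub Pf2.
      move=> t [At|/=]; first by left; left.
      rewrite in_itv/= => /andP[ut tw]; have [tv|/ltW vt] := leP t v.
        by left; right; rewrite /= in_itv/= ut.
      by right; rewrite /= in_itv/= vt.
    move=> t t01; have [d [r [s [beta [gr rs sd bj]]]]] := sq (gamma t).
    have rg : 0 < r - gauge d (gamma t) by rewrite subr_gt0.
    have [e e0 he] := within_itv_dist (@within_gauge_continuous _ _ d _ _ cg.1) t01 rg.
    exists e => // u v u0 ut tv v1 eu ev A f [cf hf] Pf.
    have [||f' [cf' hf' Pf' rf']] := @clear_square _ _ rho d r s beta gamma f (P A) rs sd bj _ nt hf cf.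
    - by move=> g g' _ _ _; exact: stepP.
    - by [].
    exists f' => //.
    have big x : u <= x <= v -> gauge d (gamma x) < r.
      move=> /andP[ux xv]; have : `|gauge d (gamma t) - gauge d (gamma x)| < r - gauge d (gamma t).
        apply: he; first by rewrite (le_trans u0 ux) (le_trans xv v1).
        by rewrite ltr_distlC; apply/andP; split; lra.
      by rewrite ltr_distlC => /andP[_]; lra.
    have gg a b : 0 <= a -> b <= 1 -> good A f' a b -> good (A `|` `[u, v]%classic) f' a b.
      move=> a0 b1 [h|h]; first by left.
      right=> x xab; have [e1 nA] := h _ xab; split => // -[//|].
      move: xab => /andP[ax xb].
      rewrite /= in_itv/= => /big; rewrite -e1 ltNge rf'//.
      by rewrite (le_trans a0 ax) (le_trans xb b1).
    case: Pf' => [h1 h2]; split => x /[dup] /andP[x0 x1].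
      by move=> /h1[w /[dup] ww /andP[_ w1] /gg h]; exists w => //; exact: h.
    by move=> /h2[w /[dup] ww /andP[w0 _] /gg h]; exists w => //; exact: h.
  move=> /(_ set0 gamma); apply; first by split => //; exact: freely_homotopic_refl.
  split=> t /andP[t0 t1].
    by exists 1; [rewrite t1 lexx|right=> x _; split].
  by exists 0; [rewrite t0 lexx|right=> x _; split].
(* All times have been cleared, so only the alternative of finite length remains. *)
have fin_of_good a b : 0 <= a -> a <= b -> b <= 1 ->
    good (set0 `|` `[0, 1]%classic) f a b -> fin f a b.
  move=> a0 ab b1 [//|/(_ a)]; rewrite lexx ab => /(_ isT)[_ []]; right.
  by rewrite /= in_itv/= a0 (le_trans ab b1).
have : 0 <= 1 :> R /\ (0 < 1 :> R -> fin f 0 1).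
  apply: (@interval_induction _ (fun a b => a <= b /\ (a < b -> fin f a b))) => //.
    move=> u v w [uv huv] [vw hvw]; split; first exact: le_trans vw.
    move: uv; rewrite le_eqVlt => /orP[/eqP->//|/huv[L hL] _].
    move: vw; rewrite le_eqVlt => /orP[/eqP<-|/hvw[L' hL']]; first by exists L.
    by exists (L + L'); exact: length_le_cat hL hL'.
  move=> t /andP[t0 t1].
  have [e1 e10 he1] : exists2 e, 0 < e & forall v, t < v -> v <= 1 -> v < t + e -> fin f t v.
    have [/eqP ->|tn1] := boolP (t == 1).
      by exists 1 => // v v1 /(lt_le_trans v1); rewrite ltxx.
    have [|w /andP[tw w1] /fin_of_good h] := Pr t; first by rewrite t0 lt_neqAle tn1.
    exists (w - t); first by rewrite subr_gt0.
    move=> v tv v1; rewrite addrC subrK => vw.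
    by apply: (fin_sub _ t w); rewrite ?lexx ?ltW//; apply: h => //; exact: ltW.
  have [e2 e20 he2] : exists2 e, 0 < e & forall v, v < t -> 0 <= v -> t - e < v -> fin f v t.
    have [/eqP ->|tn0] := boolP (t == 0).
      by exists 1 => // v v1 /le_lt_trans /(_ v1); rewrite ltxx.
    have [|w /andP[w0 wt] /fin_of_good h] := Pl t; first by rewrite t1 lt_neqAle eq_sym tn0 t0.
    exists (t - w); first by rewrite subr_gt0.
    move=> v tv v1; rewrite opprB addrC subrK => vw.
    by apply: (fin_sub _ w t); rewrite ?lexx ?ltW//; apply: h => //; exact: ltW.
  exists (Num.min e1 e2); first by rewrite lt_min e10.
  move=> u v u0 ut tv v1; rewrite ltrBlDr -ltrBlDl lt_min => /andP[_ eu].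
  rewrite -ltrBlDl lt_min => /andP[ev _]; split; first exact: le_trans tv.
  have hR : t < v -> fin f t v by move=> h; apply: he1 => //; lra.
  have hL : u < t -> fin f u t by move=> h; apply: he2 => //; lra.
  move: ut; rewrite le_eqVlt => /orP[/eqP->//|/hL[L hL1] _].
  move: tv; rewrite le_eqVlt => /orP[/eqP<-|/hR[L' hL']]; first by exists L.
  by exists (L + L'); exact: length_le_cat hL1 hL'.
move=> [_ /(_ ltr01)[L [l hl lL]]].
by apply: le_lt_trans (curve_length_le cf hf hl) _; apply: (le_lt_trans lL); rewrite ltry.
Qed.

End Competitors.

(** * Extremal metrics *)

(** A finite subcover argument as an induction principle: if [Q K] failed, the sets whose complement
    in [K] satisfies [Q] would form a proper filter without cluster point in [K]. *)
Lemma compact_induction (T : topologicalType) (K : set T) (Q : set T -> Prop) :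
  compact K -> Q set0 -> (forall A B, A `<=` B -> Q B -> Q A) ->
  (forall A B, Q A -> Q B -> Q (A `|` B)) ->
  (forall x, K x -> exists2 U, nbhs x U & Q U) -> Q K.
Proof.
move=> cK Q0 QS QU Qloc; apply: contrapT => nQ.
pose F : set_system T := [set A | Q (K `\` A)].
have FT : Filter F.
  split => [|A B FA FB|A B AB FA].
  - by rewrite /F/= setDT.
  - by rewrite /F/= setDIr; exact: QU.
  - by apply: QS FA => x [Kx nB]; split => // /AB.
have FF : ProperFilter F by split => //; rewrite /F/= setD0.
have [|x [Kx clx]] := cK F FF; first by rewrite /F/= setDv.
have [U nU QUx] := Qloc _ Kx.
have FU : F (~` U) by apply: QS QUx => y [_ /contrapT].
by have [y [nUy Uy]] := clx _ _ FU nU.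
Qed.

Section LongMetric.
Context {R : realType} {X : riemann_surface R}.
Implicit Types (rho : density X) (d : disc X) (gamma : R -> X).

(** Flat squares are added around the points of a finite cover; a nontrivial curve starting in the
    inner half of such a square has to leave it and so crosses a ring of definite flat width. *)
Lemma exists_long_metric rho : compact [set: X] -> allowable rho ->
  exists rho' (delta : R), [/\ allowable rho', 0 < delta &
    forall gamma, homotopically_nontrivial gamma ->
      (delta%:E <= curve_length rho' gamma)%E].
Proof.
move=> cX arho.
(* [Q] starts from an arbitrary metric and only increases it, so that squares can be added one on
   top of the other. *)
pose Q (A : set X) := forall rho, allowable rho -> exists rho' (delta : R),
  [/\ allowable rho', 0 < delta,
    forall phi p, atlas phi -> chart_dom phi p -> rho phi (phi p) <= rho' phi (phi p)
  & forall gamma gamma' l, homotopically_nontrivial gamma ->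
      freely_homotopic gamma gamma' -> closed_curve gamma' -> A (gamma' 0) ->
      line_integral rho' gamma' 0 1 l -> (delta%:E <= l)%E].
have : Q [set: X].
  apply: compact_induction => //.
  - by move=> rho1 arho1; exists rho1, 1; split.
  - move=> A B AB QB rho1 /QB[rho' [delta [h1 h2 h3 h4]]]; exists rho', delta; split => //.
    by move=> gamma gamma' l h5 h6 h7 /AB; exact: h4.
  - move=> A B QA QB rho1 arho1; have [rho2 [d2 [a2 d20 le2 L2]]] := QA _ arho1.
    have [rho3 [d3 [a3 d30 le3 L3]]] := QB _ a2.
    exists rho3, (Num.min d2 d3); split => //; first by rewrite lt_min d20.
      by move=> phi p aphi Dp; apply: le_trans (le2 _ _ _ _) (le3 _ _ _ _).
    move=> gamma gamma' l nt hg cg AB hl; have mrho3 := allowable_measurable_density a3.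
    case: AB => [A0|B0].
      have [|l' l'l hl'] := le_line_integral (allowable_measurable_density a2) mrho3 hl.
        by move=> t phi _ aphi Dp; exact: le3.
      apply: le_trans l'l; apply: le_trans (L2 _ _ _ nt hg cg A0 hl').
      by rewrite lee_fin ge_min lexx.
    apply: le_trans (L3 _ _ _ nt hg cg B0 hl).
    by rewrite lee_fin ge_min lexx orbT.
  - move=> x _; have [d gx] := exists_disc x; pose b := dradius d / 2.
    have d0 := dradius_gt0 d.
    have [b0 bd] : 0 < b /\ b < dradius d by rewrite /b; split; lra.
    exists [set y | gauge d y < b / 2].
      have : gauge d y @[y --> x] --> gauge d x by exact: gauge_continuous.
      move=> /(_ [set z | z < b / 2]); apply; apply: (@open_nbhs_nbhs _ _ [set z | z < b / 2]).
      by split; [exact: open_lt|rewrite /= gx divr_gt0].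
    (* With [a = 0] nothing is truncated, since [gauge d] is nonnegative. *)
    move=> rho1 arho1; exists (competitor rho1 d 0 b 1), (b / 2).
    have ac : allowable (competitor rho1 d 0 b 1).
      by apply: competitor_allowable => //; rewrite ?lexx ?(ltW b0) ?b0.
    split => //; first by rewrite divr_gt0.
      move=> phi p aphi Dp; rewrite competitorE// mul1r.
      have -> : (gauge d p < 0) = false by apply/negbTE; rewrite -leNgt; exact: gauge_ge0.
      by rewrite lerDl; case: ifP => // _; exact: stretch_ge0.
    move=> gamma gamma' l nt hg cg A0 hl.
    have [t1 t101 gt1] := nontrivial_leaves_square bd nt hg cg.
    have -> : b / 2 = 1 * (b - b / 2) by rewrite mul1r; lra.
    apply: (@competitor_crossing _ _ rho1 d 0 b 1 gamma' 0 1 l 0 t1 (b / 2)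
      (allowable_measurable_density arho1) bd ler01 cg.1 hl) => //.
    + by rewrite lexx ler01.
    + exact: ltW.
    + by lra.
    + exact: ltW.
move=> /(_ rho arho)[rho' [delta [h1 h2 _ h4]]]; exists rho', delta; split => //.
move=> gamma nt; apply: le_curve_length => gamma' l cg hg hl; exact: (h4 gamma gamma').
Qed.

Lemma multicurve_length_le rho rho' (c : weighted_multicurve X) :
  (forall i, (curve_length rho (multicurve_curve i) <=
              curve_length rho' (multicurve_curve (w := c) i))%E) ->
  (multicurve_length rho c <= multicurve_length rho' c)%E.
Proof.
move=> h; apply: lee_sum => i _; apply: lee_wpmul2l; last exact: h.
by rewrite lee_fin ltW// multicurve_weight_gt0.
Qed.

Lemma curve_length_ge0 rho gamma : measurable_density rho ->
  (0 <= curve_length rho gamma)%E.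
Proof.
by move=> mrho; apply: le_curve_length => g l _ _; exact: line_integral_ge0.
Qed.

Lemma allowable_area rho : allowable rho -> exists2 a : R, 0 < a & area rho = a%:E.
Proof.
move=> arho; have := area_neq0 arho; have := area_neqy arho.
have : (0 <= area rho)%E.
  by rewrite area_onT; exact: area_on_ge0.
case: (area rho) => [a|//|//]; rewrite lee_fin => a0 _ an0; exists a => //.
by rewrite lt_neqAle a0 andbT eq_sym; apply/eqP => e; apply: an0; rewrite e.
Qed.

(* The extremal length is positive because some metric gives all the curves a
   definite length. *)
Lemma extremal_area_ge1 (c : weighted_multicurve X) rho rho' : compact [set: X] ->
  extremal_metric c rho -> area rho = 1%:E ->
  (forall i, (curve_length rho (multicurve_curve (w := c) i) < +oo)%E) ->
  allowable rho' ->
  (forall i, (curve_length rho (multicurve_curve i) <=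
              curve_length rho' (multicurve_curve (w := c) i))%E) ->
  (1%:E <= area rho')%E.
Proof.
move=> cX [arho ext] area1 fin arho' le.
have mrho := allowable_measurable_density arho.
have extE : extremal_length c = (multicurve_length rho c ^+ 2)%E.
  rewrite ext /length_area_ratio area1.
  by rewrite (inver 1) oner_eq0 invr1 mule1.
have ext_ge sigma : allowable sigma ->
    (length_area_ratio c sigma <= extremal_length c)%E.
  by move=> asig; rewrite /extremal_length; apply: ereal_sup_ubound => /=; exists sigma.
have L0 : (0 <= multicurve_length rho c)%E.
  apply: sume_ge0 => i _; apply: mule_ge0; last exact: curve_length_ge0.
  by rewrite lee_fin ltW// multicurve_weight_gt0.
have Lfin : (multicurve_length rho c < +oo)%E.
  apply: lte_sum_pinfty => i _; apply: lte_mul_pinfty => //.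
  by rewrite lee_fin ltW// multicurve_weight_gt0.
have [l L_l] : exists l : R, multicurve_length rho c = l%:E.
  by move: L0 Lfin; case: (multicurve_length rho c) => // l; exists l.
have l0 : 0 <= l by rewrite -lee_fin -L_l.
have lgt0 : 0 < l.
  rewrite lt_neqAle l0 andbT eq_sym; apply/eqP => l00.
  have [sig [delta [asig delta0 hd]]] := exists_long_metric cX arho.
  have [a a0 aE] := allowable_area asig.
  have := ext_ge _ asig; rewrite extE L_l l00 /length_area_ratio aE leNgt => /negP; apply.
  have Lsig : (0 < multicurve_length sig c)%E.
    have term0 i : (0 < (multicurve_weight (w := c) i)%:E *
        curve_length sig (multicurve_curve i))%E.
      apply: mule_gt0; first by rewrite lte_fin multicurve_weight_gt0.
      apply: (@lt_le_trans _ _ delta%:E); first by rewrite lte_fin.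
      by apply: hd; exact: multicurve_nontrivial.
    rewrite /multicurve_length (bigD1 (Ordinal (multicurve_nonempty c)))//=.
    apply: (@lt_le_trans _ _ ((multicurve_weight (Ordinal (multicurve_nonempty c)))%:E *
        curve_length sig (multicurve_curve (Ordinal (multicurve_nonempty c)))))%E => //.
    by apply: leeDl; apply: sume_ge0 => i _; exact: ltW.
  rewrite inver gt_eqF// (_ : 0%:E ^+ 2 = 0%E)%E; last by rewrite expe2 mule0.
  by apply: mule_gt0; [exact: expe_gt0|rewrite lte_fin invr_gt0].
have [a a0 aE] := allowable_area arho'.
(* If [a < 1] then [l ^ 2 / a > l ^ 2] contradicts extremality; the strict inequality holds because
   [l] is finite and positive. *)
rewrite aE lee_fin leNgt; apply/negP => a1.
have := ext_ge _ arho'; rewrite extE /length_area_ratio aE L_l inver gt_eqF// leNgt => /negP; apply.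
apply: (@lt_le_trans _ _ ((l ^+ 2)%:E * (a^-1)%:E)%E).
  rewrite -EFin_expe -EFinM lte_fin ltr_pMr ?exprn_gt0// invf_gt1//.
apply: lee_wpmul2r; first by rewrite lee_fin invr_ge0 ltW.
have L' := multicurve_length_le le; rewrite L_l in L'.
by rewrite EFin_expe lee_sqr//; apply: le_trans L'.
Qed.

End LongMetric.

(** * Squares of short boundary *)

Section MeasureComparison.
Import HBNNSimple.

Lemma le_integral_measure d (T : measurableType d) (R : realType)
    (m1 m2 : {measure set T -> \bar R}) (D : set T) (f : T -> \bar R) :
  (forall A, measurable A -> (m1 A <= m2 A)%E) -> (forall x, D x -> (0 <= f x)%E) ->
  (\int[m1]_(x in D) f x <= \int[m2]_(x in D) f x)%E.
Proof.
move=> m12 f0; rewrite !ge0_integralE//; apply: ge_ereal_sup => _ [h hf <-].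
apply: (@le_trans _ _ (sintegral m2 h)); last by apply: ereal_sup_ubound; exists h.
rewrite !sintegralE; apply: lee_fsum; first exact: fimfunP.
move=> _ [x _ <-]; apply: lee_wpmul2l; first by rewrite lee_fin.
by apply: m12.
Qed.

End MeasureComparison.

Section ExpandingIntegral.
Context {R : realType}.
Implicit Types (A B : set (plane R)) (g : plane R -> plane R).

(** An upper bound in place of the change of variables formula: by [lam2_expanding] the push-forward
    of Lebesgue measure under [g] is at most [4 * L ^ 2] times Lebesgue measure. *)
Lemma integral_expanding A B g (L : R) (F : plane R -> \bar R) : 0 <= L ->
  measurable A -> measurable B -> measurable_fun setT g ->
  (forall z w : R * R, `|z - w| <= L * `|(g z : R * R) - g w|) ->
  A `<=` g @^-1` B -> measurable_fun B F -> (forall z, B z -> (0 <= F z)%E) ->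
  (\int[lam2 R]_(z in A) F (g z) <= (4 * L ^+ 2)%:E * \int[lam2 R]_(z in B) F z)%E.
Proof.
move=> L0 mA mB mg gL AB mF F0.
have mgB : measurable (g @^-1` B) by rewrite -[X in measurable X]setTI; exact: mg.
have mFg : measurable_fun (g @^-1` B) (F \o g).
  apply: (measurable_comp mB) => //; first by move=> _ [z gz <-].
  exact: measurable_funTS.
apply: (@le_trans _ _ (\int[lam2 R]_(z in g @^-1` B) (F \o g) z)%E).
  by apply: ge0_subset_integral => // z; exact: F0.
have -> : (\int[lam2 R]_(z in g @^-1` B) (F \o g) z =
  \int[measure_function_pushforward__canonical__measure_function_Measure (lam2 R) mg]_(z in B) F z)%E.
  by rewrite ge0_integral_pushforward// => z /set_mem; exact: F0.
have k0 : 0 <= 4 * L ^+ 2 by rewrite mulr_ge0 ?exprn_ge0.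
pose k : {nonneg R} := NngNum k0.
have -> : ((4 * L ^+ 2)%:E * \int[lam2 R]_(z in B) F z)%E =
    (\int[mscale k (lam2 R)]_(z in B) F z)%E by rewrite ge0_integral_mscale.
apply: le_integral_measure => // C mC.
rewrite /= /mscale/= /pushforward.
have := @lam2_expanding R setT C g L L0 measurableT mg (fun z w _ _ => gL z w) mC.
by rewrite setTI.
Qed.

(* AM-GM: F <= F^2 / (2 k) + k / 2. *)
Lemma integral_expanding_amgm A B g (L k : R) (f : plane R -> R) (a b : R) :
  0 <= L -> 0 < k ->
  measurable A -> measurable B -> measurable_fun setT g ->
  (forall z w : R * R, `|z - w| <= L * `|(g z : R * R) - g w|) ->
  A `<=` g @^-1` B -> measurable_fun B f ->
  (\int[lam2 R]_(z in B) (f z ^+ 2)%:E <= a%:E)%E -> (lam2 R A <= b%:E)%E ->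
  (\int[lam2 R]_(z in A) `|f (g z)|%:E <= (2 * L ^+ 2 * a / k + k * b / 2)%:E)%E.
Proof.
move=> L0 k0 mA mB mg gL AB mf fa Ab.
have mfg : measurable_fun A (f \o g).
  apply: (measurable_comp mB) => //; first by move=> _ [z /AB gz <-].
  exact: measurable_funTS.
have mf2 : measurable_fun A (fun z => (f (g z) ^+ 2)%:E).
  by apply/measurable_EFinP; exact: (measurable_funX 2 mfg).
have h1 : measurable_fun A (fun z => ((2 * k)^-1%:E * (f (g z) ^+ 2)%:E)%E).
  by apply: measurable_funeM; exact: mf2.
have k20 : 0 <= (2 * k)^-1 by rewrite invr_ge0 mulr_ge0// ltW.
apply: (@le_trans _ _ (\int[lam2 R]_(z in A)
    ((2 * k)^-1%:E * (f (g z) ^+ 2)%:E + (k / 2)%:E))%E).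
  apply: ge0_le_integral => //.
  - by apply/measurable_EFinP; exact: measurableT_comp mfg.
  - by apply: emeasurable_funD.
  - move=> z _; rewrite -EFinM -EFinD lee_fin -(real_normK (num_real (f (g z)))).
    move: `|_| (normr_ge0 (f (g z))) => x x0.
    rewrite -subr_ge0 (_ : _ - x = (x - k) ^+ 2 / (2 * k)); first by rewrite mulr_ge0// sqr_ge0.
    by field; rewrite gt_eqF.
rewrite ge0_integralD//; last first.
- by move=> z _; rewrite lee_fin divr_ge0// ltW.
- by move=> z _; rewrite -EFinM lee_fin mulr_ge0// sqr_ge0.
rewrite EFinD; apply: leeD.
  rewrite ge0_integralZl_EFin//; last by move=> z _; rewrite lee_fin sqr_ge0.
  have h := @integral_expanding A B g L (fun z => (f z ^+ 2)%:E) L0 mA mB mg gL AB.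
  have -> : 2 * L ^+ 2 * a / k = (2 * k)^-1 * (4 * L ^+ 2 * a).
    by field; rewrite gt_eqF.
  rewrite [leRHS]EFinM; apply: lee_wpmul2l; first by rewrite lee_fin.
  apply: (le_trans (h _ _)).
  - by apply/measurable_EFinP/measurable_funX.
  - by move=> z _; rewrite lee_fin sqr_ge0.
  - by rewrite [leRHS]EFinM; apply: lee_wpmul2l => //; rewrite lee_fin mulr_ge0 ?exprn_ge0.
rewrite integral_cst// (_ : k * b / 2 = (k / 2) * b); last by ring.
by rewrite [leRHS]EFinM; apply: lee_wpmul2l => //; rewrite lee_fin divr_ge0// ltW.
Qed.

End ExpandingIntegral.

(** * Segments in a chart and averages *)

Section Affine.
Context {R : realType}.

(* The maximum makes [scaling k] a cumulative function for every [k]. *)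
Definition scaling (k : R) (t : R) : R := Num.max k 0 * t.

Lemma scalingE k t : 0 <= k -> scaling k t = k * t.
Proof. by rewrite /scaling => /max_idPl ->. Qed.

Let scaling_nondecreasing k : nondecreasing (scaling k).
Proof. by move=> x y xy; rewrite /scaling ler_wpM2l// le_max lexx orbT. Qed.

Let scaling_continuous k : right_continuous (scaling k).
Proof.
move=> x; apply: cvg_at_right_filter.
exact: (cvgM (cvg_cst _) cvg_id).
Qed.

HB.instance Definition _ k := @isCumulative.Build R _ R (scaling k)
  (@scaling_nondecreasing k) (@scaling_continuous k).

(** A segment of length [c] run through at constant speed on [[a, b]] has this arc-length measure;
    its line integrals are brought back to []0, 1]]. *)
Lemma scaling_integral (a b c : R) (F : R -> \bar R) : a < b -> 0 <= c ->
  measurable_fun `](0 : R), 1]%classic F -> (forall t, 0 < t <= 1 -> (0 <= F t)%E) ->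
  (\int[lebesgue_stieltjes_measure (scaling (c / (b - a))%R)]_(t in `]a, b]%classic)
     F (((t : R) - a) / (b - a))%R =
   c%:E * \int[lebesgue_measure]_(t in `]0%R, 1%R]%classic) F t)%E.
Proof.
move=> ab c0 mF F0; have ba : 0 < b - a by rewrite subr_gt0.
pose g (t : measurableTypeR R) : measurableTypeR R := a + (b - a) * t.
have mg : measurable_fun setT g.
  by apply: measurable_funD => //; exact: measurable_funM.
pose k : {nonneg R} := NngNum c0.
pose nu : {measure set (measurableTypeR R) -> \bar R} := mscale k (measure_function_pushforward__canonical__measure_function_Measure
  (@lebesgue_measure R) mg).
have ginv t : (g t - a) / (b - a) = t by rewrite /g addrC addKr mulrC mulKf// gt_eqF.
have gpre (x y : R) : g @^-1` `]x, y]%classic =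
    `](x - a) / (b - a), (y - a) / (b - a)]%classic.
  apply/seteqP; split => t; rewrite /preimage/g/= !in_itv/=;
  by rewrite ltr_pdivrMr// ler_pdivlMr// ltrBlDl lerBrDl (mulrC t).
have nuE A : measurable A -> A `<=` `]a, b]%classic ->
    lebesgue_stieltjes_measure (scaling (c / (b - a))) A = nu A.
  move=> mA _; apply: lebesgue_stieltjes_measure_unique => // _ [[x y]] /= _ <-.
  rewrite /mscale/= /pushforward gpre lebesgue_measure_itv/= lte_fin.
  have [xy|yx] := ltP x y; last first.
    have e : `]x, y]%classic = set0 :> set R by apply: set_itv_ge; rewrite bnd_simp -leNgt.
    rewrite [in LHS]e measure0 ltNge ler_pM2r ?invr_gt0// lerD2r yx/= mule0//.
  rewrite (lebesgue_stieltjes_itvoc (scaling (c / (b - a))) (ltW xy)).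
  rewrite ltr_pM2r ?invr_gt0// ltrD2r xy -EFinB -EFinM; congr EFin.
  rewrite /= !scalingE ?divr_ge0 ?(ltW ba)//.
  by field; rewrite gt_eqF.
have mFt : measurable_fun `]a, b]%classic (fun t => F ((t - a) / (b - a))).
  apply: (measurable_comp (F := `](0 : R), 1]%classic)) => //.
    move=> _ [t + <-]; rewrite /= !in_itv/= => /andP[at_ tb].
    by rewrite divr_gt0 ?subr_gt0//= ler_pdivrMr// mul1r lerB.
  by apply: measurable_funM => //; exact: measurable_funB.
have F0t t : `]a, b]%classic t -> (0 <= F ((t - a) / (b - a))%R)%E.
  rewrite /= in_itv/= => /andP[at_ tb]; apply: F0.
  by rewrite divr_gt0 ?subr_gt0//= ler_pdivrMr// mul1r lerB.
rewrite (eq_measure_integral nu nuE) ge0_integral_mscale//; congr (_ * _)%E.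
rewrite ge0_integral_pushforward//; last by move=> t /set_mem; exact: F0t.
rewrite gpre subrr mul0r divff ?gt_eqF//; apply: eq_integral => t _.
by rewrite /= ginv.
Qed.

End Affine.

Section Segments.
Context {R : realType}.

Lemma cnorm_toCZ (x : R) (v : R * R) : cnorm (toC (x *: v)) = `|x| * cnorm (toC v).
Proof. by rewrite !cnormE/= !exprMn -mulrDr sqrtrM ?sqr_ge0// sqrtr_sqr. Qed.

(** By telescoping, all inscribed polygons have the same length. *)
Lemma affine_arc_length (f : R -> (R[i])^o) (a b k : R) : 0 <= k ->
  (forall t u, a <= t -> t <= u -> u <= b -> cnorm (f u - f t) = k * (u - t)) ->
  arc_length_function f a b (scaling k).
Proof.
move=> k0 fk t u at_ tu ub.
have len s : itv_partition t u s -> polygon_length f t u s = k * (u - t).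
  move=> [ps /eqP ls]; rewrite /polygon_length.
  have lt_nth i j : (i < j)%N -> (j <= size s)%N -> nth u (t :: s) i < nth u (t :: s) j.
    move=> ij js; have := @sorted_ltn_nth _ <%O lt_trans u (t :: s) ps i j.
    by rewrite !inE /= => h; apply: h => //; rewrite ltnS // (leq_trans (ltnW ij) js).
  have n0 : nth u (t :: s) 0 = t by [].
  have n1 : nth u (t :: s) (size s) = u by rewrite -[X in nth _ _ X]/((size (t :: s)).-1) nth_last /= ls.
  rewrite (eq_big_nat _ _ (F2 := fun n => k * nth u (t :: s) n.+1 - k * nth u (t :: s) n)).
    by rewrite telescope_sumr// n0 n1 mulrBr.
  move=> i /andP[_ is_]; rewrite fk; first by rewrite mulrBr.
  - case: i is_ => [|i] is_; first by rewrite n0.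
    by apply: le_trans at_ _; have := lt_nth 0 i.+1 isT (ltnW is_); rewrite n0 => /ltW.
  - by rewrite ltW// lt_nth.
  - move: is_; rewrite leq_eqVlt => /orP[/eqP->|is_]; first by rewrite n1.
    by apply: le_trans ub; have := lt_nth _ _ is_ (leqnn _); rewrite n1 => /ltW.
rewrite /arc_length; apply/eqP; rewrite eq_le; apply/andP; split.
  apply: ereal_sup_ubound; have [tu'|ut] := ltP t u.
    exists [:: u]; first by split => //=; rewrite tu'.
    by rewrite /= !scalingE// len ?mulrBr//; split => //=; rewrite tu'.
  have -> : u = t by apply/eqP; rewrite eq_le ut.
  exists [::]; first by split => /=.
  by rewrite /polygon_length big_nil subrr.
apply: ge_ereal_sup => _ [s hs <-]; rewrite (len _ hs) /= !scalingE//.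
by rewrite mulrBr.
Qed.

Context {X : riemann_surface R}.
Implicit Types (rho : density X) (psi : chart R X).

Lemma measurable_density_segment rho psi (p v : R * R) (D : set R) :
  measurable_density rho -> atlas psi -> measurable D ->
  (forall t, D t -> (plane_coord psi @` chart_dom psi) (p + t *: v)) ->
  measurable_fun D (fun t => (rho psi (toC (p + t *: v)))%:E).
Proof.
move=> [_ mrho] apsi mD dom; apply/measurable_EFinP.
have mV := open_measurable2 (plane_coord_open apsi (atlas_open apsi) (@subset_refl _ _)).
have mg : measurable_fun D (fun t => (p + t *: v : R * R)).
  apply: (@measurable_fun_pairD R _ _ D (fun t => p.1 + t * v.1) (fun t => p.2 + t * v.2)) => //;
  by apply: measurable_funD => //; exact: measurable_funM.
have : measurable_fun D ((fun z : R * R => rho psi (z.1 +i* z.2)%C) \o (fun t => p + t *: v)).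
  by apply: (measurable_comp mV _ (mrho psi apsi) mg) => _ [t /dom h <-].
by [].
Qed.

(** The [rho]-length of the segment is the modulus of [w - p] times the integral; the factor 2
    bounds the modulus by the sup norm. *)
Lemma segment_joins rho psi (Z : set X) (p w : R * R) (M : R) :
  measurable_density rho -> atlas psi ->
  (forall t, 0 <= t <= 1 -> (plane_coord psi @` chart_dom psi) (p + t *: (w - p)) /\
     Z (coord_inv psi (p + t *: (w - p)))) ->
  ((2 * `|w - p|)%:E * \int[lebesgue_measure]_(t in `]0%R, 1%R]%classic)
     (rho psi (toC (p + t *: (w - p))))%R%:E <= M%:E)%E ->
  joins rho Z (coord_inv psi p) (coord_inv psi w) M.
Proof.
move=> mrho apsi dom hM a b ab; set v := w - p in dom hM *.
pose th (t : R) := (t - a) / (b - a).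
have ba : 0 < b - a by rewrite subr_gt0.
have th01 t : a <= t <= b -> 0 <= th t <= 1.
  move=> /andP[at_ tb]; rewrite /th divr_ge0 ?subr_ge0 ?(ltW ab)//=.
  by rewrite ler_pdivrMr// mul1r lerB.
pose gamma t := coord_inv psi (p + th t *: v).
have psig t : a <= t <= b -> chart_dom psi (gamma t) /\ psi (gamma t) = toC (p + th t *: v).
  move=> /th01/dom[Vt _]; have [D e] := plane_coordK apsi Vt; split => //.
  by rewrite -[LHS]ofCK -plane_coordE e.
have arc : arc_length_function (psi \o gamma) a b (scaling (cnorm (toC v) / (b - a))).
  apply: affine_arc_length; first by rewrite divr_ge0 ?cnorm_ge0 ?ltW.
  move=> t u at_ tu ub.
  have [_ /= ->] := psig u (introT andP (conj (le_trans at_ tu) ub)).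
  have [_ /= ->] := psig t (introT andP (conj at_ (le_trans tu ub))).
  rewrite toCB opprD addrACA subrr add0r -scalerBl cnorm_toCZ.
  have -> : th u - th t = (u - t) / (b - a) by rewrite /th -mulrBl opprB addrA subrK.
  rewrite ger0_norm ?divr_ge0 ?subr_ge0// ?ltW//; first by rewrite mulrC mulrA mulrAC.
exists gamma; split.
- apply/subspace_continuousP => t tI.
  have tab : a <= t <= b by move: tI; rewrite /= in_itv.
  have [Vt _] := dom _ (th01 t tab).
  apply: cvg_within_filter.
  have cth : (fun t => p + th t *: v) @ nbhs t --> p + th t *: v.
    apply: cvgD; first exact: cvg_cst.
    apply: cvgZ; last exact: cvg_cst.
    by apply: cvgM; [apply: cvgB; [exact: cvg_id|exact: cvg_cst]|exact: cvg_cst].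
  exact: (cvg_comp _ _ cth (coord_inv_continuous apsi Vt)).
- by rewrite /gamma /th subrr mul0r scale0r addr0.
- by rewrite /gamma /th divff ?gt_eqF// scale1r /v addrC subrK.
- by move=> t /th01/dom[].
- exists (\int[lebesgue_stieltjes_measure (scaling (cnorm (toC v) / (b - a))%R)]_(t in
       `]a, b]%classic) (rho psi (psi (gamma t)))%:E)%E.
    by apply: (line_integral_chart rho apsi (ltW ab) _ arc) => t /psig[].
  rewrite (_ : (\int[_]_(t in _) _)%E =
     (\int[lebesgue_stieltjes_measure (scaling (cnorm (toC v) / (b - a))%R)]_(t in
       `]a, b]%classic) (rho psi (toC (p + (((t : R) - a) / (b - a)) *: v)))%R%:E)%E); last first.
    apply: eq_integral => t /set_mem; rewrite /= in_itv/= => /andP[/ltW at_ tb].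
    by have [_ ->] := psig t (introT andP (conj at_ tb)).
  have F0 t : 0 < t <= 1 -> (0 <= (rho psi (toC (p + t *: v)))%:E)%E.
    move=> /andP[/ltW t0 t1]; have [|Vt _] := dom t; first by rewrite t0.
    have [D e] := plane_coordK apsi Vt; rewrite lee_fin.
    by have := mdensity_ge0 mrho apsi D; rewrite -[psi _]ofCK -plane_coordE e.
  have mF : measurable_fun `](0 : R), 1]%classic (fun t => (rho psi (toC (p + t *: v)))%:E).
    apply: measurable_density_segment => // t; rewrite /= in_itv/= => /andP[/ltW t0 t1].
    by have [|] := dom t; first by rewrite t0.
  rewrite (scaling_integral (F := fun t => (rho psi (toC (p + t *: v)))%:E) ab (cnorm_ge0 _) mF F0).
  apply: le_trans hM; apply: lee_wpmul2r; last by rewrite lee_fin -[v in leRHS]toCK cnorm_le_ofC.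
  by apply: integral_ge0 => t; rewrite /= in_itv/=; exact: F0.
Qed.

End Segments.

Lemma exists_le_average d (T : measurableType d) (R : realType)
    (mu : {measure set T -> \bar R}) (D : set T) (F : T -> \bar R) (K M m : R) :
  measurable D -> measurable_fun D F -> (forall x, D x -> (0 <= F x)%E) ->
  mu D = m%:E -> (\int[mu]_(x in D) F x <= K%:E)%E -> 0 <= M -> K < M * m ->
  exists2 x, D x & (F x <= M%:E)%E.
Proof.
move=> mD mF F0 Dm FK M0 KM; apply: contrapT => h.
have big x : D x -> (M%:E <= F x)%E.
  by move=> Dx; rewrite leNgt; apply/negP => /ltW FM; apply: h; exists x.
move: KM; rewrite ltNge => /negP; apply; rewrite -lee_fin; apply: le_trans FK.
rewrite EFinM -Dm -integral_cst//; exact: ge0_le_integral.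
Qed.

Lemma lebesgue_affine_integral (R : realType) (a b : R) (F : R -> \bar R) : a < b ->
  measurable_fun `](0 : R), 1]%classic F -> (forall t, 0 < t <= 1 -> (0 <= F t)%E) ->
  ((b - a)%:E * \int[lebesgue_measure]_(t in `]0%R, 1%R]%classic) F t =
   \int[lebesgue_measure]_(t in `]a, b]%classic) F (((t : R) - a) / (b - a))%R)%E.
Proof.
move=> ab mF F0; have ba : 0 < b - a by rewrite subr_gt0.
have h := @scaling_integral R a b (b - a) F ab (ltW ba) mF F0.
have e1 : (b - a) / (b - a) = 1 by rewrite divff// gt_eqF.
rewrite e1 in h.
apply: etrans (esym h) _ => {h}.
apply: eq_measure_integral => A mA _; apply: lebesgue_stieltjes_measure_unique => // _ [[x y]] /= _ <-.
rewrite lebesgue_measure_itv/= lte_fin; have [xy|yx] := ltP x y.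
  by rewrite (lebesgue_stieltjes_itvoc (scaling 1) (ltW xy))/= !scalingE// !mul1r.
have xy0 : `]x, y]%classic = set0 :> set R by apply: set_itv_ge; rewrite bnd_simp -leNgt.
by rewrite [in LHS]xy0 measure0.
Qed.

Lemma convex_norm_le (R : realType) (s t1 t2 t : R) : - s <= t1 -> t1 <= t2 ->
  t2 <= s -> 0 <= t <= 1 -> `|t1 + t * (t2 - t1)| <= s.
Proof.
by move=> h1 h2 h3 /andP[h4 h5]; rewrite ler_norml; apply/andP; split; nra.
Qed.

(** * A short square in a ring *)

Section GoodSquare.
Context {R : realType} {X : riemann_surface R}.
Variables (d : disc X) (rho : density X) (r e : R).
Hypotheses (mrho : measurable_density rho) (r0 : 0 < r) (rd : 3 * r < dradius d) (e0 : 0 < e).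
Hypothesis area_ring :
  (area_in rho (dchart d) [set x | (2 * r < gauge d x < 3 * r)%R] <= (e ^+ 2)%:E)%E.

Let psi := dchart d.
Let c := dcenter d.
Let sg (b : bool) : R := if b then 1 else -1.

Let sgM (b : bool) x : `|sg b * x| = `|x|.
Proof. by case: b; rewrite /sg ?mul1r// mulN1r normrN. Qed.

(** The triple encodes a swap of the axes and two signs: the eight symmetries of the square. They
    bring each side, run in either direction, to the form [{s} x [-s, s]], so that one Fubini
    argument serves all sides. *)
Let q (i : bool * bool * bool) (z : R * R) : R * R :=
  if i.1.1 then (sg i.2 * z.2, sg i.1.2 * z.1) else (sg i.1.2 * z.1, sg i.2 * z.2).
Let g i (z : plane R) : plane R := (c + q i z : R * R).

Let qB i z w : q i z - q i w = q i (z - w).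
Proof. by rewrite /q; case: ifP => _; apply/eqP; rewrite xpair_eqE/= !mulrBr !eqxx. Qed.

Let q_norm i z : `|q i z| = `|z|.
Proof. by rewrite /q; case: ifP => _; rewrite !prod_normE/= !sgM// maxC. Qed.

Let dist_g i z : `|c - (g i z : R * R)| = `|z : R * R|.
Proof. by rewrite /g opprD addrA subrr add0r normrN q_norm. Qed.

Let mg i : measurable_fun setT (g i).
Proof.
have m0 (b : bool) : measurable_fun setT (fun z : plane R => sg b * z.1).
  by apply: measurable_funM => //; exact: measurable_fst.
have m0' (b : bool) : measurable_fun setT (fun z : plane R => sg b * z.2).
  by apply: measurable_funM => //; exact: measurable_snd.
have m1 i' : measurable_fun setT (fun z : plane R => c.1 + (q i' z).1).
  case: i' => [[[] a] b]; first exact: (measurable_funD (measurable_cst c.1) (m0' b)).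
  exact: (measurable_funD (measurable_cst c.1) (m0 a)).
have m2 i' : measurable_fun setT (fun z : plane R => c.2 + (q i' z).2).
  case: i' => [[[] a] b]; first exact: (measurable_funD (measurable_cst c.2) (m0 a)).
  exact: (measurable_funD (measurable_cst c.2) (m0' b)).
exact: (@measurable_fun_pairD R _ _ setT _ _ measurableT (m1 i) (m2 i)).
Qed.

(** Contains [{s} x [-s, s]] for all [2r < s < 3r], and its symmetric images stay in the ring
    because the first coordinate exceeds [2r]. *)
Let D : set (plane R) := `](2 * r), (3 * r)[%classic `*` `](- (3 * r)), (3 * r)[%classic.
Let B : set (plane R) := [set z | 2 * r < `|c - (z : R * R)| < 3 * r].
Let f (z : plane R) : R := rho psi (z.1 +i* z.2)%C.

Let mD : measurable D. Proof. by apply: measurableX; exact: measurable_itv. Qed.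

Let ringE : plane_coord psi @` [set x | 2 * r < gauge d x < 3 * r] = B.
Proof.
apply/seteqP; split => [_ [x /= /andP[h1 h2] <-]|z /= /andP[h1 h2]].
  by have [_ e1] := gauge_lt (lt_trans h2 rd); rewrite /B/= -e1 h1.
have [_ e1 e2] := gauge_coord (le_trans (ltW h2) (ltW rd)).
by exists (coord_inv psi z) => //=; rewrite e2 h1.
Qed.

Let mB : measurable B.
Proof.
rewrite (_ : B = [set z : R * R | 2 * r < `|c - z|] `&` [set z : R * R | `|c - z| < 3 * r]).
  have cn : continuous (fun z : R * R => `|c - z|).
    by move=> z; apply: cvg_norm; apply: cvgB; [exact: cvg_cst|exact: cvg_id].
  apply: open_measurable2; apply: openI.
    by apply: (open_comp (f := fun z : R * R => `|c - z|) (D := [set y | 2 * r < y])).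
  by apply: (open_comp (f := fun z : R * R => `|c - z|) (D := [set y | y < 3 * r])).
by apply/seteqP; split => z /=; [move=> /andP[]|move=> [? ?]; apply/andP].
Qed.

Let BV : B `<=` plane_coord psi @` chart_dom psi.
Proof. by move=> z /andP[_ h]; apply: dsub; apply: le_trans (ltW h) (ltW rd). Qed.

Let mf : measurable_fun B f.
Proof.
apply: measurable_funS BV _; last exact: (mdensity_measurable mrho (dchart_atlas d)).
exact: (open_measurable2 (plane_coord_open (dchart_atlas d) (atlas_open (dchart_atlas d)) (@subset_refl _ _))).
Qed.

Let Dg i : D `<=` g i @^-1` B.
Proof.
move=> z [/=]; rewrite !in_itv/= => /andP[z1 z1'] /andP[z2 z2'].
rewrite /B/= dist_g prod_normE/= lt_max gt_max.
have z10 : 0 < z.1 by apply: lt_trans z1; rewrite mulr_gt0.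
by rewrite (gtr0_norm z10) z1 z1'/= ltr_norml z2.
Qed.

Let H i (z : plane R) : \bar R := ((fun z => `|f (g i z)|%:E) \_ D) z.

Let H0 i z : (0 <= H i z)%E.
Proof. by rewrite /H patchE; case: ifP. Qed.

Let mH i : measurable_fun setT (H i).
Proof.
apply: (iffLR (measurable_restrictT _ mD)); apply/measurable_EFinP.
apply: measurableT_comp => //.
apply: (measurable_comp mB) => //; first by move=> _ [z Dz <-]; exact: Dg Dz.
exact: (measurable_funTS (mg i)).
Qed.

Let inner i (s : measurableTypeR R) : \bar R := fubini_F (@lebesgue_measure R) (H i) s.

(** The rectangle [D] has area [6 * r ^ 2]; with [L = 1] and [k = e / r] the AM-GM bound is
    [2 e r + 3 e r]. *)
Let inner_int i : (\int[lebesgue_measure]_s inner i s <= (5 * e * r)%:E)%E.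
Proof.
rewrite /inner -(fubini_tonelli1 _ (mH i) (H0 i)).
rewrite -(integral_mkcond D (fun z => `|f (g i z)|%:E)).
have k0 : 0 < e / r by rewrite divr_gt0.
have expd (z w : R * R) : `|z - w| <= 1 * `|(g i z : R * R) - g i w|.
  by rewrite mul1r /g opprD addrACA subrr add0r qB q_norm.
have a_le : (\int[lam2 R]_(z in B) (f z ^+ 2)%:E <= (e ^+ 2)%:E)%E.
  by rewrite -ringE; exact: area_ring.
have b_le : (lam2 R D <= (6 * r ^+ 2)%:E)%E.
  have h1 : 2 * r <= 3 * r by rewrite ler_pM2r// ler_nat.
  have h2 : - (3 * r) <= 3 * r by rewrite ge0_cp// mulr_ge0// ltW.
  by rewrite (lam2_itv _ _ _ _ h1 h2) lee_fin (_ : _ * _ = 6 * r ^+ 2)//; ring.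
apply: (le_trans (@integral_expanding_amgm R D B (g i) 1 (e / r) f (e ^+ 2) (6 * r ^+ 2)
  ler01 k0 mD mB (mg i) expd (@Dg i) mf a_le b_le)).
rewrite lee_fin le_eqVlt; apply/orP; left; apply/eqP; field.
by rewrite !gt_eqF.
Qed.

(** The eight integrals sum to at most [40 e r] over an interval of length [r]; 41 instead of 40
    gives the strict inequality needed for averaging. *)
Let good_height : exists s, 2 * r < s < 3 * r /\ forall i, (inner i s <= (41 * e)%:E)%E.
Proof.
pose F (s : measurableTypeR R) := (\sum_(i : bool * bool * bool) inner i s)%E.
have minner i : measurable_fun setT (inner i) by exact: measurable_fun_fubini_tonelli_F.
have inner0 i s : (0 <= inner i s)%E by apply: integral_ge0 => t _; exact: H0.
have mF : measurable_fun setT F by apply: emeasurable_sum => i.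
have [|||||||s /=] := @exists_le_average _ _ R (@lebesgue_measure R)
    `](2 * r), (3 * r)[%classic F (40 * e * r) (41 * e) r.
- exact: measurable_itv.
- exact: measurable_funTS.
- by move=> s _; apply: sume_ge0.
- have lt23 : 2 * r < 3 * r by rewrite ltr_pM2r// ltr_nat.
  have -> : r%:E = (3 * r - 2 * r)%:E by congr EFin; ring.
  by rewrite EFinB; have := lebesgue_measure_itv `](2 * r), (3 * r)[; rewrite /= lte_fin lt23.
- apply: (@le_trans _ _ (\int[lebesgue_measure]_s F s)%E).
    by apply: ge0_subset_integral => // s _; apply: sume_ge0.
  rewrite ge0_integral_sum//.
  have -> : (40 * e * r)%:E = (\sum_(i : bool * bool * bool) (5 * e * r)%:E)%E.
    rewrite sumEFin sumr_const; congr EFin.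
    have -> : #|{: bool * bool * bool}| = 8%N by rewrite !card_prod card_bool.
    by rewrite -mulr_natr; ring.
  by apply: lee_sum => i _; exact: inner_int.
- by rewrite mulr_ge0// ltW.
- by rewrite ltr_pM2r// ltr_pM2r// ltr_nat.
rewrite in_itv/= => s23 Fs; exists s; split => // i; apply: le_trans Fs.
rewrite /F (bigD1 i)//=; apply: leeDl; exact: sume_ge0.
Qed.

Let pt sw sgn s t : X := coord_inv psi (g (sw, sgn, true) (s, t)).

Let gauge_pt i s t : 0 < s -> s < 3 * r -> `|t| <= s ->
  gauge d (coord_inv psi (g i (s, t))) = s.
Proof.
move=> s0 s3 ts; have n : `|c - g i (s, t)| = s.
  by rewrite dist_g prod_normE/= (gtr0_norm s0); apply/max_idPl.
have [|_ _ ->] := @gauge_coord _ _ d (g i (s, t)); last exact: n.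
by rewrite -/c n; apply: le_trans (ltW s3) (ltW rd).
Qed.

(** 82 is twice 41, by the factor 2 in [segment_joins]. *)
Let oriented_side s i t1 t2 : 2 * r < s < 3 * r -> (inner i s <= (41 * e)%:E)%E ->
  - s <= t1 -> t1 <= t2 -> t2 <= s ->
  joins rho [set x | gauge d x = s] (coord_inv psi (g i (s, t1)))
    (coord_inv psi (g i (s, t2))) (82 * e).
Proof.
move=> /andP[s2 s3] hs t1s t12 t2s.
have s0 : 0 < s by apply: lt_trans s2; rewrite mulr_gt0.
have seg t : (g i (s, t1) : R * R) + t *: ((g i (s, t2) : R * R) - g i (s, t1)) =
    g i (s, t1 + t * (t2 - t1)).
  rewrite /g -addrA; congr (_ + _); rewrite opprD addrACA subrr add0r.
  by rewrite /q; case: ifP => _; apply/eqP; rewrite xpair_eqE/=; apply/andP; split; apply/eqP;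
    rewrite /GRing.scale/=; ring.
have in_s t : 0 <= t <= 1 -> `|t1 + t * (t2 - t1)| <= s.
  exact: convex_norm_le.
have nrm : `|(g i (s, t2) : R * R) - g i (s, t1)| = t2 - t1.
  rewrite /g opprD addrACA subrr add0r qB q_norm prod_normE/= subrr normr0.
  by rewrite ger0_norm ?subr_ge0//; apply/max_idPr; rewrite subr_ge0.
apply: segment_joins => //; first exact: dchart_atlas.
  move=> t t01; rewrite seg; split.
    apply: dsub; rewrite dist_g prod_normE/= (gtr0_norm s0) ge_max.
    have sd : s <= dradius d by apply: le_trans (ltW s3) (ltW rd).
    by rewrite sd (le_trans (in_s _ t01) sd).
  exact: gauge_pt (in_s _ t01).
rewrite nrm; have -> : (82 * e)%:E = (2%:E * (41 * e)%:E)%E.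
  by rewrite -EFinM; congr EFin; ring.
rewrite EFinM -muleA; apply: lee_wpmul2l; first by rewrite lee_fin.
have [<-|ne] := eqVneq t1 t2.
  by rewrite subrr mul0e lee_fin mulr_ge0// ltW.
have {t12 ne} t12 : t1 < t2 by rewrite lt_neqAle ne.
pose F t := (rho psi (toC ((g i (s, t1) : R * R) + t *: ((g i (s, t2) : R * R) - g i (s, t1)))))%:E.
have dom t : 0 < t <= 1 -> (plane_coord psi @` chart_dom psi)
    ((g i (s, t1) : R * R) + t *: ((g i (s, t2) : R * R) - g i (s, t1))).
  move=> /andP[/ltW h0 h1]; rewrite seg; apply: dsub; rewrite dist_g prod_normE/= (gtr0_norm s0) ge_max.
  have sd : s <= dradius d by apply: le_trans (ltW s3) (ltW rd).
  by rewrite sd (le_trans (in_s _ _) sd)// h0.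
have F0 t : 0 < t <= 1 -> (0 <= F t)%E.
  move=> /dom Vt; have [Dt et] := plane_coordK (dchart_atlas d) Vt.
  have := mdensity_ge0 mrho (dchart_atlas d) Dt.
  by rewrite -/psi -[psi _]ofCK -plane_coordE et lee_fin.
have mF : measurable_fun `](0 : R), 1]%classic F.
  by apply: measurable_density_segment => //; exact: dchart_atlas.
rewrite (lebesgue_affine_integral t12 mF F0); apply: le_trans hs.
have DH t : t1 < t <= t2 -> H i (s, t) = F ((t - t1) / (t2 - t1)).
  move=> /andP[h1 h2]; have F01 : 0 < (t - t1) / (t2 - t1) <= 1.
    by rewrite divr_gt0 ?subr_gt0//= ler_pdivrMr ?subr_gt0// mul1r lerB.
  have e2 : t1 + (t - t1) / (t2 - t1) * (t2 - t1) = t.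
    by rewrite divfK ?subr_eq0 ?gt_eqF// addrC subrK.
  have Dst : D (s, t).
    split; rewrite /= in_itv/= ?s2// (le_lt_trans h2 (le_lt_trans t2s s3)) andbT.
    by apply: lt_trans h1; apply: lt_le_trans t1s; rewrite ltrN2.
  rewrite /H patchE mem_set//; have := F0 _ F01.
  by rewrite /F seg e2 lee_fin => h; rewrite /f ger0_norm.
rewrite (eq_integral (fun t => H i (s, t))); last first.
  by move=> t /set_mem; rewrite /= in_itv/= => /DH.
have mHs : measurable_fun setT (fun t : measurableTypeR R => H i (s, t)).
  exact: (@measurable_fun_pair2 _ _ _ (measurableTypeR R) (measurableTypeR R) _ (H i) s (mH i)).
by apply: ge0_subset_integral => //; exact: measurable_itv.
Qed.

Let side s sw sgn t1 t2 : 2 * r < s < 3 * r ->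
  (forall i, (inner i s <= (41 * e)%:E)%E) -> `|t1| <= s -> `|t2| <= s ->
  joins rho [set x | gauge d x = s] (pt sw sgn s t1) (pt sw sgn s t2) (82 * e).
Proof.
move=> s23 hs; rewrite !ler_norml => /andP[t1s t1s'] /andP[t2s t2s'].
have [t12|/ltW t21] := leP t1 t2; first exact: oriented_side.
(* The symmetry with the opposite second sign runs the side backwards. *)
have flip t : g (sw, sgn, true) (s, t) = g (sw, sgn, false) (s, - t).
  by rewrite /g /q /=; case: sw => /=; rewrite /sg mulN1r opprK mul1r.
by rewrite /pt !flip; apply: oriented_side => //; rewrite ?lerN2// lerNl.
Qed.

(** Each point is joined to one fixed corner along two sides, at cost [2 * 82 * e = 164 * e], and
    two points are joined through that corner. *)
Lemma good_square : exists s, 2 * r < s < 3 * r /\ forall x y, gauge d x = s -> gauge d y = s ->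
  joins rho [set z | gauge d z = s] x y (328 * e).
Proof.
have [s [s23 hs]] := good_height; exists s; split => //.
have [s2 s3] := andP s23; have s0 : 0 < s by apply: lt_trans s2; rewrite mulr_gt0.
have ss : `|s| <= s by rewrite (gtr0_norm s0).
have corner sw sgn : pt sw sgn s s = pt (~~ sw) true s (sg sgn * s).
  by rewrite /pt /g /q /=; case: sw => /=; rewrite /sg !mul1r.
have sgs sgn : `|sg sgn * s| <= s by rewrite sgM.
have to_corner sw sgn t : `|t| <= s ->
    joins rho [set z | gauge d z = s] (pt sw sgn s t) (pt true true s s) (164 * e) /\
    joins rho [set z | gauge d z = s] (pt true true s s) (pt sw sgn s t) (164 * e).
  move=> ts; have -> : 164 * e = 82 * e + 82 * e by ring.
  have -> : pt true true s s = pt (~~ sw) true s s.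
    by case: sw => //=; rewrite corner /sg mul1r.
  split.
    by apply: (@joins_trans _ _ _ _ _ (pt sw sgn s s)); [|rewrite (corner sw sgn)]; apply: side.
  by apply: (@joins_trans _ _ _ _ _ (pt sw sgn s s)); [rewrite (corner sw sgn)|]; apply: side.
have on_side x : gauge d x = s -> exists sw sgn t, `|t| <= s /\ x = pt sw sgn s t.
  move=> gx; have sd : gauge d x < dradius d by rewrite gx (lt_trans s3 rd).
  have [Dx e1] := gauge_lt sd; rewrite gx in e1.
  have ex : x = coord_inv psi (plane_coord psi x) by rewrite coord_invK//; exact: dchart_atlas.
  move: e1; rewrite -/psi -/c; set z := plane_coord psi x => e1.
  have sgE (y : R) : `|y| = s -> exists sgn, y = sg sgn * s.
    move=> <-; have [y0|y0] := leP 0 y; first by exists true; rewrite /sg mul1r ger0_norm.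
    by exists false; rewrite /sg ltr0_norm// mulN1r opprK.
  have /andP[n1 n2] : (`|z.1 - c.1| <= s) && (`|z.2 - c.2| <= s).
    by rewrite -ge_max [X in X <= _](_ : _ = s)// e1 prod_normE/= !(distrC (c.1)) !(distrC c.2).
  have : `|z.1 - c.1| = s \/ `|z.2 - c.2| = s.
    move: e1; rewrite prod_normE/= (distrC c.1) (distrC c.2) maxEle; case: ifP => _ ->; [by right|by left].
  case=> /sgE[sgn h].
    exists false, sgn, (z.2 - c.2); split => //; rewrite ex /pt /g /q/= -h mul1r.
    by congr (coord_inv psi _); apply/eqP; rewrite xpair_eqE/= !(addrC c.1) !(addrC c.2) !subrK !eqxx.
  exists true, sgn, (z.1 - c.1); split => //; rewrite ex /pt /g /q/= -h mul1r.
  by congr (coord_inv psi _); apply/eqP; rewrite xpair_eqE/= !(addrC c.1) !(addrC c.2) !subrK !eqxx.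
move=> x y /on_side[sw [sgn [t [ts ->]]]] /on_side[sw' [sgn' [t' [ts' ->]]]].
have -> : 328 * e = 164 * e + 164 * e by ring.
have [h _] := to_corner sw sgn t ts; have [_ h'] := to_corner sw' sgn' t' ts'.
exact: joins_trans h h'.
Qed.

End GoodSquare.

(** * Decay of areas *)

(** Hole filling: [(1 + C) a <= C (a + x) <= C t]. *)
Lemma ratio_step (R : realFieldType) (a x C t : R) : 0 < C -> a + x <= t ->
  a <= C * x -> a <= C / (1 + C) * t.
Proof.
move=> C0 h1 h2; have C1 : 0 < 1 + C by rewrite addr_gt0.
by rewrite mulrAC ler_pdivlMr//; nra.
Qed.

Section Decay.
Context {R : realType} {X : riemann_surface R}.
Variables (c : weighted_multicurve X) (rho : density X).
Hypotheses (cX : compact [set: X]) (ext : extremal_metric c rho) (area1 : area rho = 1%:E).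

Let arho : allowable rho. Proof. by case: ext. Qed.
Let mrho : measurable_density rho. Proof. exact: allowable_measurable_density arho. Qed.

Let area_on_le1 G : (area_on rho G <= 1%:E)%E.
Proof. by rewrite -area1 area_onT; exact: le_area_on. Qed.

Lemma area_ring_le (d : disc X) (r : R) (G : set X) : 3 * r < dradius d ->
  [set x | 2 * r < gauge d x < 3 * r] `<=` G ->
  (area_in rho (dchart d) [set x | (2 * r < gauge d x < 3 * r)%R] <= area_on rho G)%E.
Proof.
move=> rd sub.
have dom x : gauge d x < 3 * r -> chart_dom (dchart d) x.
  by move=> h; case: (gauge_lt (lt_trans h rd)).
apply: area_in_le_area_on => //; first exact: dchart_atlas.
- by move=> x /= /andP[_ /dom].
- have -> : [set x | 2 * r < gauge d x < 3 * r] =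
      chart_dom (dchart d) `&` [set x | gauge d x \in `](2 * r), (3 * r)[].
    apply/seteqP; split => x /=; rewrite in_itv/=.
      by move=> /[dup] /andP[_ /dom].
    by move=> [].
  apply: measurable_plane_coord_setI => //; first exact: dchart_atlas.
  apply: open_measurable2; apply: plane_coord_open => //; [exact: dchart_atlas|].
  exact: atlas_open (dchart_atlas d).
Qed.

(** Every ring has [rho]-area at most 1, so [good_square] with [e = 1] gives around each point a
    square with boundary arcs of finite length. *)
Let finite_length i : (curve_length rho (multicurve_curve (w := c) i) < +oo)%E.
Proof.
apply: curve_length_lty => //; last 2 first.
- exact: multicurve_closed.
- exact: multicurve_nontrivial.
move=> x; have [d gx] := exists_disc x; have d0 := dradius_gt0 d.
pose r := dradius d / 4.
have [r0 rd] : 0 < r /\ 3 * r < dradius d by rewrite /r; split; lra.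
have ar : (area_in rho (dchart d) [set x | (2 * r < gauge d x < 3 * r)%R] <= (1 ^+ 2)%:E)%E.
  by rewrite expr1n; apply: le_trans (area_ring_le rd (@subset_refl _ _)) (area_on_le1 _).
have [s [/andP[s1 s2] h]] := good_square mrho r0 rd ltr01 ar.
exists d, r, s, (328 * 1); split => //; rewrite ?gx//.
- by lra.
- exact: lt_trans s2 rd.
Qed.

(* 2048 comes from [area_competitor], 656 is twice the constant of [good_square]. *)
Definition decay_constant : R := 1 + 2048 * 4 * 656 ^+ 2.

Lemma decay_constant_gt0 : 0 < decay_constant.
Proof.
apply: ltr_pwDl; first exact: ltr01.
by apply: mulr_ge0; [apply: mulr_ge0; exact: ler0n|exact: sqr_ge0].
Qed.

(** Extremality gives [1 <= outer + ring + flat] and superadditivity gives [inner + outer <= 1], so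
    the inner area is at most the ring area plus the flat area, both bounded by multiples of
    [e ^ 2]. *)
Let inner_area_le_sqr (d : disc X) (r e : R) : 0 < r -> 4 * r <= dradius d -> 0 < e ->
  (area_on rho [set x | (r <= gauge d x < 4 * r)%R] <= (e ^+ 2)%:E)%E ->
  (area_on rho [set x | (gauge d x < r)%R] <= (decay_constant * e ^+ 2)%:E)%E.
Proof.
move=> r0 rd e0 ring_le.
have rd3 : 3 * r < dradius d by lra.
have rd2 : 2 * r < dradius d by lra.
have ar : (area_in rho (dchart d) [set x | (2 * r < gauge d x < 3 * r)%R] <= (e ^+ 2)%:E)%E.
  apply: le_trans ring_le; apply: area_ring_le => // x /= /andP[h1 h2].
  by apply/andP; split; lra.
have [s [/andP[s1 s2] bj]] := good_square mrho r0 rd3 e0 ar.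
have [K KE] : exists K : R, K = 656 by exists 656.
have K0 : 0 < K by rewrite KE ltr0n.
(* Makes [B * r = 2 * (328 * e)], the cost of two arcs of the short square; the flat area is then a
   multiple of [e ^ 2] independent of [r]. *)
pose B := K * e / r.
have B0 : 0 < B by rewrite divr_gt0// mulr_gt0.
have bB : 2 * (328 * e) <= B * r.
  by rewrite /B divfK ?gt_eqF// KE mulrA -natrM.
have acomp : allowable (competitor rho d r (2 * r) B).
  by apply: competitor_allowable => //; apply/andP; split => //; lra.
have le1 : (1%:E <= area (competitor rho d r (2 * r) B))%E.
  apply: (extremal_area_ge1 cX ext area1 finite_length acomp) => i.
  apply: (competitor_curve_length mrho r0 s1 _ (ltW B0) bB bj).
    exact: lt_trans s2 rd3.
  exact: multicurve_nontrivial.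
have r2r : 0 <= r <= 2 * r by apply/andP; split; lra.
have := le_trans le1 (area_competitor mrho r2r rd2 (ltW B0)).
have : (area_on rho [set x | (gauge d x < r)%R] + area_on rho [set x | (r <= gauge d x)%R] <= 1%:E)%E.
  apply: le_trans (area_on_setU _ _) (area_on_le1 _).
  by apply/seteqP; split => x //= []; rewrite leNgt => ->.
have : (area_on rho [set x | (r <= gauge d x <= 2 * r)%R] <= (e ^+ 2)%:E)%E.
  apply: le_trans ring_le; apply: le_area_on => x /= /andP[h1 h2].
  by apply/andP; split => //; lra.
have fin G : exists2 a : R, 0 <= a & area_on rho G = a%:E.
  have := area_on_le1 G; have := area_on_ge0 rho G.
  by case: (area_on rho G) => // a a0 _; exists a.
have [x _ ->] := fin [set x | (gauge d x < r)%R].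
have [y _ ->] := fin [set x | (r <= gauge d x)%R].
have [z _ ->] := fin [set x | (r <= gauge d x <= 2 * r)%R].
have [M ME] : exists M : R, M = 2048 by exists 2048.
rewrite /decay_constant -ME -KE -!EFinD !lee_fin => h1 h2.
have -> : M * B ^+ 2 * (2 * r) ^+ 2 = M * 4 * K ^+ 2 * e ^+ 2.
  by rewrite /B; field; rewrite gt_eqF.
rewrite mulrDl mul1r; move: (M * 4 * K ^+ 2 * e ^+ 2) (e ^+ 2) h1 h2 => k k'; lra.
Qed.

(** The construction needs [e > 0] while the ring may have zero area: the bound is proved for all
    [y > x] and passed to the limit. *)
Let inner_area_le (d : disc X) (r x : R) : 0 < r -> 4 * r <= dradius d -> 0 <= x ->
  area_on rho [set x | (r <= gauge d x < 4 * r)%R] = x%:E ->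
  (area_on rho [set x | (gauge d x < r)%R] <= (decay_constant * x)%:E)%E.
Proof.
move=> r0 rd x0 ringE; have C0 := decay_constant_gt0.
have key y : x < y -> (area_on rho [set x | (gauge d x < r)%R] <= (decay_constant * y)%:E)%E.
  move=> xy; have y0 : 0 < y by exact: le_lt_trans xy.
  rewrite -(sqr_sqrtr (ltW y0)); apply: inner_area_le_sqr => //; first by rewrite sqrtr_gt0.
  by rewrite ringE sqr_sqrtr ?lee_fin ltW.
apply/lee_addgt0Pr => t t0; have := key (x + t / decay_constant).
rewrite mulrDr mulrCA divff ?gt_eqF// mulr1 EFinD; apply.
by rewrite ltrDl divr_gt0.
Qed.

Definition decay_ratio : R := decay_constant / (1 + decay_constant).

(** Consecutive squares differ by the ring [r <= gauge d < 4 * r], so each step is one hole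
    filling. *)
Lemma area_decay (d : disc X) (n : nat) :
  (area_on rho [set x | (gauge d x < dradius d * 4^-1 ^+ n)%R] <= (decay_ratio ^+ n)%:E)%E.
Proof.
elim: n => [|n IH]; first by rewrite expr0; exact: area_on_le1.
set r := dradius d * 4^-1 ^+ n.+1.
have d0 := dradius_gt0 d.
have r0 : 0 < r by rewrite mulr_gt0// exprn_gt0// invr_gt0.
have r4 : 4 * r = dradius d * 4^-1 ^+ n.
  by rewrite /r exprS mulrCA mulVKf// pnatr_eq0.
have rd : 4 * r <= dradius d.
  by rewrite r4 ler_piMr ?(ltW d0)// exprn_ile1 ?invr_ge0// invf_le1// ler1n.
have fin G : exists2 a : R, 0 <= a & area_on rho G = a%:E.
  have := area_on_le1 G; have := area_on_ge0 rho G.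
  by case: (area_on rho G) => // a a0 _; exists a.
have [x x0 xE] := fin [set x | (r <= gauge d x < 4 * r)%R].
have := inner_area_le r0 rd x0 xE.
have : (area_on rho [set x | (gauge d x < r)%R] + area_on rho [set x | (r <= gauge d x < 4 * r)%R]
    <= (decay_ratio ^+ n)%:E)%E.
  apply: le_trans IH; rewrite -r4; apply: (le_trans (area_on_setU _ _)).
    by apply/seteqP; split => z //= [h1 /andP[]]; rewrite leNgt h1.
  apply: le_area_on => z /= [h1|/andP[]//]; first by lra.
rewrite xE; have [a a0 ->] := fin [set x | (gauge d x < r)%R].
rewrite -EFinD !lee_fin => h1 h2.
by rewrite exprS; exact: ratio_step decay_constant_gt0 h1 h2.
Qed.

Lemma decay_ratio_itv : 0 < decay_ratio < 1.
Proof.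
have C0 := decay_constant_gt0.
rewrite /decay_ratio; move: decay_constant C0 => C C0.
have C1 : 0 < 1 + C by rewrite addr_gt0.
by rewrite divr_gt0//= ltr_pdivrMr// mul1r ltrDr.
Qed.

End Decay.

(** * Averages over segments *)

Section UnitInterval.
Context {R : realType}.

(** Serves to run a segment backwards. The reflection preserves the closed interval but not the
    half-open one, hence the detour through [[0, 1]]. *)
Lemma integral_reflect (F : R -> \bar R) : measurable_fun `[(0 : R), 1]%classic F ->
  (forall t, 0 <= t <= 1 -> (0 <= F t)%E) ->
  (\int[lebesgue_measure]_(t in `]0%R, 1%R]%classic) F (1 - (t : R))%R =
   \int[lebesgue_measure]_(t in `]0%R, 1%R]%classic) F t)%E.
Proof.
move=> mF F0; pose g (t : measurableTypeR R) : measurableTypeR R := 1 - t.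
have mg : measurable_fun setT g by exact: measurable_funB.
pose nu : {measure set (measurableTypeR R) -> \bar R} :=
  measure_function_pushforward__canonical__measure_function_Measure (@lebesgue_measure R) mg.
have nuE A : measurable A -> lebesgue_measure A = nu A.
  move=> mA; apply: lebesgue_measure_unique => // _ [[x y]] /= _ <-.
  rewrite /pushforward (_ : g @^-1` _ = `[1 - y, 1 - x[%classic); last first.
    apply/seteqP; split => t; rewrite /preimage/g/= !in_itv/= => /andP[h1 h2];
    by apply/andP; split; lra.
  rewrite !lebesgue_measure_itv/= !lte_fin ltrD2l ltrN2; case: ifP => // _.
  by rewrite -!EFinB; congr EFin; ring.
have gE : g @^-1` `[0, 1]%classic = `[0, 1]%classic.
  apply/seteqP; split => t; rewrite /preimage/g/= !in_itv/= => /andP[h1 h2];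
  by apply/andP; split; lra.
have mFg : measurable_fun `[(0 : R), 1]%classic (F \o g).
  apply: (measurable_comp (F := `[(0 : R), 1]%classic)) => //.
    by move=> _ [t tI <-]; have : (g @^-1` `[0, 1]%classic) t by rewrite gE.
  exact: (measurable_funTS mg).
have sub : `](0 : R), 1]%classic `<=` `[0, 1]%classic.
  by move=> t /=; rewrite !in_itv/= => /andP[/ltW -> ->].
transitivity (\int[lebesgue_measure]_(t in `[0%R, 1%R]%classic) (F \o g) t)%E.
  by apply: integral_itv_obnd_cbnd; exact: measurable_funS mFg.
transitivity (\int[lebesgue_measure]_(t in `[0%R, 1%R]%classic) F t)%E; last first.
  by apply/esym/integral_itv_obnd_cbnd; exact: measurable_funS mF.
transitivity (\int[nu]_(t in `[0%R, 1%R]%classic) F t)%E; last first.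
  by apply: eq_measure_integral => A mA _; rewrite -nuE.
by rewrite ge0_integral_pushforward// ?gE// => t /set_mem; rewrite /= in_itv/=; exact: F0.
Qed.

(** The ratio 4 is that of the squares in [area_decay]: contraction by a [t] in [dyadic n] maps the
    whole square into the [n]-th one. *)
Definition dyadic (n : nat) : set R := `](4^-1 ^+ n.+1), (4^-1 ^+ n)]%classic.

Lemma bigcup_dyadic : \bigcup_n dyadic n = `]0, 1]%classic.
Proof.
have q0 : 0 < 4^-1 :> R by rewrite invr_gt0.
have q1 : 4^-1 <= 1 :> R by rewrite invf_le1// ler1n.
apply/seteqP; split => t.
  move=> [n _]; rewrite /dyadic/= !in_itv/= => /andP[h1 h2].
  by rewrite (lt_trans _ h1) ?exprn_gt0// (le_trans h2)// exprn_ile1// ltW.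
rewrite /= in_itv/= => /andP[t0 t1].
have ex : exists n, 4^-1 ^+ n.+1 < t.
  have [n hn] : exists n : nat, t^-1 < n%:R.
    exists (Num.truncn t^-1).+1; exact: truncnS_gt.
  exists n; rewrite exprVn -[t]invrK ltf_pV2 ?posrE ?exprn_gt0 ?invr_gt0//.
  apply: lt_le_trans hn _; rewrite -natrX ler_nat.
  exact: leq_trans (leqnSn n) (ltnW (ltn_expl n.+1 _)).
case: (ex_minnP ex) => n hn hmin; exists n => //; rewrite /dyadic/= in_itv/= hn/=.
case: n hn hmin => [|n] hn hmin; first by rewrite expr0.
by rewrite leNgt; apply/negP => /hmin; rewrite ltnn.
Qed.

Lemma trivIset_dyadic : trivIset setT dyadic.
Proof.
apply: ltn_trivIset => j i ij; apply/seteqP; split => // t [].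
rewrite /dyadic/= !in_itv/= => /andP[h1 h2] /andP[h3 h4].
have : t <= 4^-1 ^+ i.+1.
  apply: le_trans h4 _; have q0 : 0 <= 4^-1 :> R by rewrite invr_ge0 ler0n.
  have q1 : 4^-1 <= 1 :> R by rewrite invf_le1 ?ltr0n// ler1n.
  exact: (ler_wiXn2l q0 q1 ij).
by rewrite leNgt h1.
Qed.

Lemma geometric_sum_le (x : R) n : 0 <= x < 1 -> \sum_(0 <= i < n) x ^+ i <= (1 - x)^-1.
Proof.
move=> /andP[x0 x1]; have y0 : 0 < 1 - x by rewrite subr_gt0.
have -> : \sum_(0 <= i < n) x ^+ i = (1 - x ^+ n) / (1 - x).
  elim: n => [|n IH]; first by rewrite big_nil expr0 subrr mul0r.
  by rewrite big_nat_recr//= IH exprS; field; rewrite gt_eqF.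
by rewrite -[leRHS]mul1r ler_pM2r ?invr_gt0// gerBl exprn_ge0.
Qed.

(** The length of [dyadic n] is [3 / 4] of [4 ^- n], which cancels [4 ^ n] and leaves a geometric
    series of ratio [th]. *)
Lemma dyadic_integral_le (phi : R -> \bar R) (M th : R) : 0 <= M -> 0 <= th < 1 ->
  measurable_fun setT phi -> (forall t, (0 <= phi t)%E) ->
  (forall n t, dyadic n t -> (phi t <= (M * (4 ^+ n * th ^+ n))%:E)%E) ->
  (\int[lebesgue_measure]_(t in `]0%R, 1%R]%classic) phi t <= (M / (1 - th))%:E)%E.
Proof.
move=> M0 th01 mphi phi0 bnd; have /andP[th0 th1] := th01.
have mdy n : measurable (dyadic n : set (measurableTypeR R)) by exact: measurable_itv.
have mphi' : measurable_fun (\bigcup_n dyadic n : set (measurableTypeR R)) phi.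
  exact: measurable_funTS.
rewrite -bigcup_dyadic (ge0_integral_bigcup _ mdy mphi' (fun t _ => phi0 t) trivIset_dyadic).
have term n : (\int[lebesgue_measure]_(t in dyadic n) phi t <= (M * th ^+ n)%:E)%E.
  apply: (@le_trans _ _ (\int[lebesgue_measure]_(t in dyadic n) (cst (M * (4 ^+ n * th ^+ n))%:E) t)%E).
    apply: ge0_le_integral => //; first exact: measurable_funTS.
    exact: bnd.
  have q : 4^-1 ^+ n.+1 < 4^-1 ^+ n :> R.
    by rewrite exprS gtr_pMl ?exprn_gt0 ?invr_gt0// invf_lt1// ltr1n.
  have len : lebesgue_measure (dyadic n) = (4^-1 ^+ n - 4^-1 ^+ n.+1)%:E.
    have := lebesgue_measure_itv `](4^-1 ^+ n.+1 : R), (4^-1 ^+ n)].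
    by rewrite /= lte_fin q.
  rewrite (integral_cst _ (mdy n)) [X in (_ * X)%E]len -EFinM lee_fin.
  rewrite [4^-1 ^+ n.+1]exprS exprVn; have : 0 < 4 ^+ n :> R by rewrite exprn_gt0.
  have : 0 <= th ^+ n by rewrite exprn_ge0.
  move: (4 ^+ n) (th ^+ n) => k u u0 k0.
  have -> : M * (k * u) * (k^-1 - 4^-1 * k^-1) = (M * u) * (3 / 4).
    by field; rewrite gt_eqF.
  by rewrite ler_piMr ?mulr_ge0// ler_pdivrMr// mul1r ler_nat.
apply: lime_le; first by apply: is_cvg_nneseries => n _ _; exact: integral_ge0.
apply: nearW => n; apply: (@le_trans _ _ (\sum_(0 <= i < n) (M * th ^+ i)%:E)%E).
  exact: lee_sum.
rewrite sumEFin lee_fin -mulr_sumr; apply: ler_wpM2l => //.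
exact: geometric_sum_le.
Qed.

End UnitInterval.

Section PlaneMeasure.
Context {R : realType}.

(** A name for [lam2 R] that carries a sigma-finite structure, as Tonelli in [(t, w)] requires. *)
Definition plane_measure : set (plane R) -> \bar R := lam2 R.
HB.instance Definition _ := Measure.on plane_measure.

Let plane_measure_sigma_finite : sigma_finite setT plane_measure.
Proof.
exists (fun n : nat => ball (0 : R * R) n%:R).
  apply/seteqP; split => // z _; exists (Num.truncn `|z|).+1 => //.
  by rewrite -ball_normE/= sub0r normrN; exact: truncnS_gt.
move=> n; split; first by apply: open_measurable2; exact: ball_open.
by rewrite /plane_measure lam2_ball// ltry.
Qed.

HB.instance Definition _ :=
  Measure_isSigmaFinite.Build _ _ _ plane_measure plane_measure_sigma_finite.

End PlaneMeasure.

Section SegmentAverage.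
Context {R : realType} {X : riemann_surface R}.
Implicit Types (d : disc X) (rho : density X).

Lemma area_ball_le d rho (r : R) : measurable_density rho -> r <= dradius d ->
  (\int[lam2 R]_(z in [set z : R * R | (`|dcenter d - z| < r)%R])
     ((rho (dchart d) (z.1 +i* z.2)%C) ^+ 2)%:E <=
   area_on rho [set x | (gauge d x < r)%R])%E.
Proof.
move=> mrho rd.
have ballE : plane_coord (dchart d) @` [set x | gauge d x < r] =
    [set z | `|dcenter d - z| < r].
  apply/seteqP; split => [_ [x /= h <-]|z /= h].
    by have [_ <-] := gauge_lt (lt_le_trans h rd).
  have [_ e1 e2] := gauge_coord (le_trans (ltW h) rd).
  by exists (coord_inv (dchart d) z) => //=; rewrite e2.
rewrite -ballE; apply: area_in_le_area_on => //; first exact: dchart_atlas.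
- by move=> x /= h; case: (gauge_lt (lt_le_trans h rd)).
- rewrite ballE; apply: open_measurable2.
  have -> : [set z : R * R | `|dcenter d - z| < r] = ball (dcenter d) r by rewrite -ball_normE.
  exact: ball_open.
Qed.

(** Tonelli exchanges the integral along the segment with the one over its endpoint [w]. For [t] in
    [dyadic n] the points [p + t (w - p)] lie in the [n]-th square, of [rho]-area at most
    [th ^ (2 n)]; the expansion factor of order [4 ^ n] and the AM-GM bound give a multiple of
    [(4 th) ^ n], summable against [dt] because [th < 1]. *)
Lemma segment_average d rho (th b : R) (W : set (plane R)) :
  measurable_density rho -> 0 < th < 1 -> 0 <= b -> measurable W ->
  (forall n, (area_on rho [set x | (gauge d x < dradius d * 4^-1 ^+ n)%R] <=
     ((th ^+ 2) ^+ n)%:E)%E) ->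
  (forall w, W w -> `|dcenter d - (w : R * R)| < dradius d) -> (lam2 R W <= b%:E)%E ->
  exists F : plane R -> \bar R, [/\ measurable_fun setT F, forall w, (0 <= F w)%E,
    (\int[lam2 R]_(w in W) F w <= ((32 + b / 2) / (1 - th))%:E)%E
  & forall w, W w -> F w = (\int[lebesgue_measure]_(t in `]0%R, 1%R]%classic)
      (rho (dchart d) (toC (dcenter d + t *: ((w : R * R) - dcenter d))))%R%:E)%E].
Proof.
move=> mrho th01 b0 mW decay Wd Wb; have [th0 th1] := andP th01.
set p := dcenter d in Wd *; set psi := dchart d; have apsi := dchart_atlas d.
have d0 := dradius_gt0 d.
pose f (z : plane R) : R := rho psi (z.1 +i* z.2)%C.
pose G (x : measurableTypeR R * plane R) : plane R := (p + x.1 *: ((x.2 : R * R) - p) : R * R).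
pose DW : set (measurableTypeR R * plane R) := `](0 : R), 1]%classic `*` W.
have mDW : measurable DW by apply: measurableX => //; exact: measurable_itv.
have VG x : DW x -> (plane_coord psi @` chart_dom psi) (G x).
  move=> [/=]; rewrite in_itv/= => /andP[/ltW t0 t1] /Wd wd; apply: dsub.
  rewrite /G opprD addrA subrr add0r normrN normrZ (ger0_norm t0) distrC.
  by apply: le_trans (ltW wd); rewrite ler_piMl.
have mV := open_measurable2 (plane_coord_open apsi (atlas_open apsi) (@subset_refl _ _)).
have mG : measurable_fun setT G.
  have m1 : measurable_fun setT (fun x : measurableTypeR R * plane R => p.1 + x.1 * (x.2.1 - p.1)).
    apply: measurable_funD => //; apply: measurable_funM; first exact: measurable_fst.
    apply: measurable_funB => //.
    exact: (measurableT_comp measurable_fst measurable_snd).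
  have m2 : measurable_fun setT (fun x : measurableTypeR R * plane R => p.2 + x.1 * (x.2.2 - p.2)).
    apply: measurable_funD => //; apply: measurable_funM; first exact: measurable_fst.
    apply: measurable_funB => //.
    exact: (measurableT_comp measurable_snd measurable_snd).
  exact: (@measurable_fun_pairD R _ _ setT _ _ measurableT m1 m2).
have mf : measurable_fun (plane_coord psi @` chart_dom psi) f by exact: (mdensity_measurable mrho apsi).
pose H x : \bar R := ((fun x => `|f (G x)|%:E) \_ DW) x.
have H0 x : (0 <= H x)%E by rewrite /H patchE; case: ifP.
have mH : measurable_fun setT H.
  apply: (iffLR (measurable_restrictT _ mDW)); apply/measurable_EFinP.
  apply: measurableT_comp => //.
  apply: (measurable_comp mV _ mf); first by move=> _ [x Dx <-]; exact: VG.
  exact: (measurable_funTS mG).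
pose lam2s : {sigma_finite_measure set (plane R) -> \bar R} := plane_measure.
pose phi (t : measurableTypeR R) := fubini_F lam2s H t.
have phi0 t : (0 <= phi t)%E by apply: integral_ge0 => w _; exact: H0.
have mphi : measurable_fun setT phi by
  exact: (@measurable_fun_fubini_tonelli_F _ _ (measurableTypeR R) (plane R) R lam2s H mH H0).
have bnd n t : dyadic n t -> (phi t <= ((32 + b / 2) * (4 ^+ n * th ^+ n))%:E)%E.
  rewrite /dyadic/= in_itv/= => /andP[t1 t2].
  have q0 : 0 < 4^-1 ^+ n.+1 :> R by rewrite exprn_gt0// invr_gt0.
  have t0 : 0 < t by exact: lt_trans t1.
  have t01 : t <= 1.
    by apply: le_trans t2 _; rewrite exprn_ile1// ?invf_le1// ?ler1n// invr_ge0.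
  pose g (w : plane R) : plane R := (p + (t : R) *: ((w : R * R) - p) : R * R).
  have mg : measurable_fun setT g.
    have := @measurable_fun_pair2 _ _ _ (measurableTypeR R) (plane R) (plane R) G t mG.
    by [].
  pose B : set (plane R) := [set z : R * R | `|p - z| < dradius d * 4^-1 ^+ n].
  have qle : dradius d * 4^-1 ^+ n <= dradius d.
    by rewrite ler_piMr ?(ltW d0)// exprn_ile1// ?invf_le1// ?ler1n// invr_ge0.
  have mB : measurable B.
    apply: open_measurable2.
    have -> : B = ball p (dradius d * 4^-1 ^+ n) by rewrite -ball_normE.
    exact: ball_open.
  have WB : W `<=` g @^-1` B.
    move=> w /Wd wd; rewrite /B /preimage/= /g opprD addrA subrr add0r normrN normrZ (gtr0_norm t0) distrC.
    apply: (@lt_le_trans _ _ (t * dradius d)); first by rewrite ltr_pM2l.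
    by rewrite mulrC ler_pM2l.
  have expd (z w : R * R) : `|z - w| <= 4 ^+ n.+1 * `|(g z : R * R) - g w|.
    rewrite /g opprD addrACA subrr add0r -scalerBr opprB addrA subrK.
    rewrite normrZ (gtr0_norm t0) mulrA ler_peMl//.
    by rewrite -ler_pdivrMl ?exprn_gt0// mulr1 -exprVn ltW.
  (* This [k] balances the two terms of the AM-GM bound: with [L = 4 ^ n.+1] they become
     [32 (4 th) ^ n] and [(b / 2) (4 th) ^ n]. *)
  have k0 : 0 < th ^+ n * 4 ^+ n by rewrite mulr_gt0// exprn_gt0.
  have fB : (\int[lam2 R]_(z in B) (f z ^+ 2)%:E <= ((th ^+ 2) ^+ n)%:E)%E.
    exact: le_trans (area_ball_le mrho qle) (decay n).
  have mfB : measurable_fun B f.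
    apply: measurable_funS mf => //.
    by move=> z /= h; apply: dsub; exact: le_trans (ltW h) qle.
  have L0 : 0 <= 4 ^+ n.+1 :> R by rewrite exprn_ge0.
  have := @integral_expanding_amgm R W B g (4 ^+ n.+1) (th ^+ n * 4 ^+ n) f
    ((th ^+ 2) ^+ n) b L0 k0 mW mB mg expd WB mfB fB Wb.
  have -> : 2 * (4 ^+ n.+1) ^+ 2 * (th ^+ 2) ^+ n / (th ^+ n * 4 ^+ n) + th ^+ n * 4 ^+ n * b / 2 =
      (32 + b / 2) * (4 ^+ n * th ^+ n).
    rewrite (exprAC th 2 n) [4 ^+ n.+1]exprS; have k1 : 0 < th ^+ n by rewrite exprn_gt0.
    have c0 : 0 < 4 ^+ n :> R by rewrite exprn_gt0.
    move: (th ^+ n) (4 ^+ n) k1 c0 {k0} => u v u0 v0.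
    by field; rewrite (gt_eqF u0) (gt_eqF v0).
  apply: le_trans; rewrite /phi /fubini_F integral_mkcond.
  rewrite le_eqVlt; apply/orP; left; apply/eqP; rewrite -integral_mkcond [RHS]integral_mkcond.
  apply: eq_integral => w _; rewrite /H !patchE.
  suff -> : ((t, w) \in DW) = (w \in W) by [].
  apply/idP/idP => /set_mem.
    by move=> [_ Ww]; exact: mem_set.
  by move=> Ww; apply: mem_set; split => //=; rewrite in_itv/= t0.
have M0 : 0 <= 32 + b / 2 by rewrite addr_ge0// divr_ge0.
have th01' : 0 <= th < 1 by rewrite (ltW th0).
have tot := dyadic_integral_le M0 th01' mphi phi0 bnd.
have mGH : measurable_fun setT (fubini_G (@lebesgue_measure R) H).
  exact: (@measurable_fun_fubini_tonelli_G _ _ (measurableTypeR R) (plane R) R (@lebesgue_measure R) H mH H0).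
exists (fubini_G (@lebesgue_measure R) H); split.
- exact: mGH.
- by move=> w; apply: integral_ge0 => t _; exact: H0.
- apply: (@le_trans _ _ (\int[lam2 R]_w fubini_G (@lebesgue_measure R) H w)%E).
    apply: ge0_subset_integral => //.
    by move=> w _; apply: integral_ge0 => t _; exact: H0.
  have -> : (\int[lam2 R]_w fubini_G (@lebesgue_measure R) H w = \int[lebesgue_measure]_t phi t)%E.
    by rewrite -(@fubini_tonelli2 _ _ (measurableTypeR R) (plane R) R (@lebesgue_measure R) lam2s H mH H0)
      (@fubini_tonelli1 _ _ (measurableTypeR R) (plane R) R (@lebesgue_measure R) lam2s H mH H0).
  apply: le_trans tot; rewrite [leRHS]integral_mkcond le_eqVlt; apply/orP; left; apply/eqP.
  apply: eq_integral => t _; rewrite patchE; case: ifPn => // tI.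
  apply: integral0_eq => w _; rewrite /H patchE ifF//; apply/negbTE.
  by apply: contra tI => /set_mem[h _]; exact: mem_set.
- move=> w Ww; rewrite [RHS]integral_mkcond; apply: eq_integral => t _.
  rewrite /H !patchE.
  have -> : ((t, w) \in DW) = (t \in `]0, 1]%classic).
    apply/idP/idP => /set_mem.
      by move=> [tI _]; exact: mem_set.
    by move=> tI; apply: mem_set; split.
  case: ifPn => // /set_mem tI.
  have Vx : (plane_coord psi @` chart_dom psi) (G (t, w)) by apply: VG; split.
  have [D e] := plane_coordK apsi Vx; congr EFin.
  have := mdensity_ge0 mrho apsi D; rewrite -/psi -[psi _]ofCK -plane_coordE e.
  by move=> h; rewrite /f ger0_norm.
Qed.

End SegmentAverage.

(** * Conclusion *)

Section LocalJoins.
Context {R : realType} {X : riemann_surface R}.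
Hypothesis cX : compact [set: X].

(** [D] is fixed before [c] and [rho]. Both directions are kept, so that symmetry in [x] and [y] is
    immediate. *)
Definition uniformly_joined (x y : X) (D : R) :=
  forall (c : weighted_multicurve X) (rho : density X),
    extremal_metric c rho -> area rho = 1%:E ->
    joins rho setT x y D /\ joins rho setT y x D.

Lemma uniformly_joined_trans x y z D D' : uniformly_joined x y D ->
  uniformly_joined y z D' -> uniformly_joined x z (D + D').
Proof.
move=> h h' c rho ext a1; have [h1 h2] := h c rho ext a1; have [h1' h2'] := h' c rho ext a1.
by split; [|rewrite addrC]; [exact: joins_trans h1 h1'|exact: joins_trans h2' h2].
Qed.

Lemma uniformly_joined_sym x y D : uniformly_joined x y D -> uniformly_joined y x D.
Proof. by move=> h c rho ext a1; have [h1 h2] := h c rho ext a1. Qed.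

Lemma uniformly_joined_le x y D D' : D <= D' ->
  uniformly_joined x y D -> uniformly_joined x y D'.
Proof.
by move=> DD h c rho ext a1; have [h1 h2] := h c rho ext a1; split;
   [move: h1|move: h2]; exact: joins_weaken.
Qed.

(* A common point w of the square is reached from x and from y by segments whose
   rho-length is bounded on average over w. *)
Lemma square_joined (d : disc X) : exists D : R, forall x y,
  gauge d x < dradius d / 4 -> gauge d y < dradius d / 4 -> uniformly_joined x y D.
Proof.
set R0 := dradius d; have d0 : 0 < R0 := dradius_gt0 d.
set psi := dchart d; have apsi : atlas psi := dchart_atlas d.
(* [decay_ratio] governs areas, and its square root the corresponding lengths. *)
pose th : R := Num.sqrt (@decay_ratio R).
have /andP[q0 q1] := @decay_ratio_itv R.
have th2 : th ^+ 2 = @decay_ratio R by rewrite sqr_sqrtr// ltW.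
have th0 : 0 < th by rewrite sqrtr_gt0.
have th1 : th < 1 by rewrite -(@ltr_pXn2r _ 2)// ?nnegrE ?ler01 ?(ltW th0)// th2 expr1n.
pose b := 4 * (R0 / 4) ^+ 2.
have b0 : 0 < b by rewrite mulr_gt0// exprn_gt0// divr_gt0.
pose K := (32 + b / 2) / (1 - th).
have K0 : 0 <= K.
  by rewrite divr_ge0 ?subr_ge0 ?(ltW th1)// addr_ge0// divr_ge0// ltW.
(* The two functions to be averaged have total integral at most [2 * K] over a set of measure [b];
   the added 1 makes [2 * K < M * b] strict. *)
pose M := (2 * K + 1) / b.
have M0 : 0 <= M by rewrite divr_ge0 ?(ltW b0)// addr_ge0// mulr_ge0.
(* A square contained in the squares of radius [R0 / 2] about both [x] and [y], as these are within
   [R0 / 4] of the centre. *)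
pose W : set (plane R) := ball (dcenter d) (R0 / 4).
have mW : measurable W by apply: open_measurable2; exact: ball_open.
have Wb : lam2 R W = b%:E by rewrite lam2_ball// divr_ge0// ltW.
exists (R0 * M + R0 * M) => x y gx gy c rho ext a1.
have mrho : measurable_density rho by case: ext => /allowable_measurable_density.
have half z : gauge d z < R0 / 4 -> exists F : plane R -> \bar R,
    [/\ measurable_fun setT F, forall w, (0 <= F w)%E, (\int[lam2 R]_(w in W) F w <= K%:E)%E
      & forall w, W w -> (F w <= M%:E)%E ->
        joins rho setT z (coord_inv psi w) (R0 * M) /\
        joins rho setT (coord_inv psi w) z (R0 * M)].
  move=> gz; have gz2 : gauge d z <= R0 / 2.
    by apply: le_trans (ltW gz) _; rewrite ler_pM2l// lef_pV2 ?posrE// ler_nat.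
  have gzd : gauge d z < dradius d.
    by apply: le_lt_trans gz2 _; rewrite ltr_pdivrMr// ltr_pMr// ltr1n.
  have [Dz gzE] := gauge_lt gzd.
  have [d' [e1 e2 e3]] := exists_subdisc gz2.
  set p := plane_coord psi z in e2.
  have Wd w : W w -> `|dcenter d' - (w : R * R)| < dradius d'.
    rewrite /W -ball_normE/= => cw; rewrite e2 e3 -/R0 (_ : R0 / 2 = R0 / 4 + R0 / 4); last by field.
    apply: le_lt_trans (ler_distD (dcenter d) _ _) _; apply: ltrD => //.
    by rewrite distrC -/psi in gzE *; rewrite -gzE.
  have dec n : (area_on rho [set x | (gauge d' x < dradius d' * 4^-1 ^+ n)%R] <=
      ((th ^+ 2) ^+ n)%:E)%E.
    by rewrite th2; exact: (area_decay cX ext a1).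
  have thI : 0 < th < 1 by rewrite th0.
  have Wb' : (lam2 R W <= b%:E)%E by rewrite Wb.
  have [F [mF F0 FK FE]] := segment_average mrho thI (ltW b0) mW dec Wd Wb'.
  exists F; split => // w Ww; rewrite FE// e1 e2 -/psi => FM.
  have {}Ww := Wd _ Ww; rewrite e2 e3 -/R0 in Ww.
  have sub t : 0 <= t <= 1 -> (plane_coord psi @` chart_dom psi) (p + t *: ((w : R * R) - p)).
    move=> /andP[t0 t1]; have := @dsub _ _ d' (p + t *: ((w : R * R) - p)).
    rewrite e1 e2 e3; apply; rewrite opprD addrA subrr add0r normrN normrZ (ger0_norm t0) distrC.
    by apply: le_trans (ltW Ww); rewrite ler_piMl.
  have zE : z = coord_inv psi p by rewrite coord_invK.
  (* The segments have sup norm at most [R0 / 2], and the 2 is the factor in [segment_joins]. *)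
  have RM : R0 * M = (2 * (R0 / 2)) * M by congr (_ * _); field.
  have I0 : (0 <= \int[lebesgue_measure]_(t in `]0%R, 1%R]%classic)
      (rho psi (toC (p + t *: ((w : R * R) - p))))%R%:E)%E.
    apply: integral_ge0 => t; rewrite /= in_itv/= => /andP[/ltW t0 t1].
    have [D e] := plane_coordK apsi (sub t (introT andP (conj t0 t1))).
    by have := mdensity_ge0 mrho apsi D; rewrite -[psi _]ofCK -plane_coordE e lee_fin.
  have bound (v : R * R) : `|v| <= R0 / 2 -> ((2 * `|v|)%:E *
      \int[lebesgue_measure]_(t in `]0%R, 1%R]%classic)
      (rho psi (toC (p + t *: ((w : R * R) - p))))%R%:E <= (R0 * M)%:E)%E.
    move=> vR; rewrite RM [leRHS]EFinM; apply: lee_pmul => //.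
    by rewrite lee_fin ler_wpM2l.
  rewrite zE; split.
    apply: segment_joins => //; first by move=> t /sub h; split.
    by apply: bound; rewrite distrC ltW.
  have rev t : (w : R * R) + t *: (p - w) = p + (1 - t) *: ((w : R * R) - p).
    rewrite scalerBl scale1r addrCA addrA subrK -scalerN opprB.
    by rewrite addrC.
  apply: segment_joins => //.
    move=> t /andP[t0 t1]; rewrite rev; split => //; apply: sub.
    by rewrite subr_ge0 t1 gerBl t0.
  under eq_integral do rewrite rev.
  rewrite (@integral_reflect R (fun t => (rho psi (toC (p + t *: ((w : R * R) - p))))%:E)).
  - by apply: bound; rewrite ltW.
  - apply: measurable_density_segment => // t; rewrite /= in_itv/=; exact: sub.
  - move=> t t01; have [D e] := plane_coordK apsi (sub t t01).
    by have := mdensity_ge0 mrho apsi D; rewrite -[psi _]ofCK -plane_coordE e lee_fin.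
have [F [mF F0 FK FM]] := half x gx; have [F' [mF' F0' FK' FM']] := half y gy.
have [||||||w Ww wM] := @exists_le_average _ _ R (lam2 R) W (fun w => (F w + F' w)%E) (2 * K) M b mW.
- by apply: measurable_funTS; exact: emeasurable_funD.
- by move=> w _; exact: adde_ge0.
- exact: Wb.
- rewrite ge0_integralD//; [|exact: measurable_funTS|exact: measurable_funTS].
  by rewrite (_ : 2 * K = K + K) ?EFinD; [exact: leeD|ring].
- by [].
- by rewrite /M divfK ?gt_eqF// ltrDl.
have [h1 h2] := FM _ Ww (le_trans (leeDl _ (F0' _)) wM).
have [h1' h2'] := FM' _ Ww (le_trans (leeDr _ (F0 _)) wM).
by split; [exact: joins_trans h1 h2'|exact: joins_trans h1' h2].
Qed.

(** The bound first depends on [y]: connectedness gives its existence, compactness its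
    uniformity. *)
Lemma all_uniformly_joined (x0 : X) : exists D : R, forall y, uniformly_joined x0 y D.
Proof.
have nbr x : exists2 U, open_nbhs x U & exists D, forall y z, U y -> U z -> uniformly_joined y z D.
  have [d gx] := exists_disc x; have [D hD] := square_joined d.
  exists [set y | gauge d y < dradius d / 4]; last by exists D => y z; exact: hD.
  split; last by rewrite /= gx divr_gt0// dradius_gt0.
  apply: (open_comp (f := gauge d) (D := [set y | y < dradius d / 4])) => //.
  - by move=> z _; exact: gauge_continuous.
pose A := [set y | exists D, uniformly_joined x0 y D].
have AT : A = setT.
  apply: (@surface_connected _ X).
  - have [U [_ Ux] [D hD]] := nbr x0; by exists x0, D; exact: hD.
  - exists A; last by rewrite setTI.
    rewrite openE => y [D hy]; have [U [oU Uy] [D' hD']] := nbr y.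
    apply: (@filterS _ (nbhs y) _ U); last exact: open_nbhs_nbhs.
    by move=> z Uz; exists (D + D'); apply: uniformly_joined_trans hy (hD' _ _ Uy Uz).
  - exists A; last by rewrite setTI.
    move=> y cy; have [U oU [D' hD']] := nbr y.
    have [z [[D hz] Uz]] := cy _ (open_nbhs_nbhs oU).
    by exists (D + D'); apply: uniformly_joined_trans hz (hD' _ _ Uz oU.2).
suff [D hD] : exists D, forall y, [set: X] y -> uniformly_joined x0 y D.
  by exists D => y; exact: hD.
apply: (@compact_induction X setT (fun B => exists D, forall y, B y -> uniformly_joined x0 y D) cX).
- by exists 0.
- by move=> B B' BB [D hD]; exists D => y /BB; exact: hD.
- move=> B B' [D hD] [D' hD']; exists (Num.max D D') => y [/hD|/hD'];
  by apply: uniformly_joined_le; rewrite le_max lexx ?orbT.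
- move=> y _; have [U oU [D' hD']] := nbr y; exists U; first exact: open_nbhs_nbhs.
  have [D hy] : A y by rewrite AT.
  by exists (D + D') => z Uz; apply: uniformly_joined_trans hy (hD' _ _ oU.2 Uz).
Qed.

End LocalJoins.

(** [X] is the image of the closed unit disc under the gluing map followed by the marking. *)
Lemma compact_surface (R : realType) (g : nat) (S : topologicalType)
    (X : marked_surface R S) : closed_orientable_surface R g S -> compact [set: X].
Proof.
move=> [_ [q [cq surj _]]]; have [cm [m' [_ _ mK]]] := marking_homeo X.
have cD : compact (@unit_disc R).
  apply: (@subclosed_compact _ _ [set z : R * R | `|0 - z| <= 1]).
  - rewrite (_ : @unit_disc R = (fun z : R * R => z.1 ^+ 2 + z.2 ^+ 2) @^-1` [set t | t <= 1])//.
    apply: preimage_closed; last exact: num_normedtype.closed_le.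
    move=> z _; apply: (@cvgD _ _ _ (nbhs z) _ (fun z => z.1 ^+ 2) (fun z => z.2 ^+ 2)).
      by apply: (@cvgM _ _ (nbhs z) _ (fun z => z.1) (fun z => z.1)); exact: continuous_fst_plane.
    by apply: (@cvgM _ _ (nbhs z) _ (fun z => z.2) (fun z => z.2)); exact: continuous_snd_plane.
  - exact: compact_square.
  - move=> z /= h; rewrite sub0r normrN prod_normE/= ge_max.
    have le1 (t : R) : t ^+ 2 <= 1 -> `|t| <= 1.
      by move=> t1; rewrite -(@ler_pXn2r _ 2)// ?nnegrE// real_normK ?num_real// expr1n.
    by rewrite !le1//; apply: le_trans h; rewrite ?lerDl ?lerDr sqr_ge0.
have -> : [set: X] = (marking X) @` (q @` @unit_disc R).
  apply/seteqP; split => // x _; have [z Dz qz] := surj (m' x).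
  by exists (q z); [exists z|rewrite qz mK].
apply: continuous_compact; first by apply: continuous_subspaceT.
exact: continuous_compact.
Qed.

Theorem theorem1p4 (R : realType) (g : nat) (hg : (2 <= g)%N)
    (S : topologicalType) (hS : closed_orientable_surface R g S)
    (X : marked_surface R S) :
  exists D : R, 0 < D /\
    forall (c : weighted_multicurve X) (rho : density X),
      extremal_metric c rho -> area rho = 1%:E ->
      forall x y : X, (rho_dist rho x y <= D%:E)%E.
Proof.
have cX : compact [set: X] := @compact_surface R g S X hS.
have [[x0]|noX] := pselect (exists x : X, True); last first.
  by exists 1; split => // c rho _ _ x; exfalso; apply: noX; exists x.
move=> _; have [D hD] := all_uniformly_joined cX x0.
(* Any two points are joined through [x0], at cost [D + D]; the maximum with 1 makes the bound
   positive. *)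
exists (Num.max 1 (D + D)); split; first by rewrite lt_max ltr01.
move=> c rho ext a1 x y.
have [h _] := uniformly_joined_trans (uniformly_joined_sym (hD x)) (hD y) ext a1.
have [f [cf f0 f1 _ [l hl lD]]] := h 0 1 ltr01.
apply: (@le_trans _ _ (path_length rho f)); first by apply: ereal_inf_lbound; exists f.
apply: (@le_trans _ _ l); first exact: ereal_inf_lbound.
by apply: le_trans lD _; rewrite lee_fin le_max lexx orbT.
Qed.
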